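(* For every $n\in\{3,4,5\}$, the quotient space $\mathrm{LSP}(n)/\mathrm{Aff}(\mathbb{C})$ of the space $\mathrm{LSP}(n)$ of simple $n$-gons in the plane (with vertices labelled in counter-clockwise order) by the action of the group $\mathrm{Aff}(\mathbb{C})$, equipped with the quotient topology, is homeomorphic to $\mathbb{R}^{2n-4}$.
   Context: A simple $n$-gon with vertices labelled in counter-clockwise order is a tuple $(w_1,\ldots,w_n)\in\mathbb{C}^n$ such that the closed polygonal curve that traverses in order the straight line segments $[w_1,w_2],[w_2,w_3],\ldots,[w_{n-1},w_n],[w_n,w_1]$ (each of them non-degenerate) is simple, i.e. is an injective image of the circle $S^1$, and is oriented counter-clockwise around the bounded region that it encloses. Interior angles equal to $\pi$ at the vertices are allowed. The set $\mathrm{LSP}(n)\subset\mathbb{C}^n$ of all such tuples is given the subspace topology from $\mathbb{C}^n$. $\mathrm{Aff}(\mathbb{C})=\{z\mapsto az+b : a\in\mathbb{C}\setminus\{0\},\ b\in\mathbb{C}\}$ is the group of complex affine transformations (orientation-preserving similarities of the plane). It acts on $\mathrm{LSP}(n)$ by $h\cdot(w_1,\ldots,w_n)=(h(w_1),\ldots,h(w_n))$. *)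

(* Defs.v *)
From HB Require Import structures.
From mathcomp Require Import all_boot all_order all_algebra.
From mathcomp Require Import generic_quotient.
From mathcomp Require Import all_classical all_reals all_analysis.
From mathcomp Require Import complex.

Set Implicit Arguments.
Unset Strict Implicit.
Unset Printing Implicit Defensive.

Import Order.TTheory GRing.Theory Num.Theory.
Import numFieldNormedType.Exports.

Local Open Scope classical_set_scope.
Local Open Scope ring_scope.
Local Open Scope complex_scope.

Definition homeomorphic (T U : topologicalType) : Prop :=
  exists (f : T -> U) (g : U -> T),
    [/\ continuous f, continuous g, cancel f g & cancel g f].

(* R[i]^o is R[i] equipped with the topology and norm given by the modulus.   *)

(* The winding number, by a continuous choice theta of the argument of        *)
(* gamma t - p along the closed curve gamma : [a, b] -> C.                    *)
Definition has_winding_number (R : realType) (gamma : R -> R[i]^o) (a b : R)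
    (p : R[i]^o) (m : int) : Prop :=
  ~ (gamma @` `[a, b]) p /\
  exists theta : R -> R,
    [/\ {within `[a, b], continuous theta},
        {in `[a, b], forall t,
          gamma t - p = `|gamma t - p| * (cos (theta t) +i* sin (theta t))}
      & theta b - theta a = 2 * pi * m%:~R].

Section Polygons.
Variables (R : realType) (n : nat).
Implicit Types (w : 'rV[R[i]^o]_n) (D : set R[i]^o).

(* Vertices are numbered from 0 and indexed cyclically: the index k is read   *)
(* modulo n, so that vertex w n = vertex w 0. (The default 0 is reached only  *)
(* for n = 0.)                                                                *)
Definition vertex w (k : nat) : R[i]^o :=
  if insub (k %% n)%N is Some i then w 0 i else 0.

(* For t in [k, k+1], traverses the segment from vertex k to vertex k+1; the  *)
(* closed polygonal curve is the restriction to [0, n].                       *)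
Definition polygon_curve w (t : R) : R[i]^o :=
  let k := Num.truncn t in
  let s := t - k%:R in
  (1 - s)%:C * vertex w k + s%:C * vertex w k.+1.

Definition polygon_trace w : set R[i]^o := polygon_curve w @` `[0, n%:R].

(* The circle is [0, n] with its endpoints identified, hence injectivity on   *)
(* the half-open interval.                                                    *)
Definition simple_polygon w : Prop :=
  (forall k, vertex w k != vertex w k.+1) /\
  set_inj `[0, n%:R[ (polygon_curve w).

Definition bounded_region w D : Prop :=
  bounded_set D /\
  exists2 p, (~` polygon_trace w) p &
    D = connected_component (~` polygon_trace w) p.

(* By the Jordan curve theorem the region D of a simple polygon is unique.    *)
Definition counterclockwise w : Prop :=
  exists2 D, bounded_region w D &
    forall p, D p -> has_winding_number (polygon_curve w) 0 n%:R p 1.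

Definition LSP : set 'rV[R[i]^o]_n :=
  [set w | simple_polygon w /\ counterclockwise w].

Definition Aff : set (R[i]^o -> R[i]^o) :=
  [set h | exists a b : R[i]^o, a != 0 /\ forall z, h z = a * z + b].

Definition same_Aff_orbit (x y : LSP) : bool :=
  `[< exists2 h, Aff h & set_val y = map_mx h (set_val x) >].

Lemma same_Aff_orbit_refl : reflexive same_Aff_orbit.
Proof.
move=> x; apply/asboolP; exists id; last by rewrite map_mx_id.
by exists 1, 0; split=> [|z]; rewrite ?oner_eq0// mul1r addr0.
Qed.

Lemma same_Aff_orbit_sym : symmetric same_Aff_orbit.
Proof.
suff H x y : same_Aff_orbit x y -> same_Aff_orbit y x.
  by move=> x y; apply/idP/idP; exact: H.
move=> /asboolP[h [a [b [a0 hE]]] yE]; apply/asboolP.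
exists (fun z => a^-1 * z + - (a^-1 * b)).
  by exists a^-1, (- (a^-1 * b)); rewrite invr_eq0.
rewrite yE -map_mx_comp; apply/matrixP => i j; rewrite mxE /= hE.
by rewrite mulrDr mulKf// addrK.
Qed.

Lemma same_Aff_orbit_trans : transitive same_Aff_orbit.
Proof.
move=> y x z /asboolP[h [a [b [a0 hE]]] yE] /asboolP[k [c [d [c0 kE]]] zE].
apply/asboolP; exists (k \o h); last by rewrite zE yE map_mx_comp.
exists (c * a), (c * b + d); split=> [|u]; first by rewrite mulf_neq0.
by rewrite /= kE hE mulrDr mulrA addrA.
Qed.

Canonical same_Aff_orbit_equiv := EquivRel same_Aff_orbit
  same_Aff_orbit_refl same_Aff_orbit_sym same_Aff_orbit_trans.

Definition LSP_mod_Aff : topologicalType :=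
  quotient_topology {eq_quot same_Aff_orbit}%qT.

End Polygons.

(* Main.v *)
(* A simple polygon with at most five vertices is star-shaped, so that LSP(n)
   consists of the w such that, for some p, all the triangles p, w_k, w_(k+1)
   are positively oriented and the angles at p sum up to 2 pi. For five vertices
   this follows from an inspection of the possible orientations of the ten
   triangles spanned by the vertices.

   A triangle is determined up to Aff(C) by (w_2 - w_0) / (w_1 - w_0) in the
   upper half-plane. A quadrilateral is determined by the ratio of its
   diagonals, again in the upper half-plane, and by the point (x, y) locating
   the intersection of the diagonals on both of them; this point ranges over the
   cross min(|x|, |y|) < 1, a star-shaped domain.

   For a pentagon let p be the analytic center of the kernel (the maximum of the
   product of the areas A_k of the triangles p, w_k, w_(k+1)), which depends
   continuously on w, and put z_k = w_k - p. The angles alpha_k between z_k and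
   z_(k+1) range over an open convex subset of R^4. As 5 is odd there are unique
   sigma_k > 0 such that y_k = sigma_k z_k satisfies det(y_k, y_(k+1)) = 1, and
   y is determined by alpha up to a rotation. The criticality of p says that
   sum_k (sigma_(k-1) - sigma_(k+1)) y_k = 0: a linear condition on the
   differences, which determine sigma up to an additive constant and hence,
   after division by min sigma, determine sigma / min sigma. For fixed y these
   differences fill a plane, the fibre of a vector bundle for which an explicit
   trivialization is given. *)

Require Import Defs.
From mathcomp Require Import all_boot all_order all_algebra.
From mathcomp Require Import generic_quotient.
From mathcomp Require Import all_classical all_reals all_analysis.
From mathcomp Require Import complex.
From mathcomp Require Import ring lra zify.

Set Implicit Arguments.
Unset Strict Implicit.
Unset Printing Implicit Defensive.

Import Order.TTheory GRing.Theory Num.Theory.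
Import numFieldNormedType.Exports.

Local Open Scope classical_set_scope.
Local Open Scope ring_scope.
Local Open Scope complex_scope.

Local Notation Re := (@complex.Re _).
Local Notation Im := (@complex.Im _).

(** The definition of orientation speaks of a bounded component and of a lift of the argument. Both
    are made computable by [winding], a finite sum of principal arguments which lies in 2 pi Z and
    is locally constant off the curve; a component where it is not 0 cannot reach infinity and so is
    bounded. Signs of areas determine a polygon only up to reflection, and the wrong orientation is
    excluded by conjugation, as a star-shaped curve has no winding numbers other than 0 and 1. Each
    homeomorphism is an explicit pair of continuous maps, a chart on polygons and a section with
    values in polygons, inverse to each other up to Aff(C). For pentagons the obstacle is to choose
    a point of the kernel continuously and equivariantly: the continuity of the center follows from
    an inequality which bounds the distance to the center by the size of the gradient. The plane of
    differences is identified with a fixed plane along the positive part of the functional that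
    defines it: this vector has nonnegative entries, not all 0, and therefore lies in neither
    plane. *)

Section ComplexTopology.
Variable R : realType.
Implicit Types z : R[i].

Lemma normc_leP z (e : R) :
  (`|z| < e%:C) = (Num.sqrt (Re z ^+ 2 + Im z ^+ 2) < e).
Proof. by rewrite normc_def ltcR. Qed.

Lemma ler_Re_sqrt z : `|Re z| <= Num.sqrt (Re z ^+ 2 + Im z ^+ 2).
Proof. by rewrite -sqrtr_sqr ler_sqrt ?addr_ge0 ?sqr_ge0// lerDl sqr_ge0. Qed.

Lemma ler_Im_sqrt z : `|Im z| <= Num.sqrt (Re z ^+ 2 + Im z ^+ 2).
Proof. by rewrite -sqrtr_sqr ler_sqrt ?addr_ge0 ?sqr_ge0// lerDr sqr_ge0. Qed.

Lemma cvg_Re (F : set_system R[i]^o) (FF : Filter F) (z : R[i]^o) :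
  F --> z -> (Re : R[i]^o -> R) @ F --> Re z.
Proof.
move=> Fz; apply/cvgrPdist_lt => e e0.
have e0C : (0 : R[i]) < e%:C by rewrite ltcR.
move/cvgrPdist_lt : Fz => /(_ _ e0C); apply: filterS => u.
by rewrite normc_leP; apply: le_lt_trans; rewrite -raddfB; exact: ler_Re_sqrt.
Qed.

Lemma continuous_Re : continuous (Re : R[i]^o -> R).
Proof. by move=> z; exact: (@cvg_Re (nbhs z) (nbhs_filter z)). Qed.

Lemma cvg_Im (F : set_system R[i]^o) (FF : Filter F) (z : R[i]^o) :
  F --> z -> (Im : R[i]^o -> R) @ F --> Im z.
Proof.
move=> Fz; apply/cvgrPdist_lt => e e0.
have e0C : (0 : R[i]) < e%:C by rewrite ltcR.
move/cvgrPdist_lt : Fz => /(_ _ e0C); apply: filterS => u.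
by rewrite normc_leP; apply: le_lt_trans; rewrite -raddfB; exact: ler_Im_sqrt.
Qed.

Lemma continuous_Im : continuous (Im : R[i]^o -> R).
Proof. by move=> z; exact: (@cvg_Im (nbhs z) (nbhs_filter z)). Qed.

Lemma cvg_Re_comp (T : Type) (F : set_system T) {FF : Filter F}
    (f : T -> R[i]^o) (z : R[i]^o) : f x @[x --> F] --> z ->
  Re (f x) @[x --> F] --> Re z.
Proof. by move=> fz; apply: continuous_cvg fz; exact: continuous_Re. Qed.

Lemma cvg_Im_comp (T : Type) (F : set_system T) {FF : Filter F}
    (f : T -> R[i]^o) (z : R[i]^o) : f x @[x --> F] --> z ->
  Im (f x) @[x --> F] --> Im z.
Proof. by move=> fz; apply: continuous_cvg fz; exact: continuous_Im. Qed.

Lemma normc_le_add z : Num.sqrt (Re z ^+ 2 + Im z ^+ 2) <= `|Re z| + `|Im z|.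
Proof.
rewrite -[leRHS]ger0_norm ?addr_ge0// -sqrtr_sqr ler_sqrt ?sqr_ge0//.
rewrite sqrrD !real_normK ?num_real//.
by rewrite lerD2r lerDl mulrn_wge0 ?mulr_ge0.
Qed.

Lemma cvg_complex (T : Type) (F : set_system T) {FF : Filter F}
    (f g : T -> R) (a b : R) :
  f x @[x --> F] --> a -> g x @[x --> F] --> b ->
  (fun x => f x +i* g x : R[i]^o) x @[x --> F] --> (a +i* b : R[i]^o).
Proof.
move=> fa gb; apply/cvgrPdist_lt => -[e e'] e0.
have [e'0 {}e0] : e' = 0 /\ 0 < e by move: e0; rewrite ltcE/= => /andP[/eqP].
have eE : e +i* e' = e%:C by rewrite e'0.
have e2 : 0 < e / 2 by rewrite divr_gt0.
move/cvgrPdist_lt : fa => /(_ _ e2) fa; move/cvgrPdist_lt : gb => /(_ _ e2) gb.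
apply: filterS2 fa gb => x fa gb.
rewrite eE normc_leP; apply: (le_lt_trans (normc_le_add _)) => /=.
by rewrite [e]splitr ltrD.
Qed.

End ComplexTopology.

(** * Convergence of matrices, and descent to the quotient by Aff(C) *)

Lemma cvg_mx (U : topologicalType) (T : Type) (F : set_system T)
    {FF : Filter F} m n (f : T -> 'M[U]_(m, n)) (A : 'M[U]_(m, n)) :
  (forall i j, f x i j @[x --> F] --> A i j) -> f x @[x --> F] --> A.
Proof.
move=> fA B [P AP sPB].
have : \forall x \near F, forall p : 'I_m * 'I_n, P p.1 p.2 (f x p.1 p.2).
  by apply: filter_forall => p; exact/fA/AP.
by apply: filterS => x Px; apply: sPB => i j; exact: (Px (i, j)).
Qed.

Lemma cvg_coord (U : topologicalType) m n (A : 'M[U]_(m, n))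
    (F : set_system 'M[U]_(m, n)) {FF : Filter F} i j :
  F --> A -> (M i j) @[M --> F] --> A i j.
Proof.
move=> FA B AB; apply: FA; exists (fun i' j' => [set x | i' = i -> j' = j -> B x]).
  move=> i' j'; have [->|/eqP ne] := eqVneq i' i; last first.
    by apply: nearW => x /ne.
  have [->|/eqP ne] := eqVneq j' j; last first.
    by apply: nearW => x _ /ne.
  by apply: filterS AB => x Bx _ _.
by move=> M /(_ i j); apply.
Qed.

Local Open Scope quotient_scope.
(** The invariant chart [F] descends to the quotient, where [G] followed by the projection is its
    inverse. Continuity along arbitrary filters is the form in which coordinatewise limits
    compose. *)
Lemma LSP_quotient_homeomorphic (R : realType) n N
    (F : 'rV[R[i]^o]_n -> 'rV[R]_N) (G : 'rV[R]_N -> 'rV[R[i]^o]_n) :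
  (forall (X : set_system 'rV[R[i]^o]_n) w, Filter X -> LSP w -> X --> w ->
    F x @[x --> X] --> F w) ->
  (forall (X : set_system 'rV[R]_N) v, Filter X -> X --> v ->
    G x @[x --> X] --> G v) ->
  (forall w h, LSP w -> Aff h -> F (map_mx h w) = F w) ->
  (forall v, LSP (G v)) -> cancel G F ->
  (forall w, LSP w -> exists2 h, Aff h & w = map_mx h (G (F w))) ->
  homeomorphic (LSP_mod_Aff R n) 'rV[R]_N.
Proof.
move=> cF cG invF LG GK FK.
pose Q := LSP_mod_Aff R n.
pose Fq (x : Q) := F (set_val (repr x)).
pose G1 v : @LSP R n := SigSub (mem_set (LG v)).
pose Gq v : Q := \pi_Q (G1 v).
have FqE (x : @LSP R n) : Fq (\pi_Q x) = F (set_val x).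
  rewrite /Fq; have : same_Aff_orbit (repr (\pi_Q x)) x.
    by apply/eqmodP; rewrite reprK.
  by move=> /asboolP[h Ah ->]; rewrite invF//; exact: set_valP.
exists Fq, Gq; split.
- apply/quotient_continuous => x.
  rewrite (_ : _ \o _ = F \o set_val); last exact/funext.
  apply: continuous_comp; first exact: initial_continuous.
  pose wx : 'rV[R[i]^o]_n := set_val x.
  exact: (cF (nbhs wx) wx (nbhs_filter wx) (set_valP x) (fun _ => id)).
- move=> v; apply: (@continuous_comp _ _ _ G1); last exact: pi_continuous.
  apply: continuous_comp_initial => u.
  exact: (cG (nbhs u) u (nbhs_filter u) (fun _ => id)).
- move=> x; rewrite -[x]reprK FqE; apply/eqmodP/asboolP.
  apply: FK; exact: set_valP.
- by move=> v; rewrite /Gq FqE GK.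
Qed.
Local Close Scope quotient_scope.

(** * The argument *)

Section Arg.
Variable R : realType.
Implicit Types (z u : R[i]) (a b x : R).

Definition cmod z : R := Num.sqrt (Re z ^+ 2 + Im z ^+ 2).
Definition expi a : R[i] := cos a +i* sin a.
(** The plane without the closed negative half-axis, where [arg] is the principal argument. *)
Definition slit z : bool := (Im z != 0) || (0 < Re z).
(** The half-angle formula tan (theta / 2) = sin theta / (1 + cos theta), which makes continuity a
    matter of composition. On the closed negative half-axis the denominator vanishes and the value
    is 0 by the convention for division. *)
Definition arg z : R := 2 * atan (Im z / (cmod z + Re z)).

Lemma normcE' z : `|z| = (cmod z)%:C. Proof. exact: normc_def. Qed.

Lemma cmodM z u : cmod (z * u) = cmod z * cmod u.
Proof. by apply: complexI; rewrite rmorphM/= -!normcE' normrM. Qed.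

Lemma cmodV z : cmod z^-1 = (cmod z)^-1.
Proof. by apply: complexI; rewrite fmorphV/= -!normcE' normfV. Qed.

Lemma cmod_ge0 z : 0 <= cmod z. Proof. exact: sqrtr_ge0. Qed.

Lemma cmod_gt0 z : (0 < cmod z) = (z != 0).
Proof. by rewrite -normr_gt0 normcE' ltcR. Qed.

Lemma sqr_cmod z : cmod z ^+ 2 = Re z ^+ 2 + Im z ^+ 2.
Proof. by rewrite sqr_sqrtr// addr_ge0 ?sqr_ge0. Qed.

Lemma cmod_real a : 0 <= a -> cmod a%:C = a.
Proof. by move=> a0; apply: complexI; rewrite -normcE' ger0_norm// ler0c. Qed.

Lemma cmod_expi a : cmod (expi a) = 1.
Proof. by rewrite /cmod/= cos2Dsin2 sqrtr1. Qed.

Lemma expi0 : expi 0 = 1. Proof. by rewrite /expi cos0 sin0. Qed.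

Lemma expiD a b : expi (a + b) = expi a * expi b.
Proof.
by apply/eqP; rewrite eq_complex/= cosD sinD; apply/andP; split; apply/eqP; ring.
Qed.

Lemma expiN a : expi (- a) = (expi a)^-1.
Proof.
have := expiD (- a) a; rewrite addNr expi0 => /esym/mulr1_eq.
by move=> <-; rewrite invrK.
Qed.

Lemma expi_neq0 a : expi a != 0.
Proof. by rewrite -cmod_gt0 cmod_expi. Qed.

Lemma expi_sum (I : Type) (r : seq I) (P : pred I) (F : I -> R) :
  expi (\sum_(i <- r | P i) F i) = \prod_(i <- r | P i) expi (F i).
Proof. exact: (big_morph expi expiD expi0). Qed.

Lemma expi2pi (m : int) : expi (2 * pi * m%:~R) = 1.
Proof.
have nat_case (k : nat) : expi (2 * pi * k%:R) = 1.
  elim: k => [|k IHk]; first by rewrite mulr0 expi0.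
  rewrite -[k.+1%:R]natr1 mulrDr mulr1 expiD IHk mul1r /expi.
  by rewrite mulrC mulr_natr cos2pi sin2pi.
case: m => k; first exact: nat_case.
by rewrite NegzE mulrNz mulrN expiN nat_case invr1.
Qed.

(** A multiple of 2 pi brings [a] to some y in [0, 2 pi), and the injectivity of cos on [0, pi]
    applies to y or to 2 pi - y. *)
Lemma cos_eq1 a : cos a = 1 -> exists m : int, a = 2 * pi * m%:~R.
Proof.
move=> ca; have p0 : 0 < 2 * pi :> R by rewrite mulr_gt0// pi_gt0.
pose m := Num.floor (a / (2 * pi)); pose y := a - 2 * pi * m%:~R.
have cy : cos y = 1.
  have : expi a = expi y * expi (2 * pi * m%:~R) by rewrite -expiD subrK.
  by rewrite expi2pi mulr1 => -[<-].
have y0 : 0 <= y by rewrite subr_ge0 mulrC -ler_pdivlMr// floor_le.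
have y2 : y < 2 * pi.
  rewrite ltrBlDr -[X in X + _]mulr1 -mulrDr addrC mulrC -ltr_pdivrMr//.
  by have := floorD1_gt (a / (2 * pi)); rewrite intrD.
have [ypi|ypi] := leP y pi.
  have : y = 0 by apply: cos_inj; rewrite ?in_itv/= ?lexx ?y0 ?pi_ge0// cy cos0.
  by exists m; apply/eqP; rewrite -subr_eq0; apply/eqP.
have : 2 * pi - y = 0.
  apply: cos_inj; rewrite ?in_itv/= ?lexx ?pi_ge0// ?cos0; first by apply/andP; split; lra.
  have : expi (2 * pi * 1%:~R - y) = expi (- y) by rewrite expiD expi2pi mul1r.
  by rewrite mulr1 => -[-> _]; rewrite cosN.
by move/eqP; rewrite subr_eq0 => /eqP E; move: y2; rewrite -E ltxx.
Qed.

Lemma expi_eq a b : expi a = expi b -> exists m : int, a - b = 2 * pi * m%:~R.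
Proof.
move=> ab; apply: cos_eq1.
have : expi (a - b) = 1 by rewrite expiD expiN ab divff// expi_neq0.
by case.
Qed.

Lemma int2pi_small (m : int) : `|2 * pi * m%:~R| < 2 * pi :> R -> m = 0.
Proof.
have p0 : 0 < 2 * pi :> R by rewrite mulr_gt0// pi_gt0.
rewrite normrM gtr0_norm// gtr_pMr// -intr_norm -[1]/(1%:~R) ltr_int.
by case: m => [[|?]|?].
Qed.

Lemma expi_inj a b : expi a = expi b -> `|a - b| < 2 * pi -> a = b.
Proof.
move=> /expi_eq[m E]; rewrite E => /int2pi_small m0.
by apply/eqP; rewrite -subr_eq0 E m0 mulr0.
Qed.

Lemma slit_neq0 z : slit z -> z != 0.
Proof. by apply: contraTneq => ->; rewrite /slit/= eqxx ltxx. Qed.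

Lemma slit_cmod z : slit z -> 0 < cmod z + Re z.
Proof.
move=> /orP[im|re]; last by rewrite ltr_wpDl// cmod_ge0.
suff : - Re z < cmod z by rewrite addrC -ltrBlDl sub0r.
apply: (@le_lt_trans _ _ `|Re z|); first by rewrite -normrN ler_norm.
rewrite -sqrtr_sqr ltr_sqrt ?ltrDl ?exprn_even_gt0//.
by rewrite ltr_wpDl ?sqr_ge0// exprn_even_gt0.
Qed.

(** For u the tangent of the half angle, 1 + u^2 = 2 |z| / (|z| + Re z); the double-angle formulas
    for atan u then return Re z / |z| and Im z / |z|. *)
Lemma polar z : slit z -> z = (cmod z)%:C * expi (arg z).
Proof.
move=> sz; have r0 : 0 < cmod z by rewrite cmod_gt0 slit_neq0.
have s0 := slit_cmod sz; have r2 := sqr_cmod z.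
set u := Im z / (cmod z + Re z).
have uE : 1 + u ^+ 2 = 2 * cmod z / (cmod z + Re z).
  rewrite /u; move: r2 s0 r0; case: (z) => x y /=; set r := cmod _ => r2 s0 r0.
  apply: (mulIf (lt0r_neq0 (exprn_gt0 2 s0))).
  have -> : 2 * r / (r + x) * (r + x) ^+ 2 = 2 * r * (r + x).
    by field; rewrite gt_eqF.
  have -> : (1 + (y / (r + x)) ^+ 2) * (r + x) ^+ 2 = (r + x) ^+ 2 + y ^+ 2.
    by field; rewrite gt_eqF.
  by rewrite sqrrD; ring: r2.
have c2 : cos (atan u) ^+ 2 = (cmod z + Re z) / (2 * cmod z).
  by rewrite cos_atan exprVn sqr_sqrtr ?addr_ge0 ?sqr_ge0// uE invf_div.
have c0 : cos (atan u) != 0.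
  by rewrite -sqrf_eq0 c2 mulf_neq0 ?invr_eq0 ?mulf_neq0 ?gt_eqF.
have sE : sin (atan u) = u * cos (atan u).
  by rewrite -{2}(atanK u) /tan mulfVK.
apply/eqP; rewrite eq_complex/= !mul0r subr0 addr0 /arg -/u.
rewrite (mulr_natl (atan u) 2) cos_mulr2n sin_mulr2n sE c2 mulrCA -expr2 c2 /u.
by apply/andP; split; apply/eqP; field; rewrite !gt_eqF.
Qed.

Lemma arg_bound z : - pi < arg z < pi.
Proof.
have := atan_gtNpi2 (Im z / (cmod z + Re z)).
have := atan_ltpi2 (Im z / (cmod z + Re z)).
by rewrite /arg => ? ?; apply/andP; split; lra.
Qed.

Lemma arg_unique r a : 0 < r -> - pi < a < pi -> arg (r%:C * expi a) = a.
Proof.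
move=> r0 /andP[a1 a2]; set z := _ * _.
have [zR zI] : Re z = r * cos a /\ Im z = r * sin a.
  by rewrite /z/= !mul0r subr0 addr0.
have sz : slit z.
  rewrite /slit zR zI mulf_eq0 (gt_eqF r0)/= pmulr_rgt0//.
  have [s0|//] := eqVneq (sin a) 0.
  have [a0|a0|->] := ltgtP a 0; last by rewrite cos0 ltr01.
    have : 0 < sin (- a) by apply: sin_gt0_pi; rewrite oppr_gt0 a0 ltrNl.
    by rewrite sinN s0 oppr0 ltxx.
  have : 0 < sin a by apply: sin_gt0_pi; rewrite a0.
  by rewrite s0 ltxx.
have rz : cmod z = r by rewrite cmodM cmod_expi mulr1 cmod_real// ltW.
apply: expi_inj; last first.
  have := arg_bound z; rewrite ltr_norml => /andP[b1 b2].
  by apply/andP; split; lra.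
have rC : r%:C != 0 by apply/eqP => -[/eqP]; rewrite gt_eqF.
by apply: (mulfI rC); rewrite -{1}rz -polar.
Qed.

Lemma arg1 : arg 1 = 0.
Proof. by rewrite /arg/= mul0r atan0 mulr0. Qed.

Lemma arg_conjc z : arg z^* = - arg z.
Proof. by case: z => x y; rewrite /arg /cmod/= sqrrN mulNr atanN mulrN. Qed.

Lemma arg_gt0 z : 0 < Im z -> 0 < arg z.
Proof.
move=> z0; rewrite /arg mulr_gt0// -atan0 lt_atan// divr_gt0// slit_cmod//.
by rewrite /slit gt_eqF.
Qed.

Lemma arg_le_pihalf z : 0 < Re z -> `|arg z| < pi / 2.
Proof.
move=> x0; have s0 : 0 < cmod z + Re z by rewrite ltr_wpDl// cmod_ge0.
have ub : `|Im z| < cmod z + Re z.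
  by rewrite (le_lt_trans (ler_Im_sqrt z))// ltrDl.
have pi4 : pi / 2 = 2 * (pi / 4) :> R by field.
move: ub; rewrite !ltr_norml pi4 /arg -atan1 -mulrN -atanN !ltr_pM2l//.
move=> /andP[u1 u2]; apply/andP; split; apply: lt_atan.
  by rewrite ltr_pdivlMr// mulN1r.
by rewrite ltr_pdivrMr// mul1r.
Qed.

Lemma argB z u : slit z -> slit u -> - pi < arg z - arg u < pi ->
  arg (z / u) = arg z - arg u.
Proof.
move=> sz su b; have [z0 u0] := (slit_neq0 sz, slit_neq0 su).
rewrite -(@arg_unique (cmod z / cmod u) (arg z - arg u)) ?divr_gt0 ?cmod_gt0//.
congr arg; rewrite {1}(polar sz) {1}(polar su) invfM mulrACA -expiN -expiD.
by rewrite -fmorphV -rmorphM.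
Qed.

Lemma cvg_cmod (T : Type) (F : set_system T) {FF : Filter F}
    (f : T -> R[i]^o) (z : R[i]^o) : f x @[x --> F] --> z ->
  cmod (f x) @[x --> F] --> cmod z.
Proof.
move=> fz.
have [cRe cIm] := (cvg_Re_comp fz, cvg_Im_comp fz).
have h : (Re (f x) ^+ 2 + Im (f x) ^+ 2) @[x --> F] --> Re z ^+ 2 + Im z ^+ 2.
  by apply: cvgD; apply: cvgM.
exact: (cvg_comp _ _ h (@sqrt_continuous R _)).
Qed.

Lemma cvg_arg (T : Type) (F : set_system T) {FF : Filter F}
    (f : T -> R[i]^o) (z : R[i]^o) : slit z -> f x @[x --> F] --> z ->
  arg (f x) @[x --> F] --> arg z.
Proof.
move=> sz fz; have s0 := slit_cmod sz.
apply: cvgM; first exact: cvg_cst.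
apply: continuous_cvg; first exact: continuous_atan.
apply: cvgM; first exact: cvg_Im_comp.
apply: cvgV; first by rewrite gt_eqF.
by apply: cvgD; [exact: cvg_cmod|exact: cvg_Re_comp].
Qed.

End Arg.

(** * Winding numbers of closed polygonal curves *)

Section IntegerValued.
Variable R : realType.

Lemma int2pi_between (m k : int) :
  2 * pi * m%:~R + pi = 2 * pi * k%:~R :> R -> False.
Proof.
move=> E; have p0 : pi != 0 :> R by rewrite gt_eqF// pi_gt0.
have : (2 * m + 1)%:~R = (2 * k)%:~R :> R.
  by rewrite intrD !intrM; apply: (mulfI p0); move: E => /=; rewrite -[2%:~R]/2; lra.
by move=> /intr_inj; lia.
Qed.

(** The image is an interval; two distinct values would be at least 2 pi apart, and the value
    [f x + pi] between them is no multiple of 2 pi. *)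
Lemma connected_int2pi_constant (T : topologicalType) (D : set T) (f : T -> R) :
  connected D -> {within D, continuous f} ->
  (forall x, D x -> exists m : int, f x = 2 * pi * m%:~R) ->
  forall x y, D x -> D y -> f x = f y.
Proof.
move=> cD cf fZ.
have /connected_intervalP If := connected_continuous_connected cD cf.
suff H x y : D x -> D y -> ~ f x < f y.
  move=> x y Dx Dy; have [xy|xy|//] := ltgtP (f x) (f y).
    by case: (H x y Dx Dy).
  by case: (H y x Dy Dx).
move=> Dx Dy xy; have [m mE] := fZ _ Dx; have [m' m'E] := fZ _ Dy.
have p0 : 0 < pi :> R := pi_gt0 R.
have mm' : m + 1 <= m'.
  by move: xy; rewrite mE m'E ltr_pM2l ?mulr_gt0// ltr_int lezD1.
have : 2 * pi * (m%:~R + 1) <= 2 * pi * m'%:~R :> R.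
  by rewrite ler_pM2l ?mulr_gt0// -[1]/(1%:~R) -intrD ler_int.
move=> le.
have [z Dz zE] : (f @` D) (f x + pi).
  apply: (If (f x) (f y)); [by exists x|by exists y|].
  by rewrite lerDl (ltW p0)/= m'E mE; lra.
have [k kE] := fZ _ Dz.
by apply: (@int2pi_between m k); rewrite -mE -zE kE.
Qed.

End IntegerValued.

Section Winding.
Variable R : realType.
Implicit Types (v : nat -> R[i]^o) (q p : R[i]^o) (s t : R) (n j k : nat).

Definition edge v j s : R[i]^o := (1 - s)%:C * v j + s%:C * v j.+1.

Definition polyline v t : R[i]^o :=
  edge v (Num.truncn t) (t - (Num.truncn t)%:R).

Definition avoids v n q := ~ (polyline v @` `[0, n%:R]) q.

(** Freezes the time outside [j, j + 1], so that edge j contributes nothing to [lifted] before and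
    its full angle afterwards. *)
Definition clamp j t : R := Num.max j%:R (Num.min t j.+1%:R).

(** The total angle swept as seen from [q], each edge contributing less than pi in absolute value;
    for a closed curve off [q] it is 2 pi times the winding number. *)
Definition winding v n q : R :=
  \sum_(j < n) arg ((v j.+1 - q) / (v j - q)).

(* A continuous argument of [polyline v t - q], up to the constant              *)
(* [arg (v 0 - q)]; each summand only varies for t in [j, j + 1], and there the *)
(* quotient stays off the negative real axis.                                   *)
Definition lifted v n q t : R :=
  \sum_(j < n) arg ((edge v j (clamp j t - j%:R) - q) / (v j - q)).

Lemma edge0 v j : edge v j 0 = v j.
Proof. by rewrite /edge subr0 mul1r mul0r addr0. Qed.

Lemma edge1 v j : edge v j 1 = v j.+1.
Proof. by rewrite /edge subrr mul1r mul0r add0r. Qed.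

(** At the right endpoint [Num.truncn] has already moved to the next edge, which starts where this
    one ends. *)
Lemma polylineE v j t : j%:R <= t <= j.+1%:R ->
  polyline v t = edge v j (t - j%:R).
Proof.
move=> /andP[jt]; rewrite le_eqVlt => /predU1P[->|tj].
  have -> : j.+1%:R - j%:R = 1 :> R by rewrite -natrB ?subSnn.
  by rewrite edge1 /polyline natrK subrr edge0.
by rewrite /polyline (@truncn_def _ t j)// jt.
Qed.

Lemma polyline_nat v j : polyline v j%:R = v j.
Proof.
have jj : j%:R <= (j%:R : R) <= j.+1%:R by rewrite lexx ler_nat leqnSn.
by rewrite (polylineE v jj) subrr edge0.
Qed.

Lemma clamp_itv j t : j%:R <= clamp j t <= j.+1%:R.
Proof.
rewrite /clamp le_max lexx/= ge_max ge_min lexx orbT andbT ler_nat//.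
Qed.

Lemma clamp_subitv j t : 0 <= clamp j t - j%:R <= 1.
Proof. by have := clamp_itv j t; rewrite -natr1 subr_ge0 lerBlDl. Qed.

Lemma avoids_edge v n q j s : avoids v n q -> (j < n)%N -> 0 <= s <= 1 ->
  edge v j s - q != 0.
Proof.
move=> av jn /andP[s0 s1]; rewrite subr_eq0; apply/eqP => E; apply: av.
exists (j%:R + s).
  rewrite /= in_itv/= addr_ge0//=; apply: (@le_trans _ _ j.+1%:R).
    by rewrite -natr1 lerD2l.
  by rewrite ler_nat.
by rewrite (@polylineE _ j) ?lerDl ?s0 -?natr1 ?lerD2l// addrAC subrr add0r.
Qed.

(** If b = - c a with c >= 0, the segment passes through 0 at the parameter 1 / (1 + c). *)
Lemma slit_segment (a b : R[i]) :
  (forall s, 0 <= s <= 1 -> (1 - s)%:C * a + s%:C * b != 0) -> slit (b / a).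
Proof.
move=> H; have a0 : a != 0.
  by have := H 0; rewrite subr0 mul1r mul0r addr0; apply; rewrite lexx ler01.
apply/negPn/negP; rewrite negb_or negbK -leNgt => /andP[/eqP im re].
set c := - Re (b / a).
have c0 : 0 <= c by rewrite oppr_ge0.
have bE : b = (- c)%:C * a.
  rewrite -[LHS](divfK a0); congr (_ * _).
  by apply/eqP; rewrite eq_complex/= im /c opprK !eqxx.
have c1 : 1 + c != 0 by rewrite gt_eqF// ltr_pwDl.
suff : (1 - (1 + c)^-1)%:C * a + (1 + c)^-1%:C * b != 0.
  apply/negP; rewrite negbK.
  rewrite bE mulrA -rmorphM -mulrDl -rmorphD/= (_ : _ + _ = 0) ?mul0r//.
  by field.
by apply: H; rewrite invr_ge0 addr_ge0//= invf_le1 ?lerDl// ltr_pwDl.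
Qed.

Lemma slit_edge v n q j s s' : avoids v n q -> (j < n)%N ->
  0 <= s <= 1 -> 0 <= s' <= 1 ->
  slit ((edge v j s' - q) / (edge v j s - q)).
Proof.
move=> av jn s01 s'01; apply: slit_segment => x x01.
have -> : (1 - x)%:C * (edge v j s - q) + x%:C * (edge v j s' - q) =
    edge v j ((1 - x) * s + x * s') - q.
  rewrite /edge; apply/eqP; rewrite eq_complex/=.
  by case: (v j) (v j.+1) q {av} => [a b] [c d] [e f] /=; apply/andP; split; apply/eqP; ring.
apply: (avoids_edge av jn); move: s01 s'01 x01 => /andP[? ?] /andP[? ?] /andP[? ?].
by apply/andP; split; nra.
Qed.

Lemma slit_edge0 v n q j s : avoids v n q -> (j < n)%N -> 0 <= s <= 1 ->
  slit ((edge v j s - q) / (v j - q)).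
Proof.
by move=> av jn s01; rewrite -[in X in _ / X](edge0 v j); apply: (slit_edge av); rewrite ?lexx ?ler01.
Qed.

(** The quotients telescope: finished edges contribute their full quotient, the current edge its
    partial one, later edges 1. *)
Lemma lifted_prod v n q t m : avoids v n q -> (m <= n)%N -> 0 <= t ->
  \prod_(j < m) ((edge v j (clamp j t - j%:R) - q) / (v j - q)) =
  (polyline v (Num.min t m%:R) - q) / (v 0%N - q).
Proof.
move=> av mn t0; elim: m mn => [|m IHm] mn.
  have v0 : v 0%N - q != 0.
    apply/eqP => E; apply: av; exists 0; first by rewrite /= in_itv/= lexx ler0n.
    by rewrite (polyline_nat v 0); apply/eqP; rewrite -subr_eq0 E.
  by rewrite big_ord0 min_r// (polyline_nat v 0) divff.
rewrite big_ord_recr/= IHm ?(ltnW mn)//.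
have vm : v m - q != 0.
  by rewrite -(edge0 v m); apply: (avoids_edge av) => //; rewrite lexx ler01.
rewrite -polylineE ?clamp_itv//.
have [tm|mt] := leP t m%:R.
  have tm1 : t <= m.+1%:R by rewrite (le_trans tm)// ler_nat.
  by rewrite /clamp !min_l// max_l// polyline_nat divff// mulr1.
have frac (a b c : R[i]) : b != 0 -> b / c * (a / b) = a / c.
  by move=> b0; rewrite mulrC mulrA divfK.
rewrite polyline_nat frac// /clamp max_r//.
by rewrite le_min (ltW mt) ler_nat leqnSn.
Qed.

Lemma lifted_polar v n q t : avoids v n q -> 0 <= t <= n%:R ->
  polyline v t - q = (cmod (polyline v t - q) / cmod (v 0%N - q))%:C *
    (v 0%N - q) * expi (lifted v n q t).
Proof.
move=> av /andP[t0 tn].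
have v0 : v 0%N - q != 0.
  apply/eqP => E; apply: av; exists 0; first by rewrite /= in_itv/= lexx ler0n.
  by rewrite (polyline_nat v 0); apply/eqP; rewrite -subr_eq0 E.
have := lifted_prod av (leqnn n) t0; rewrite (min_l tn) => prodE.
have -> : expi (lifted v n q t) = (polyline v t - q) / (v 0%N - q) /
    (cmod ((polyline v t - q) / (v 0%N - q)))%:C.
  rewrite -prodE /lifted expi_sum.
  rewrite (big_morph (@cmod R) (@cmodM R) (_ : cmod 1 = 1)); last first.
    by rewrite -[1]/(1%:C) cmod_real.
  rewrite rmorph_prod -prodf_div; apply: eq_bigr => j _ /=.
  set z := _ / _; have sz : slit z by apply: (slit_edge0 av); rewrite ?clamp_subitv.
  rewrite [X in X / _](polar sz) mulrAC divff ?mul1r//.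
  by apply/eqP => -[/eqP]; rewrite gt_eqF// cmod_gt0 slit_neq0.
have qt : polyline v t - q != 0.
  apply/eqP => E; apply: av; exists t; first by rewrite /= in_itv/= t0 tn.
  by apply/eqP; rewrite -subr_eq0 E.
rewrite cmodM cmodV; set X := (_ / _)%:C.
have X0 : X != 0 by apply/eqP => -[/eqP]; rewrite gt_eqF// divr_gt0 ?cmod_gt0.
rewrite [X in _ = X](_ : _ = (polyline v t - q) * ((v 0%N - q) / (v 0%N - q)) * (X / X)).
  by rewrite !divff// !mulr1.
by ring.
Qed.

End Winding.

Section WindingNumber.
Variable R : realType.
Implicit Types (v : nat -> R[i]^o) (q p : R[i]^o) (s t : R) (n j k : nat).

Lemma avoids_vertex v n q j : avoids v n q -> (j <= n)%N -> v j - q != 0.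
Proof.
move=> av jn; rewrite subr_eq0; apply/eqP => E; apply: av; exists j%:R.
  by rewrite /= in_itv/= ler0n ler_nat.
by rewrite polyline_nat.
Qed.

Lemma lifted0 v n q : avoids v n q -> lifted v n q 0 = 0.
Proof.
move=> av; rewrite /lifted big1// => j _.
rewrite /clamp min_l// max_l// subrr edge0 divff ?arg1//.
by apply: (avoids_vertex av); exact: ltnW.
Qed.

Lemma lifted_end v n q : lifted v n q n%:R = winding v n q.
Proof.
rewrite /lifted /winding; apply: eq_bigr => j _.
rewrite /clamp min_r ?ler_nat// max_r ?ler_nat//.
by have -> : j.+1%:R - j%:R = 1 :> R; rewrite ?edge1// -natrB// subSnn.
Qed.

Lemma continuous_edge v j : continuous (edge v j).
Proof.
move=> s; have E x : edge v j x = ((1 - x) * Re (v j) + x * Re (v j.+1)) +i*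
    ((1 - x) * Im (v j) + x * Im (v j.+1)).
  rewrite /edge; apply/eqP; rewrite eq_complex/=.
  case: (v j) (v j.+1) => [a b] [c d] /=.
  by apply/andP; split; apply/eqP; ring.
rewrite /continuous_at E (funext E).
have cs : continuous (fun s : R => 1 - s).
  by move=> x; apply: cvgB; [exact: cvg_cst|exact: cvg_id].
by apply: cvg_complex; apply: cvgD; apply: cvgM;
   try exact: cvg_cst; try exact: cs; exact: cvg_id.
Qed.

Lemma continuous_clamp j : continuous (clamp j : R -> R).
Proof.
move=> t.
apply: (@continuous_max _ _ (fun=> j%:R) (fun t => Num.min t j.+1%:R) t).
  exact: cvg_cst.
apply: (@continuous_min _ _ id (fun=> j.+1%:R) t); first exact: cvg_id.
exact: cvg_cst.
Qed.

Lemma cvg_complexM (T : Type) (F : set_system T) {FF : Filter F}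
    (f g : T -> R[i]^o) (a b : R[i]^o) :
  f x @[x --> F] --> a -> g x @[x --> F] --> b ->
  (f x * g x : R[i]^o) @[x --> F] --> (a * b : R[i]^o).
Proof.
move=> fa gb.
have [fR fI] := (cvg_Re_comp fa, cvg_Im_comp fa).
have [gR gI] := (cvg_Re_comp gb, cvg_Im_comp gb).
have mulE (x y : R[i]) : x * y =
  (Re x * Re y - Im x * Im y) +i* (Re x * Im y + Im x * Re y).
  by case: x y => [? ?] [? ?].
under eq_fun do rewrite mulE; rewrite mulE.
by apply: cvg_complex; [apply: cvgB|apply: cvgD]; apply: cvgM.
Qed.

Lemma cvg_complexV (T : Type) (F : set_system T) {FF : Filter F}
    (f : T -> R[i]^o) (a : R[i]^o) : a != 0 ->
  f x @[x --> F] --> a -> ((f x)^-1 : R[i]^o) @[x --> F] --> (a^-1 : R[i]^o).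
Proof.
move=> a0 fa.
have [fR fI] := (cvg_Re_comp fa, cvg_Im_comp fa).
have invE (x : R[i]) : x^-1 = (Re x / (Re x ^+ 2 + Im x ^+ 2)) +i*
    (- (Im x / (Re x ^+ 2 + Im x ^+ 2))).
  by case: x => ? ?; rewrite /GRing.inv/=.
have n0 : Re a ^+ 2 + Im a ^+ 2 != 0 by rewrite -sqr_cmod expf_neq0// gt_eqF// cmod_gt0.
have cn : ((Re (f x) ^+ 2 + Im (f x) ^+ 2)^-1 : R) @[x --> F] --> (Re a ^+ 2 + Im a ^+ 2)^-1.
  by apply: cvgV => //; apply: cvgD; apply: cvgM.
under eq_fun do rewrite invE; rewrite invE.
by apply: cvg_complex; [|apply: cvgN]; apply: cvgM.
Qed.

Lemma continuous_lifted v n q : avoids v n q -> continuous (lifted v n q).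
Proof.
move=> av t.
have addc : continuous (fun x : R * R => x.1 + x.2) by exact: add_continuous.
apply: (cvg_big addc) => j _.
apply: cvg_arg; first by apply: (slit_edge0 av); rewrite ?clamp_subitv.
apply: cvg_complexM; last exact: cvg_cst.
apply: cvgB; last exact: cvg_cst.
apply: (@cvg_comp _ _ _ (fun t => clamp j t - j%:R) (edge v j) _
  (nbhs (clamp j t - j%:R))); last exact: continuous_edge.
by apply: cvgB; [exact: continuous_clamp|exact: cvg_cst].
Qed.

Lemma polar_exists (z : R[i]) : z != 0 -> exists a, z = (cmod z)%:C * expi a.
Proof.
move=> z0; have [sz|] := boolP (slit z); first by exists (arg z); exact: polar.
rewrite negb_or negbK -leNgt => /andP[/eqP im re].
exists pi; rewrite /expi cospi sinpi /cmod im expr0n addr0 sqrtr_sqr ler0_norm//.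
by apply/eqP; rewrite eq_complex/= im; apply/andP; split; apply/eqP; ring.
Qed.

Lemma lifted_argument v n q a : avoids v n q ->
  v 0%N - q = (cmod (v 0%N - q))%:C * expi a ->
  forall t, 0 <= t <= n%:R -> polyline v t - q =
    (cmod (polyline v t - q))%:C * expi (a + lifted v n q t).
Proof.
move=> av aE t t01; rewrite [LHS](lifted_polar av t01) {2}aE expiD.
rewrite !mulrA -rmorphM/= divfK// gt_eqF// cmod_gt0.
exact: (avoids_vertex av (leq0n n)).
Qed.

Lemma winding_int v n q : avoids v n q -> v n = v 0%N ->
  exists m : int, winding v n q = 2 * pi * m%:~R.
Proof.
move=> av vn; have v0 := avoids_vertex av (leq0n n).
have [a aE] := polar_exists v0.
have C0 : (cmod (v 0%N - q))%:C != 0.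
  by apply/eqP => -[/eqP]; rewrite gt_eqF// cmod_gt0.
have E : expi (a + winding v n q) = expi a.
  apply: (mulfI C0); rewrite -aE -vn -lifted_end -[in RHS](polyline_nat v n).
  by rewrite [RHS](lifted_argument av aE) ?polyline_nat ?vn// ler0n lexx.
have [m mE] := expi_eq E; exists m.
by rewrite -mE addrAC subrr add0r.
Qed.

(** Two continuous arguments of one curve differ by a continuous function with values in 2 pi Z,
    which is constant on [0, n]; so every argument has the increment of [lifted]. *)
Lemma has_winding_numberP v n q (m : int) : (0 < n)%N -> avoids v n q ->
  has_winding_number (polyline v) 0 n%:R q m <->
  winding v n q = 2 * pi * m%:~R.
Proof.
move=> n0 av; have v0 := avoids_vertex av (leq0n n).
have [a aE] := polar_exists v0.
have nn : 0 <= (n%:R : R) <= n%:R by rewrite ler0n lexx.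
have n00 : 0 <= (0 : R) <= n%:R by rewrite lexx ler0n.
have pol := lifted_argument av aE; split; last first.
  move=> wE; split; first exact: av.
  exists (fun t => a + lifted v n q t); split.
  - apply: continuous_subspaceT => t.
    by apply: cvgD; [exact: cvg_cst|exact: continuous_lifted].
  - by move=> t; rewrite in_itv/= normcE' => /pol.
  - by rewrite lifted0// addr0 addrAC subrr add0r lifted_end.
move=> [_ [th [cth thE thn]]].
pose f t := th t - (a + lifted v n q t).
have cf : {within `[0, n%:R], continuous f}.
  move=> t; apply: cvgB; first exact: cth.
  apply: cvgD; first exact: cvg_cst.
  by apply: continuous_subspaceT => t'; exact: continuous_lifted.
have fZ t : `[0, n%:R]%classic t -> exists m : int, f t = 2 * pi * m%:~R.
  rewrite /= in_itv/= => t01; apply: expi_eq.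
  have C0 : (cmod (polyline v t - q))%:C != 0.
    apply/eqP => -[/eqP]; rewrite gt_eqF// cmod_gt0; apply/eqP => E; apply: av.
    by exists t; [rewrite /= in_itv/=|apply/eqP; rewrite -subr_eq0 E].
  apply: (mulfI C0); rewrite -pol// -normcE' /expi -thE//; by rewrite in_itv/=.
have := connected_int2pi_constant (@segment_connected R 0 n%:R) cf fZ.
move=> /(_ 0 n%:R); rewrite /= !in_itv/= n00 nn => /(_ isT isT).
rewrite /f lifted0// lifted_end; move: thn => /=; lra.
Qed.

Lemma cvg_winding (F : set_system R[i]^o) {FF : Filter F} v n q :
  avoids v n q -> F --> q -> winding v n x @[x --> F] --> winding v n q.
Proof.
move=> av Fq.
have addc : continuous (fun x : R * R => x.1 + x.2) by exact: add_continuous.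
apply: (cvg_big addc) => j _; apply: cvg_arg.
  rewrite -[v j.+1]edge1; apply: (slit_edge0 av) => //.
  by rewrite lexx ler01.
apply: cvg_complexM; first by apply: cvgB; [exact: cvg_cst|exact: Fq].
apply: cvg_complexV; first by apply: (avoids_vertex av); exact: ltnW.
by apply: cvgB; [exact: cvg_cst|exact: Fq].
Qed.

Lemma continuous_winding v n q : avoids v n q ->
  {for q, continuous (winding v n)}.
Proof.
by move=> av; exact: (@cvg_winding (nbhs q) (nbhs_filter q) v n q av).
Qed.

Lemma winding_constant v n D p q : v n = v 0%N -> connected D ->
  (forall z, D z -> avoids v n z) -> D p -> D q ->
  winding v n p = winding v n q.
Proof.
move=> vn cD av; apply: connected_int2pi_constant => //.
  by apply: continuous_in_subspaceT => z /set_mem /av; exact: continuous_winding.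
by move=> z /av az; exact: winding_int.
Qed.

End WindingNumber.

(** * Orientation read off from one winding number *)

Section Counterclockwise.
Variable R : realType.
Implicit Types (v : nat -> R[i]^o) (q p : R[i]^o) (s t : R) (n j k : nat).

Lemma polyline_index n t : (0 < n)%N -> 0 <= t <= n%:R ->
  exists2 k, (k < n)%N & k%:R <= t <= k.+1%:R.
Proof.
move=> n0 /andP[t0]; rewrite le_eqVlt => /predU1P[->|tn].
  by exists n.-1; rewrite ?ltn_predL// !ler_nat leq_pred prednK// leqnn.
have /andP[kt tk] := Num.Theory.truncn_itv t0.
exists (Num.truncn t); last by rewrite kt ltW.
by rewrite -(ltr_nat R) (le_lt_trans kt).
Qed.

Lemma vertex_bound v n : exists2 M, 0 <= M & forall j, (j <= n)%N -> cmod (v j) <= M.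
Proof.
elim: n => [|n [M M0 IH]].
  by exists (cmod (v 0%N)); [exact: cmod_ge0|move=> j; rewrite leqn0 => /eqP->].
exists (Num.max M (cmod (v n.+1))); first by rewrite le_max M0.
move=> j; rewrite leq_eqVlt => /predU1P[->|jn]; first by rewrite le_max lexx orbT.
by rewrite le_max IH.
Qed.

Lemma far_halfplane (z q : R[i]) : cmod z < cmod q -> 0 < Re ((z - q) / (- q)).
Proof.
move=> zq; have q0 : q != 0.
  by rewrite -cmod_gt0 (le_lt_trans (cmod_ge0 z)).
rewrite mulrBl invrN !mulrN opprK divff// addrC raddfD raddfN/= subr_gt0.
apply: (le_lt_trans (ler_norm _)); apply: (le_lt_trans (ler_Re_sqrt _)).
by rewrite -/(cmod _) cmodM cmodV ltr_pdivrMr ?cmod_gt0// mul1r.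
Qed.

(** Seen from far away the vertices lie in an open half-plane around the direction [- q]; arguments
    relative to it stay within pi / 2 of 0, and their differences telescope. *)
Lemma far_winding v n M q : (forall j, (j <= n)%N -> cmod (v j) <= M) ->
  M < cmod q -> v n = v 0%N -> winding v n q = 0.
Proof.
move=> vM Mq vn.
have h j : (j <= n)%N -> 0 < Re ((v j - q) / (- q)).
  by move=> /vM vj; apply: far_halfplane; exact: le_lt_trans Mq.
have sl j : (j <= n)%N -> slit ((v j - q) / (- q)).
  by move=> /h hj; rewrite /slit hj orbT.
have q0 : - q != 0.
  have /slit_neq0 := sl 0%N (leq0n n).
  by rewrite mulf_eq0 negb_or invr_eq0 => /andP[].
pose a j := arg ((v j - q) / (- q)).
suff -> : winding v n q = \sum_(0 <= j < n) (a j.+1 - a j).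
  by rewrite telescope_sumr// /a vn subrr.
rewrite big_mkord; apply: eq_bigr => j _; rewrite /a -argB ?sl//.
- by rewrite invfM mulrACA invrK mulVf ?mulr1// invr_eq0.
- exact: ltnW.
- have := arg_le_pihalf (h j (ltnW (ltn_ord j))).
  have := arg_le_pihalf (h j.+1 (ltn_ord j)).
  rewrite !ltr_norml => /andP[? ?] /andP[? ?].
  by apply/andP; split; lra.
Qed.

Lemma vertex_period n (w : 'rV[R[i]^o]_n) : vertex w n = vertex w 0.
Proof. by rewrite /vertex modnn mod0n. Qed.

(** One point of winding number 1 suffices: the number is constant on its component, and since it
    vanishes far away, the component is bounded. *)
Lemma counterclockwiseP n (w : 'rV[R[i]^o]_n) : (0 < n)%N ->
  counterclockwise w <->
  exists2 q, avoids (vertex w) n q & winding (vertex w) n q = 2 * pi.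
Proof.
move=> n0; split.
  move=> [D [_ [p Tp ->]] /(_ p)]; move=> /(_ (connected_component_refl Tp)).
  move=> /(has_winding_numberP 1 n0 Tp) wE; exists p => //.
  by rewrite wE mulr1.
move=> [q av wq]; pose D := connected_component (~` polygon_trace w) q.
have Dav p : D p -> avoids (vertex w) n p by move=> /connected_component_sub.
have cD : connected D := @component_connected _ _ _.
have Dq : D q by exact: connected_component_refl.
have Dw p : D p -> winding (vertex w) n p = 2 * pi.
  by move=> Dp; rewrite -wq; apply: winding_constant Dp Dq => //; exact: vertex_period.
exists D; last first.
  by move=> p Dp; apply/(has_winding_numberP 1 n0 (Dav _ Dp)); rewrite Dw// mulr1.
split; last by exists q.
have [M M0 vM] := vertex_bound (vertex w) n.
exists M%:C; split; first by apply/complex_realP; exists M.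
move=> x Mx p Dp /=; rewrite normcE'.
have [pM|Mp] := leP (cmod p) M; first by rewrite (le_trans _ (ltW Mx))// lecR.
have := Dw _ Dp; rewrite (far_winding vM Mp (vertex_period w)) => /esym/eqP.
by rewrite mulf_eq0 pnatr_eq0/= gt_eqF// pi_gt0.
Qed.

End Counterclockwise.

(** * Star-shaped polygons *)

Section Star.
Variable R : realType.
Implicit Types (v : nat -> R[i]^o) (q p : R[i]^o) (a b z : R[i]).
Implicit Types (s t : R) (n j k : nat).

Definition cross a b : R := Re a * Im b - Im a * Re b.

(** All edges run counter-clockwise as seen from [p], and one turn is made in total; the second
    condition excludes pentagrams. *)
Definition star v n p :=
  (forall k, (k < n)%N -> 0 < cross (v k - p) (v k.+1 - p)) /\
  winding v n p = 2 * pi.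

Lemma Im_divc a b : Im (b / a) = cross a b / cmod a ^+ 2.
Proof.
rewrite sqr_cmod /cross; case: a b => [a1 a2] [b1 b2].
rewrite [X in _ * X]/GRing.inv/=; move: (_ ^+ 2 + _)^-1 => N.
by ring.
Qed.

Lemma cross_edge v p j s s' :
  cross (edge v j s - p) (edge v j s' - p) =
  (s' - s) * cross (v j - p) (v j.+1 - p).
Proof.
rewrite /cross /edge; case: (v j) (v j.+1) p => [a1 a2] [b1 b2] [p1 p2] /=.
by ring.
Qed.

(** If [p] were the point of an edge at parameter s, [cross_edge] against the two ends of the edge
    would force both s = 0 and s = 1. *)
Lemma cross_avoids v n p : (0 < n)%N ->
  (forall k, (k < n)%N -> 0 < cross (v k - p) (v k.+1 - p)) -> avoids v n p.
Proof.
move=> n0 A [t]; rewrite /= in_itv/= => /(polyline_index n0)[k kn kt].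
rewrite (polylineE v kt) => E; have := A _ kn; set c := cross _ _ => c0.
have z0 z : cross (0 : R[i]) z = 0 by rewrite /cross/= !mul0r subrr.
have := cross_edge v p k (t - k%:R) 0; have := cross_edge v p k (t - k%:R) 1.
rewrite E subrr !z0 => /esym/eqP; rewrite mulf_eq0 (gt_eqF c0) orbF => /eqP E1.
move/esym/eqP; rewrite mulf_eq0 (gt_eqF c0) orbF => /eqP; lra.
Qed.

Lemma star_avoids v n p : (0 < n)%N -> star v n p -> avoids v n p.
Proof. by move=> n0 [A _]; exact: cross_avoids. Qed.

Lemma clamp_le j t t' : t <= t' -> clamp j t <= clamp j t'.
Proof.
by move=> tt'; rewrite /clamp ge_max !le_max lexx/= orbC le_min ge_min tt'
  ge_min lexx orbT.
Qed.

Lemma arg_edge_lt v n p j s s' : (0 < n)%N -> star v n p -> (j < n)%N ->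
  0 <= s -> s < s' -> s' <= 1 ->
  arg ((edge v j s - p) / (v j - p)) < arg ((edge v j s' - p) / (v j - p)).
Proof.
move=> n0 st jn s0 ss' s1; have av := star_avoids n0 st.
have vj := avoids_vertex av (ltnW jn).
have A0 := st.1 _ jn.
have I01 x : 0 <= x -> x <= 1 -> 0 <= arg ((edge v j x - p) / (v j - p)) < pi.
  move=> x0 x1; have /andP[_ ->] := arg_bound ((edge v j x - p) / (v j - p)).
  rewrite andbT; move: x0; rewrite le_eqVlt => /predU1P[<-|x0].
    by rewrite edge0 divff// arg1.
  apply/ltW/arg_gt0; rewrite Im_divc -{1}(edge0 v j) cross_edge subr0.
  apply: divr_gt0; first exact: mulr_gt0.
  by rewrite exprn_gt0// cmod_gt0.
have /andP[i1 i2] := I01 s s0 (ltW (lt_le_trans ss' s1)).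
have /andP[i3 i4] := I01 s' (ltW (le_lt_trans s0 ss')) s1.
have s01 : 0 <= s <= 1 by rewrite s0 (ltW (lt_le_trans ss' s1)).
have s'01 : 0 <= s' <= 1 by rewrite s1 (ltW (le_lt_trans s0 ss')).
rewrite -subr_gt0 -argB; [|exact: (slit_edge0 av)|exact: (slit_edge0 av)|]; last first.
  by apply/andP; split; lra.
have es := avoids_edge av jn s01.
rewrite invfM invrK mulrACA mulVf// mulr1.
apply: arg_gt0; rewrite Im_divc cross_edge; apply: divr_gt0.
  by apply: mulr_gt0 => //; rewrite subr_gt0.
by rewrite exprn_gt0// cmod_gt0.
Qed.

(** No summand decreases, and the one of the edge containing [t] increases strictly. *)
Lemma lifted_lt v n p t t' : (0 < n)%N -> star v n p ->
  0 <= t -> t < t' -> t' <= n%:R -> lifted v n p t < lifted v n p t'.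
Proof.
move=> n0 st t0 tt' tn.
have le j : (j < n)%N ->
    arg ((edge v j (clamp j t - j%:R) - p) / (v j - p)) <=
    arg ((edge v j (clamp j t' - j%:R) - p) / (v j - p)).
  move=> jn; have := clamp_le j (ltW tt').
  rewrite le_eqVlt => /predU1P[->//|ltc].
  apply/ltW; have /andP[? _] := clamp_subitv j t.
  have /andP[_ ?] := clamp_subitv j t'.
  by apply: (arg_edge_lt n0 st) => //; rewrite ltrD2r.
have /andP[kt tk] := Num.Theory.truncn_itv t0.
set k := Num.truncn t in kt tk.
have kn : (k < n)%N by rewrite -(ltr_nat R) (le_lt_trans kt)// (lt_le_trans tt').
rewrite /lifted (bigD1 (Ordinal kn))//= [ltRHS](bigD1 (Ordinal kn))//=.
apply: ltr_leD; last by apply: ler_sum => j _; exact: le.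
have /andP[? _] := clamp_subitv k t; have /andP[_ ?] := clamp_subitv k t'.
apply: (arg_edge_lt n0 st) => //; rewrite ltrD2r /clamp.
by rewrite (min_l (ltW tk)) max_r// lt_max lt_min tt' tk orbT.
Qed.

(** A ray from [p] meets the curve at most once: the argument increases strictly and makes less than
    one turn on [0, n), so that equal directions mean equal times. The case c = 1 is the simplicity
    of the curve. *)
Lemma star_ray v n p t t' (c : R) : (0 < n)%N -> star v n p -> 0 < c ->
  0 <= t < n%:R -> 0 <= t' < n%:R ->
  polyline v t - p = c%:C * (polyline v t' - p) -> t = t'.
Proof.
move=> n0 st c0 t01 t'01 E; have av := star_avoids n0 st.
have [a aE] := polar_exists (avoids_vertex av (leq0n n)).
have L (x : R) : 0 <= x < n%:R -> 0 <= lifted v n p x < 2 * pi.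
  move=> /andP[x0 xn]; rewrite -st.2 -lifted_end (lifted_lt n0 st)//= andbT.
  rewrite -(lifted0 av); move: x0; rewrite le_eqVlt => /predU1P[<-//|x0].
  by rewrite ltW// (lifted_lt n0 st)// ltW.
have pos (x : R) : 0 <= x < n%:R -> 0 < cmod (polyline v x - p).
  move=> /andP[x0 xn]; rewrite cmod_gt0 subr_eq0; apply/eqP => xp.
  by apply: av; exists x => //; rewrite /= in_itv/= x0 ltW.
have W (x : R) : 0 <= x < n%:R -> 0 <= x <= n%:R by move=> /andP[-> /ltW].
have EL : lifted v n p t = lifted v n p t'.
  apply: expi_inj; last first.
    have /andP[? ?] := L _ t01; have /andP[? ?] := L _ t'01.
    by rewrite ltr_norml; apply/andP; split; lra.
  have cE : cmod (polyline v t - p) = c * cmod (polyline v t' - p).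
    by rewrite E cmodM cmod_real// ltW.
  have C0 : (cmod (polyline v t - p))%:C != 0.
    by apply/eqP => -[/eqP]; rewrite (gt_eqF (pos _ t01)).
  apply: (mulfI (expi_neq0 a)); rewrite -!expiD; apply: (mulfI C0).
  rewrite -(lifted_argument av aE (W _ t01)) cE rmorphM/= -mulrA.
  by rewrite -(lifted_argument av aE (W _ t'01)).
move: t01 t'01 => /andP[t0 tn] /andP[t'0 t'n].
have [tt'|tt'|//] := ltgtP t t'.
  by have := lifted_lt n0 st t0 tt' (ltW t'n); rewrite EL ltxx.
by have := lifted_lt n0 st t'0 tt' (ltW tn); rewrite EL ltxx.
Qed.

Lemma polyline_half_open v n t : (0 < n)%N -> v n = v 0%N -> 0 <= t <= n%:R ->
  exists2 t', 0 <= t' < n%:R & polyline v t' = polyline v t.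
Proof.
move=> n0 vn /andP[t0]; rewrite le_eqVlt => /predU1P[->|tn].
  by exists 0; rewrite ?lexx ?ltr0n// polyline_nat (polyline_nat v 0).
by exists t; rewrite ?t0.
Qed.

(** Either the segment from [p] to [q] stays off the curve and the winding number is kept, or it
    meets the curve; then, by [star_ray], the ray from [q] away from [p] does not, and it joins [q]
    to far points, of winding number 0. *)
Lemma star_winding v n p q : (0 < n)%N -> v n = v 0%N -> star v n p ->
  avoids v n q -> winding v n q = 2 * pi \/ winding v n q = 0.
Proof.
move=> n0 vn st avq; have avp := star_avoids n0 st.
pose l := edge (fun k => if k is 0%N then p else q) 0.
have lB s : l s - p = s%:C * (q - p).
  rewrite /l /edge; apply/eqP; rewrite eq_complex/=.
  by case: p q {st avp avq l} => [a b] [c d] /=; apply/andP; split; apply/eqP; ring.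
have cl : continuous l by exact: continuous_edge.
have l1 : l 1 = q by rewrite /l edge1.
have l0 : l 0 = p by rewrite /l edge0.
have con I : is_interval I -> connected (l @` I).
  move=> /connected_intervalP cI; apply: connected_continuous_connected => //.
  exact: continuous_subspaceT.
have [seg|] := pselect (forall s, 0 <= s <= 1 -> avoids v n (l s)).
  left; rewrite -st.2.
  apply: (winding_constant vn (con `[0, 1]%classic (@interval_is_interval _ _))).
  - by move=> _ [s + <-]; rewrite /= in_itv/= => /seg.
  - by exists 1 => //; rewrite /= in_itv/= ler01 lexx.
  - by exists 0 => //; rewrite /= in_itv/= ler01 lexx.
move=> /existsNP[s /not_implyP[/andP[s0 s1] /contrapT[t]]].
rewrite /= in_itv/= => /(polyline_half_open n0 vn)[t1 t1n <-] t1E.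
have sp : 0 < s.
  move: s0; rewrite le_eqVlt => /predU1P[sE|//]; exfalso; apply: avp.
  exists t1; last by rewrite t1E -sE l0.
  by rewrite /= in_itv/=; case/andP: t1n => -> /ltW.
have sn1 : s < 1.
  move: s1; rewrite le_eqVlt => /predU1P[sE|//]; exfalso; apply: avq.
  exists t1; last by rewrite t1E sE l1.
  by rewrite /= in_itv/=; case/andP: t1n => -> /ltW.
have qp : q - p != 0.
  apply/eqP => E; apply: avp; exists t1.
    by rewrite /= in_itv/=; case/andP: t1n => -> /ltW.
  by apply/eqP; rewrite -subr_eq0 t1E lB E mulr0.
have ray s' : 1 <= s' -> avoids v n (l s').
  move=> s'1 [t2]; rewrite /= in_itv/= => /(polyline_half_open n0 vn)[t3 t3n <-] t3E.
  have s'0 : 0 < s' by rewrite (lt_le_trans _ s'1).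
  have : t3 = t1.
    apply: (@star_ray v n p _ _ (s' / s)) => //; first by rewrite divr_gt0.
    by rewrite t3E t1E !lB mulrA -rmorphM/= divfK// gt_eqF.
  move=> tE; have : (s' - s)%:C * (q - p) = 0.
    by rewrite rmorphB mulrBl -!lB -t3E -t1E tE subrr.
  move=> /eqP; rewrite mulf_eq0 (negbTE qp) orbF => /eqP[/eqP].
  by rewrite subr_eq0 gt_eqF// (lt_le_trans sn1).
right; have [M M0 vM] := vertex_bound v n.
(* With this K, the modulus of l K - p = K (q - p) is |q - p| + M + 1 + |p|, which puts [l K]
   outside the disc of radius M. *)
pose K := 1 + (M + 1 + cmod p) / cmod (q - p).
have qp0 : 0 < cmod (q - p) by rewrite cmod_gt0.
have K1 : 1 <= K by rewrite lerDl divr_ge0 ?addr_ge0 ?cmod_ge0.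
have far : M < cmod (l K).
  have tri : cmod (l K - p) <= cmod (l K) + cmod p.
    by rewrite -lecR rmorphD/= -!normcE' ler_normB.
  move: tri; rewrite lB cmodM cmod_real ?(le_trans ler01)// /K mulrDl divfK ?gt_eqF//.
  have := qp0; lra.
rewrite -(far_winding vM far vn).
have Iray : is_interval `[1, +oo[%classic := @interval_is_interval R _.
apply: (winding_constant vn (con _ Iray)).
- by move=> _ [s' + <-]; rewrite /= in_itv/= andbT => /ray.
- by exists 1 => //; rewrite /= in_itv/= lexx.
- by exists K => //; rewrite /= in_itv/= K1.
Qed.

End Star.

(** * Star-shaped polygons and their mirror images *)

Section StarPolygon.
Variable R : realType.
Implicit Types (v : nat -> R[i]^o) (q p : R[i]^o) (n j k : nat).

Lemma vertex_mod n (w : 'rV[R[i]^o]_n) k : vertex w (k %% n) = vertex w k.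
Proof. by rewrite /vertex modn_mod. Qed.

Lemma vertex_modS n (w : 'rV[R[i]^o]_n) k : vertex w (k %% n).+1 = vertex w k.+1.
Proof. by rewrite /vertex -addn1 modnDml addn1. Qed.

Lemma star_LSP n (w : 'rV[R[i]^o]_n) p : (0 < n)%N -> star (vertex w) n p ->
  LSP w.
Proof.
move=> n0 st; split; last first.
  by apply/(counterclockwiseP _ n0); exists p; [exact: star_avoids|exact: st.2].
split=> [k|t t'].
  rewrite -vertex_mod -vertex_modS; apply/eqP => E.
  by have := st.1 _ (ltn_pmod k n0); rewrite E /cross mulrC subrr ltxx.
rewrite !inE/= !in_itv/= => t01 t'01 E.
by apply: (star_ray n0 st ltr01 t01 t'01); rewrite mul1r; congr (_ - _).
Qed.

Lemma winding_conj v n q :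
  winding (fun k => conjc (v k) : R[i]^o) n (conjc q) = - winding v n q.
Proof.
rewrite /winding -sumrN; apply: eq_bigr => j _.
by rewrite -arg_conjc rmorphM/= conjc_inv !rmorphB.
Qed.

Lemma polyline_conj v t :
  polyline (fun k => conjc (v k) : R[i]^o) t = conjc (polyline v t).
Proof.
rewrite /polyline /edge; move: (Num.truncn t) => k.
case: (v k) (v k.+1) => [a b] [c d]; apply/eqP; rewrite eq_complex/=.
by apply/andP; split; apply/eqP; ring.
Qed.

Lemma avoids_conj v n q : avoids v n q ->
  avoids (fun k => conjc (v k) : R[i]^o) n (conjc q).
Proof.
move=> av [t t01]; rewrite polyline_conj => /(congr1 conjc); rewrite !conjcK => E.
by apply: av; exists t.
Qed.

(** Conjugation negates [winding], whose values for the conjugate curve are 2 pi and 0; the curve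
    itself never reaches 2 pi. *)
Lemma star_conj_not_ccw n (w : 'rV[R[i]^o]_n) p : (0 < n)%N ->
  star (fun k => conjc (vertex w k) : R[i]^o) n p -> ~ counterclockwise w.
Proof.
move=> n0 st /(counterclockwiseP _ n0)[q av wq].
have vn : conjc (vertex w n) = conjc (vertex w 0%N) by rewrite vertex_period.
have pi0 := pi_gt0 R.
by have [] := star_winding n0 vn st (avoids_conj av); rewrite winding_conj wq; lra.
Qed.

End StarPolygon.

(** * Criteria for a single turn *)

Section StarCriteria.
Variable R : realType.
Implicit Types (v : nat -> R[i]^o) (q p : R[i]^o) (a b c d : R[i]) (n j k : nat).

(** Twice the signed area of the triangle. *)
Definition area a b c : R := cross (b - a) (c - a).

Lemma cross_arg_bound a b : a != 0 -> 0 < cross a b -> 0 < arg (b / a) < pi.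
Proof.
move=> a0 ab; have /andP[_ ->] := arg_bound (b / a).
rewrite andbT; apply: arg_gt0; rewrite Im_divc divr_gt0// exprn_gt0//.
by rewrite cmod_gt0.
Qed.

Lemma int2pi_eq1 (m : int) : 0 < 2 * (pi : R) * m%:~R < 4 * pi -> m = 1.
Proof.
have pi2 : 0 < 2 * pi :> R by rewrite mulr_gt0// pi_gt0.
have -> : 4 * pi = 2 * pi * 2%:~R :> R by rewrite mulrAC -natrM.
by rewrite ltr_pM2l// pmulr_rgt0// ltr0z ltr_int; lia.
Qed.

(* Up to four angles in (0, pi) cannot sum up to 4 pi, and five of them only if *)
(* the sum of any two exceeds pi.                                               *)
Lemma star_small v n p : (0 < n <= 4)%N -> v n = v 0%N ->
  (forall k, (k < n)%N -> 0 < cross (v k - p) (v k.+1 - p)) -> star v n p.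
Proof.
move=> /andP[n0 n4] vn A; split => //.
have av := cross_avoids n0 A.
have [m mE] := winding_int av vn; rewrite mE.
have B k : (k < n)%N -> 0 < arg ((v k.+1 - p) / (v k - p)) < pi.
  by move=> kn; apply: cross_arg_bound (A _ kn); exact: (avoids_vertex av (ltnW kn)).
have pi0 := pi_gt0 R.
have w0 : 0 < winding v n p.
  rewrite /winding (bigD1 (Ordinal n0))//= ltr_pwDl//.
    by case/andP: (B _ n0).
  by apply: sumr_ge0 => j _; case/andP: (B _ (ltn_ord j)) => /ltW.
have w4 : winding v n p < 4 * pi.
  apply: (@lt_le_trans _ _ (\sum_(j < n) pi)); last first.
    by rewrite sumr_const card_ord -[pi *+ n]mulr_natl ler_pM2r// ler_nat.
  rewrite /winding (bigD1 (Ordinal n0))//= [ltRHS](bigD1 (Ordinal n0))//=.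
  apply: ltr_leD; first by case/andP: (B _ n0).
  by apply: ler_sum => j _; case/andP: (B _ (ltn_ord j)) => _ /ltW.
by rewrite (@int2pi_eq1 m) ?mulr1// -mE w0 w4.
Qed.

(** The sine of the sum has the sign of [cross a c], whereas a sum strictly between pi and 2 pi has
    a negative sine. *)
Lemma arg_add_le_pi a b c : a != 0 -> 0 < cross a b -> 0 < cross b c ->
  0 <= cross a c -> arg (b / a) + arg (c / b) <= pi.
Proof.
move=> a0 ab bc ac.
have b0 : b != 0 by apply: contraTneq bc => ->; rewrite /cross/= !mul0r subrr ltxx.
have /andP[x0 x1] := cross_arg_bound a0 ab.
have /andP[y0 y1] := cross_arg_bound b0 bc.
rewrite leNgt; apply/negP => lt.
have c0 : c != 0 by apply: contraTneq bc => ->; rewrite /cross/= !mulr0 subrr ltxx.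
have sl x y : x != 0 -> 0 < cross x y -> slit (y / x).
  move=> x0' xy; apply/orP; left; rewrite Im_divc gt_eqF// divr_gt0//.
  by rewrite exprn_gt0// cmod_gt0.
have : c / a = (cmod (b / a) * cmod (c / b))%:C * expi (arg (b / a) + arg (c / b)).
  rewrite expiD rmorphM/= mulrACA -!polar ?sl//.
  by rewrite [RHS]mulrC mulrA divfK.
move=> /(congr1 (@complex.Im _)); rewrite Im_divc /expi /= mul0r addr0 => E.
have r0 : 0 < cmod (b / a) * cmod (c / b).
  by rewrite mulr_gt0 // cmod_gt0 mulf_neq0 ?invr_eq0.
have : 0 <= sin (arg (b / a) + arg (c / b)).
  by rewrite -(pmulr_rge0 _ r0) -E divr_ge0// exprn_ge0// cmod_ge0.
have : 0 < sin (arg (b / a) + arg (c / b) - pi).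
  by apply: sin_gt0_pi; apply/andP; split; lra.
by rewrite sinB cospi sinpi mulrN1 mulr0 subr0; lra.
Qed.

(** The two angles at [p] on both sides of [v k.+1] are together at most pi, so that the five sum up
    to less than 4 pi, hence to 2 pi. *)
Lemma star_pentagon v p k : (forall j, v (j + 5)%N = v j) ->
  (forall j, 0 < cross (v j - p) (v j.+1 - p)) ->
  0 <= cross (v k - p) (v k.+2 - p) -> star v 5 p.
Proof.
move=> per A Ck; split; first by move=> j _; exact: A.
have av : avoids v 5 p by apply: cross_avoids => // j _; exact: A.
have [m mE] := winding_int av (per 0%N); rewrite mE.
have perm j : v (j %% 5)%N = v j.
  rewrite [in RHS](divn_eq j 5); elim: (j %/ 5)%N => [//|i IH].
  by rewrite mulSn -addnA addnC per.
have vj j : v j - p != 0.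
  by rewrite -perm; apply: (avoids_vertex av); rewrite ltnW// ltn_pmod.
pose a j := arg ((v j.+1 - p) / (v j - p)).
have B j : 0 < a j < pi by exact: cross_arg_bound.
have permS j : a (j %% 5)%N = a j.
  by rewrite /a perm -(perm (j %% 5).+1) -[(j %% 5).+1]addn1 modnDml addn1 perm.
have a2 : a (k %% 5)%N + a (k %% 5).+1 <= pi.
  rewrite -(permS (k %% 5).+1) -[(k %% 5).+1]addn1 modnDml addn1 !permS.
  by apply: arg_add_le_pi.
have pi0 := pi_gt0 R.
have wE : winding v 5 p = a 0%N + a 1%N + a 2%N + a 3%N + a 4%N.
  by rewrite /winding !big_ord_recr big_ord0/= add0r.
have a5 : a 5%N = a 0%N by rewrite -permS.
have := (B 0%N, B 1%N, B 2%N, B 3%N, B 4%N).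
move=> [[[[/andP[? ?] /andP[? ?]] /andP[? ?]] /andP[? ?]] /andP[? ?]].
have w4 : winding v 5 p < 4 * pi.
  rewrite wE; move: a2; have : (k %% 5 < 5)%N by rewrite ltn_pmod.
  by case: (k %% 5)%N => [|[|[|[|[|//]]]]] _; rewrite ?a5; lra.
have w0 : 0 < winding v 5 p by rewrite wE; lra.
by rewrite (@int2pi_eq1 m) ?mulr1// -mE w0 w4.
Qed.

(** A pair (x, y) stands for the affine function x + e y; finitely many strict inequalities at e = 0
    survive for a common small e. *)
Lemma small_perturbation (s : seq (R * R)) :
  (forall x, x \in s -> 0 < x.1) ->
  exists2 e, 0 < e & forall x, x \in s -> 0 < x.1 + e * x.2.
Proof.
move=> s0; suff [e e0 H] : exists2 e, 0 < e & forall e', 0 < e' <= e ->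
    forall x, x \in s -> 0 < x.1 + e' * x.2.
  by exists e => //; apply: H; rewrite e0 lexx.
elim: s s0 => [|[x y] s IHs] s0; first by exists 1.
have [|e e0 H] := IHs; first by move=> z zs; apply: s0; rewrite inE zs orbT.
have x0 : 0 < x by apply: (s0 (x, y)); rewrite inE eqxx.
have y1 : 0 < 1 + `|y| by rewrite ltr_pwDl.
exists (Num.min e (x / (1 + `|y|))); first by rewrite lt_min e0 divr_gt0.
move=> e' /andP[e'0]; rewrite le_min => /andP[e'e e'x] z.
rewrite inE => /predU1P[->/=|zs]; last by apply: H => //; rewrite e'0.
move: e'x; rewrite ler_pdivlMr// => e'x.
have : - `|y| <= y by rewrite lerNl -normrN ler_norm.
by nra.
Qed.

(** The vertex [v k] sees the three edges not containing it counter-clockwise, and a point moved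
    slightly from it into the interior angle sees all five so. Two consecutive angles of sum at most
    pi, found through [pos] at a convex angle, exclude a double turn; [flat] excludes a spike at
    [v k]. *)
Lemma pentagon_fan v k : (forall j, v (j + 5)%N = v j) ->
  0 < area (v k) (v k.+1) (v k.+2) -> 0 < area (v k) (v k.+2) (v k.+3) ->
  0 < area (v k) (v k.+3) (v k.+4) ->
  (0 < area (v k.+4) (v k) (v k.+1) -> 0 < area (v k) (v k.+1) (v k.+3) \/
     0 < area (v k) (v k.+2) (v k.+4)) ->
  (area (v k.+4) (v k) (v k.+1) = 0 -> exists2 c : R, 0 < c &
    v k - v k.+4 = c%:C * (v k.+1 - v k)) ->
  exists p, star v 5 p.
Proof.
move=> per A1 A2 A3 pos flat.
set x := v k; set a := v k.+1 - x; set b := v k.+4 - x.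
have tE : area (v k.+4) (v k) (v k.+1) = cross a b.
  rewrite /area /cross /a /b /x; case: (v k) (v k.+1) (v k.+4) => [? ?] [? ?] [? ?] /=.
  by ring.
(* A direction into the interior angle: a + b if the angle is convex, - (a + b) if it is reflex, a
   quarter turn of a if it is flat. *)
have [d ad db] : exists2 d, 0 < cross a d & 0 < cross d b.
  have [t0|t0|t0] := ltgtP 0 (cross a b).
  - by exists (a + b); move: t0; rewrite /cross; case: (a) (b) => [? ?] [? ?] /=; lra.
  - by exists (- (a + b)); move: t0; rewrite /cross; case: (a) (b) => [? ?] [? ?] /=; lra.
  - have := flat; rewrite tE -t0 => /(_ erefl)[c c0 cE].
    have bE : b = - (c%:C * a) by rewrite -cE /b opprB.
    have a0 : 0 < Re a ^+ 2 + Im a ^+ 2.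
      rewrite -sqr_cmod exprn_gt0// cmod_gt0; apply: contraTneq A1 => a0.
      by rewrite /area -/x -/a a0 /cross/= !mul0r subrr ltxx.
    exists (- Im a +i* Re a); rewrite ?bE /cross; case: (a) a0 => a1 a2 /= a0.
      by lra.
    by nra.
pose z j := v (k + j)%N - x.
(* Value and slope at e = 0 of the cross product seen from x + e d, which is affine in e because the
   cross product of d with itself vanishes. *)
pose f i j := (cross (z i) (z j), - (cross d (z j)) - cross (z i) d).
have fE e i j : cross (z i - e%:C * d) (z j - e%:C * d) = (f i j).1 + e * (f i j).2.
  by rewrite /f/= /cross; case: (z i) (z j) (d) => [? ?] [? ?] [? ?] /=; ring.
have zE : (z 1%N = a) * (z 4%N = b) * (z 2%N = v k.+2 - x) * (z 3%N = v k.+3 - x) * (z 0%N = 0).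
  by rewrite /z /a /b addn0 addn1 addn2 addn3 addn4 subrr.
have A1' : 0 < cross (z 1%N) (z 2%N) by rewrite !zE.
have A2' : 0 < cross (z 2%N) (z 3%N) by rewrite !zE.
have A3' : 0 < cross (z 3%N) (z 4%N) by rewrite !zE.
have [i [j [ijE [e e0 He]]]] : exists i j, (j = i.+2)%N /\ exists2 e, 0 < e &
    [/\ 0 < (f 1%N 2%N).1 + e * (f 1%N 2%N).2, 0 < (f 2%N 3%N).1 + e * (f 2%N 3%N).2,
        0 < (f 3%N 4%N).1 + e * (f 3%N 4%N).2 & 0 <= (f i j).1 + e * (f i j).2].
  have step i j : 0 < cross (z i) (z j) -> exists2 e, 0 < e &
    [/\ 0 < (f 1%N 2%N).1 + e * (f 1%N 2%N).2, 0 < (f 2%N 3%N).1 + e * (f 2%N 3%N).2,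
        0 < (f 3%N 4%N).1 + e * (f 3%N 4%N).2 & 0 <= (f i j).1 + e * (f i j).2].
    move=> Cij.
    have [|e e0 He] := @small_perturbation [:: f 1%N 2%N; f 2%N 3%N; f 3%N 4%N; f i j].
      by move=> y; rewrite !inE => /or4P[] /eqP ->.
    by exists e => //; split; [| | |apply: ltW]; apply: He;
      rewrite !inE eqxx ?orbT.
  have [t0|t0] := ltP 0 (cross a b).
    have [] := pos; rewrite ?tE// => C.
      by exists 1%N, 3%N; split=> //; apply: step; rewrite !zE.
    by exists 2%N, 4%N; split=> //; apply: step; rewrite !zE.
  (* At a reflex or flat angle the two edges at [v k], from index 4 through 5 to 6, together subtend
     at most pi at the new point. *)
  exists 4%N, 6%N; split=> //.
  have [e e0 [? ? ? _]] := step _ _ A1'.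
  have z6 : z 6%N = a by rewrite /z -[6%N]/(1 + 5)%N addnA per addn1.
  exists e => //; split=> //; rewrite -fE z6 zE.
  have : cross (b - e%:C * d) (a - e%:C * d) = - cross a b + e * (cross d b + cross a d).
    by rewrite /cross; case: (a) (b) (d) => [? ?] [? ?] [? ?] /=; ring.
  move=> ->; apply: addr_ge0; rewrite ?oppr_ge0//.
  by apply: mulr_ge0; [exact: ltW|apply: addr_ge0; exact: ltW].
exists (x + e%:C * d).
have zp j' : v (k + j')%N - (x + e%:C * d) = z j' - e%:C * d.
  by rewrite /z opprD addrA.
case: He => H1 H2 H3 H4.
have Ak j' : (j' < 5)%N -> 0 < cross (v (k + j')%N - (x + e%:C * d)) (v (k + j').+1 - (x + e%:C * d)).
  rewrite -addnS !zp.
  case: j' => [|[|[|[|[|//]]]]] _; [|by rewrite fE|by rewrite fE|by rewrite fE|].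
    have -> : cross (z 0%N - e%:C * d) (z 1%N - e%:C * d) = e * cross a d.
      by rewrite !zE /cross; case: (a) (d) => [? ?] [? ?] /=; ring.
    by rewrite mulr_gt0.
  have z5 : z 5%N = 0 by rewrite /z per subrr.
  have -> : cross (z 4%N - e%:C * d) (z 5%N - e%:C * d) = e * cross d b.
    by rewrite z5 !zE /cross; case: (b) (d) => [? ?] [? ?] /=; ring.
  by rewrite mulr_gt0.
have perM i' j' : v (j' + i' * 5)%N = v j'.
  by elim: i' => [|i' IH]; rewrite ?addn0// mulSn addnCA addnC per.
apply: (star_pentagon (k := k + i)%N) => //.
  (* Modulo 5 this is j' - k, the position of vertex j' counted from k. *)
  move=> j'; pose l := (j' + k * 4)%N.
  have jE : (j' + k * 5 = k + l %% 5 + (l %/ 5) * 5)%N.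
    by rewrite -addnA [(l %% 5 + _)%N]addnC -divn_eq /l mulnS addnCA.
  rewrite -(perM k j') -(perM k j'.+1) addSn jE perM -addSn perM.
  exact/Ak/ltn_pmod.
by rewrite -!addnS !zp fE -ijE.
Qed.

End StarCriteria.

(** * Simple polygons with at most five vertices are star-shaped *)

Section SimplePolygon.
Variable R : realType.
Implicit Types (v : nat -> R[i]^o) (q p : R[i]^o) (a b c d : R[i]) (n j k : nat).
Implicit Types (s t : R).

Lemma simple_edge_inj n (w : 'rV[R[i]^o]_n) j k s s' : (0 < n)%N ->
  simple_polygon w -> 0 <= s < 1 -> 0 <= s' < 1 ->
  edge (vertex w) j s = edge (vertex w) k s' -> j = k %[mod n].
Proof.
move=> n0 [_ inj] s01 s'01.
have aux i x : 0 <= x < 1 -> ((i %% n)%:R + x \in `[0, n%:R[) /\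
    polygon_curve w ((i %% n)%:R + x) = edge (vertex w) i x.
  move=> /andP[x0 x1]; split.
    rewrite in_itv/= addr_ge0//= (@lt_le_trans _ _ (i %% n).+1%:R)//.
      by rewrite -[(i %% n).+1%:R]natr1 ltrD2l.
    by rewrite ler_nat ltn_pmod.
  rewrite -[LHS]/(polyline (vertex w) _) (@polylineE _ _ (i %% n)); last first.
    by rewrite lerDl x0 -[(i %% n).+1%:R]natr1 lerD2l ltW.
  by rewrite addrAC subrr add0r /edge vertex_mod vertex_modS.
have [j1 j2] := aux j s s01; have [k1 k2] := aux k s' s'01.
rewrite -j2 -k2 => /inj; rewrite !inE => /(_ j1 k1) E.
move: s01 s'01 => /andP[s0 s1] /andP[s'0 s'1].
rewrite -(@truncn_def R ((j %% n)%:R + s) (j %% n)).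
  rewrite E (@truncn_def R _ (k %% n))//.
  by rewrite lerDl s'0 -[(k %% n).+1%:R]natr1 ltrD2l.
by rewrite lerDl s0 -[(j %% n).+1%:R]natr1 ltrD2l.
Qed.

(** The right endpoint of an edge is the left endpoint of the next one, which reduces closed edges
    to the half-open ones of [simple_edge_inj]. *)
Lemma simple_disjoint n (w : 'rV[R[i]^o]_n) j k s s' : (0 < n)%N ->
  simple_polygon w -> j != k %[mod n] -> j.+1 != k %[mod n] ->
  j != k.+1 %[mod n] -> 0 <= s <= 1 -> 0 <= s' <= 1 ->
  edge (vertex w) j s != edge (vertex w) k s'.
Proof.
move=> n0 sw jk j1k jk1 s01 s'01; apply/eqP.
have norm i x : 0 <= x <= 1 -> exists i' x',
   [/\ (i' == i) || (i' == i.+1), 0 <= x' < 1 & edge (vertex w) i x = edge (vertex w) i' x'].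
  move=> /andP[x0]; rewrite le_eqVlt => /predU1P[->|x1]; last first.
    by exists i, x; rewrite eqxx x0 x1.
  by exists i.+1, 0; rewrite eqxx orbT lexx ltr01 edge0 edge1.
have [j' [x [j'E x01 ->]]] := norm j s s01.
have [k' [y [k'E y01 ->]]] := norm k s' s'01.
move=> /(simple_edge_inj n0 sw x01 y01) /eqP; apply/negP.
case/orP: j'E => /eqP ->; case/orP: k'E => /eqP -> //.
by rewrite -addn1 -(addn1 k) eqn_modDr.
Qed.

(** D is, up to sign, the cross product of the two directions. If it is not 0, the supporting lines
    meet at the parameters - area c d a / D and area a b c / D, which the sign conditions place in
    [0, 1]. If it is 0, the areas in each product coincide, and a nonpositive square is 0. *)
Lemma disjoint_segments_area a b c d :
  (forall s s', 0 <= s <= 1 -> 0 <= s' <= 1 ->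
    (1 - s)%:C * a + s%:C * b != (1 - s')%:C * c + s'%:C * d) ->
  area a b c * area a b d <= 0 -> area c d a * area c d b <= 0 ->
  [/\ area a b c = 0, area a b d = 0, area c d a = 0 & area c d b = 0].
Proof.
move=> dis.
have rel : area a b c - area a b d = area c d b - area c d a.
  by rewrite /area /cross; case: a b c d {dis} => [? ?] [? ?] [? ?] [? ?] /=; ring.
have solve (D m e a1 b1 c1 d1 : R) : D != 0 ->
    D * a1 + e * (b1 - a1) = D * c1 + m * (d1 - c1) ->
    (1 - e / D) * a1 + e / D * b1 = (1 - m / D) * c1 + m / D * d1.
  move=> D0 E; apply: (mulfI D0).
  transitivity (D * a1 + e * (b1 - a1)); first by field.
  by rewrite E; field.
pose D := area a b c - area a b d.
have pt : D != 0 -> (1 - (- area c d a / D))%:C * a + (- area c d a / D)%:C * b =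
    (1 - area a b c / D)%:C * c + (area a b c / D)%:C * d.
  move=> D0; have R1 : D * Re a - area c d a * (Re b - Re a) =
      D * Re c + area a b c * (Re d - Re c).
    by rewrite /D /area /cross; case: a b c d {dis rel D D0} => [? ?] [? ?] [? ?] [? ?] /=; ring.
  have I1 : D * Im a - area c d a * (Im b - Im a) =
      D * Im c + area a b c * (Im d - Im c).
    by rewrite /D /area /cross; case: a b c d {dis rel D D0 R1} => [? ?] [? ?] [? ?] [? ?] /=; ring.
  rewrite -mulNr in R1; rewrite -mulNr in I1.
  have {}R1 := solve _ _ _ _ _ _ _ D0 R1; have {}I1 := solve _ _ _ _ _ _ _ D0 I1.
  have ReZ (x : R) (z : R[i]) : Re (x%:C * z) = x * Re z.
    by case: z => ? ? /=; rewrite mul0r subr0.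
  have ImZ (x : R) (z : R[i]) : Im (x%:C * z) = x * Im z.
    by case: z => ? ? /=; rewrite mul0r addr0.
  apply/eqP; rewrite eq_complex.
  have [addR addI] : (forall x y : R[i], Re (x + y) = Re x + Re y) /\
      (forall x y : R[i], Im (x + y) = Im x + Im y) by split=> -[? ?] [? ?].
  rewrite !addR !addI !ReZ !ImZ.
  by apply/andP; split; apply/eqP; [exact: R1|exact: I1].
have [D0|D0] := eqVneq D 0.
  move: D0 rel; rewrite /D; move: (area a b c) (area a b d) (area c d a) (area c d b).
  by move=> x y z t D0 rel xy zt; split; nra.
move=> xy zt; have H := dis (- area c d a / D) (area a b c / D).
have frac x : x * (x - D) <= 0 -> 0 <= x / D <= 1.
  move=> xD; have D2 : 0 < D ^+ 2 by rewrite exprn_even_gt0.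
  have -> : x / D = x * D / D ^+ 2 by field.
  rewrite ler_pdivlMr// ler_pdivrMr// mul0r mul1r.
  by apply/andP; split; nra.
have [] := negP (H _ _); last by rewrite pt.
- by apply: frac; move: rel zt; rewrite /D; nra.
- by apply: frac; move: xy; rewrite /D; nra.
Qed.

(** Collinear consecutive edges are multiples of one another, and a negative factor would fold the
    second edge back over the first. *)
Lemma simple_flat n (w : 'rV[R[i]^o]_n) k : (1 < n)%N -> simple_polygon w ->
  area (vertex w k) (vertex w k.+1) (vertex w k.+2) = 0 ->
  exists2 c : R, 0 < c & vertex w k.+1 - vertex w k =
    c%:C * (vertex w k.+2 - vertex w k.+1).
Proof.
move=> n1 sw; have n0 := ltnW n1.
set a := vertex w k; set b := vertex w k.+1; set c := vertex w k.+2.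
have ab : a != b by have := sw.1 k.
have bc : b != c by have := sw.1 k.+1.
set u := b - a; set z := c - b => A0.
have {A0} uz : cross u z = 0.
  rewrite -A0 /u /z /area /cross; case: a b c {ab bc u z A0} => [? ?] [? ?] [? ?] /=.
  by ring.
have z0 : 0 < cmod z by rewrite cmod_gt0 subr_eq0 eq_sym.
have u0 : 0 < cmod u by rewrite cmod_gt0 subr_eq0 eq_sym.
pose m := (Re u * Re z + Im u * Im z) / cmod z ^+ 2.
have uE : u = m%:C * z.
  have n2 : Re z ^+ 2 + Im z ^+ 2 != 0 by rewrite -sqr_cmod expf_neq0// gt_eqF.
  move: uz n2; rewrite /m sqr_cmod /cross.
  case: (u) (z) => [u1 u2] [z1 z2] /= uz n2.
  apply/eqP; rewrite eq_complex/= mul0r subr0 mul0r addr0.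
  have e1 : u1 * (z1 ^+ 2 + z2 ^+ 2) = (u1 * z1 + u2 * z2) * z1.
    by apply/eqP; rewrite -subr_eq0; apply/eqP; rewrite -(mulr0 z2) -uz; ring.
  have e2 : u2 * (z1 ^+ 2 + z2 ^+ 2) = (u1 * z1 + u2 * z2) * z2.
    by apply/eqP; rewrite -subr_eq0; apply/eqP; rewrite -(mulr0 (- z1)) -uz; ring.
  by rewrite ![_ / _ * _]mulrAC -e1 -e2 !mulfK// !eqxx.
exists m => //; rewrite ltNge; apply/negP => m0.
have m1 : m < 0.
  rewrite lt_neqAle m0 andbT; apply: contraTneq u0 => mE.
  by rewrite uE mE mul0r cmod_gt0 eqxx.
(* The edges [a, b] and [b, c] overlap near b. *)
pose s := (1 - m)^-1.
have h0 : 0 < 1 - m by lra.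
have s0 : 0 < s by rewrite invr_gt0.
have s1 : s < 1 by rewrite invf_lt1//; lra.
(* The point b - x u of the first edge is b + y z on the second one because u = m z and y = - m x;
   this x puts both parameters into (0, 1). *)
pose x := s / 2; pose y := - m * x.
have hx : 0 < x < 1 by rewrite /x; apply/andP; split; lra.
have my : y = (1 - s) / 2.
  by rewrite /y /x /s; field; rewrite gt_eqF.
have hy : 0 < y < 1 by rewrite my; apply/andP; split; lra.
have := @simple_edge_inj n w k k.+1 (1 - x) y n0 sw.
case/andP: hx => x0 x1; case/andP: hy => y0 y1.
have E : edge (vertex w) k (1 - x) = edge (vertex w) k.+1 y.
  rewrite /edge -/a -/b -/c; have aE : a = b - m%:C * z by rewrite -uE /u opprB addrC subrK.
  have cE : c = b + z by rewrite /z addrC subrK.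
  rewrite aE cE /y; case: (b) (z) => [b1 b2] [z1 z2]; apply/eqP.
  by rewrite eq_complex/=; apply/andP; split; apply/eqP; ring.
move=> /(_ _ _ E) => H; have : k = k.+1 %[mod n].
  by apply: H; apply/andP; split; lra.
move/eqP; rewrite -addn1 -[X in X == _ %[mod n]]addn0 eqn_modDl.
by rewrite mod0n modn_small.
Qed.

(** If all vertices were flat, all edges would be positive multiples of the first one and could not
    sum up to 0. *)
Lemma simple_not_flat n (w : 'rV[R[i]^o]_n) : (1 < n)%N -> simple_polygon w ->
  exists k, area (vertex w k) (vertex w k.+1) (vertex w k.+2) != 0.
Proof.
move=> n1 sw; apply: contrapT => /forallNP flat.
have flat_step k : exists2 c : R, 0 < c & vertex w k.+1 - vertex w k =
    c%:C * (vertex w k.+2 - vertex w k.+1).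
  by apply: (simple_flat n1 sw); apply/eqP/negPn/negP; exact: flat.
pose e k := vertex w k.+1 - vertex w k.
have [c [c0 cE]] : exists c : nat -> R, (forall k, 0 < c k) /\
    forall k, e k.+1 = (c k)%:C * e 0%N.
  suff /choice[c cE] : forall k, exists c : R, 0 < c /\ e k.+1 = c%:C * e 0%N.
    by exists c; split=> k; have [] := cE k.
  elim=> [|k [c [c0 cE]]].
    have [c c0 cE] := flat_step 0%N; exists c^-1; rewrite invr_gt0; split=> //.
    by rewrite /e cE mulrA -rmorphM/= mulVf ?gt_eqF// mul1r.
  have [d d0 dE] := flat_step k.+1; exists (d^-1 * c); split.
    by rewrite mulr_gt0// invr_gt0.
  rewrite rmorphM/= -mulrA -cE /e dE mulrA -rmorphM/= mulVf ?gt_eqF//.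
  by rewrite mul1r.
have e0 : e 0%N != 0 by rewrite subr_eq0 eq_sym; have := sw.1 0%N.
have : \sum_(0 <= k < n) e k = 0.
  by rewrite telescope_sumr// vertex_period subrr.
rewrite big_ltn ?(ltnW n1)// -(prednK (ltnW n1)) big_add1/=.
under eq_bigr do rewrite cE; rewrite -mulr_suml -rmorph_sum/=.
rewrite -[X in X + _]mul1r -mulrDl => /eqP; rewrite mulf_eq0 (negbTE e0) orbF.
move=> /eqP[/eqP]; rewrite gt_eqF// ltr_pwDl//.
by apply: sumr_ge0 => k _; exact: ltW.
Qed.

End SimplePolygon.

(* [None] is the sign of 0, [Some true] the sign of a positive number. *)
Definition sign_mul (a b : option bool) : option bool :=
  if a is Some x then if b is Some y then Some (x == y) else None else None.

(** Whether a sum of numbers of signs [a] and [b] can have the sign [c]. *)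
Definition sign_sum (c a b : option bool) : bool :=
  if a is Some x then
    if b is Some y then if x == y then c == a else true else c == a
  else c == b.

Definition forall_sign (P : option bool -> bool) : bool :=
  if P None then if P (Some true) then P (Some false) else false else false.

Lemma forall_signP P a : forall_sign P -> P a.
Proof.
by rewrite /forall_sign; case: a => [[]|]; case: ifP => //; case: ifP.
Qed.

(* The arguments are the signs of t_k, t_{k+1}, t_{k+2}, t_{k+4}, d_k, d_{k+2} *)
(* and d_{k+3}, for the areas t_k = [k-1, k, k+1] and d_k = [k, k+2, k+3].     *)
Definition simple_signs (t0 t1 t2 t4 d0 d2 d3 : option bool) : bool :=
  let nonpos a b := if sign_mul a b is Some true then false else true in
  [&& sign_sum (sign_mul d2 d3) (sign_mul t4 t1) (sign_mul d0 t0),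
    if nonpos t1 d3 then if nonpos t2 d0 then
      [&& t1 == None, d3 == None, t2 == None & d0 == None] else true else true &
    if t0 is None then (t1 == d2) && (t4 == d3) else true].

(** The sign conditions of [pentagon_fan] at one vertex, for the polygon itself if [e] is true and
    for its mirror image otherwise. *)
Definition fan_sign (e : bool) (t0 t1 t4 d0 d2 d3 : option bool) : bool :=
  [&& t4 == Some e, t1 == Some e, d0 == Some e &
      [|| t0 != Some e, d2 == Some e | d3 == Some e]].

Definition some_fan_sign (e : bool) (t0 t1 t2 t3 t4 d0 d1 d2 d3 d4 : option bool) : bool :=
  [|| fan_sign e t0 t1 t4 d0 d2 d3, fan_sign e t1 t2 t0 d1 d3 d4,
      fan_sign e t2 t3 t1 d2 d4 d0, fan_sign e t3 t4 t2 d3 d0 d1 |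
      fan_sign e t4 t0 t3 d4 d1 d2].

(** Three facts enter at each vertex: a three-term Pluecker relation, the disjointness of two
    non-adjacent edges, and the position of a flat vertex between its neighbours. They leave a fan
    of either orientation, unless all vertices are flat. *)
Lemma pentagon_signs t0 t1 t2 t3 t4 d0 d1 d2 d3 d4 :
  simple_signs t0 t1 t2 t4 d0 d2 d3 -> simple_signs t1 t2 t3 t0 d1 d3 d4 ->
  simple_signs t2 t3 t4 t1 d2 d4 d0 -> simple_signs t3 t4 t0 t2 d3 d0 d1 ->
  simple_signs t4 t0 t1 t3 d4 d1 d2 ->
  [|| [&& t0 == None, t1 == None, t2 == None, t3 == None & t4 == None],
      some_fan_sign true t0 t1 t2 t3 t4 d0 d1 d2 d3 d4 |
      some_fan_sign false t0 t1 t2 t3 t4 d0 d1 d2 d3 d4].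
Proof.
(* The quantifiers are ordered so that the conditions at vertices 0 and 3 prune the 3^10 sign
   vectors early; conditionals keep the pruned branches from being evaluated. *)
have : forall_sign (fun t0 => forall_sign (fun t1 => forall_sign (fun t2 =>
  forall_sign (fun t4 => forall_sign (fun d0 => forall_sign (fun d2 =>
  forall_sign (fun d3 => if simple_signs t0 t1 t2 t4 d0 d2 d3 then
  forall_sign (fun t3 => forall_sign (fun d1 =>
    if simple_signs t3 t4 t0 t2 d3 d0 d1 then forall_sign (fun d4 =>
      if simple_signs t1 t2 t3 t0 d1 d3 d4 then
      if simple_signs t2 t3 t4 t1 d2 d4 d0 then
      if simple_signs t4 t0 t1 t3 d4 d1 d2 then
  [|| [&& t0 == None, t1 == None, t2 == None, t3 == None & t4 == None],
      some_fan_sign true t0 t1 t2 t3 t4 d0 d1 d2 d3 d4 |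
      some_fan_sign false t0 t1 t2 t3 t4 d0 d1 d2 d3 d4] else true else true else true)
    else true)) else true))))))).
  by vm_compute.
move=> /(forall_signP t0)/(forall_signP t1)/(forall_signP t2)/(forall_signP t4).
move=> /(forall_signP d0)/(forall_signP d2)/(forall_signP d3) H H0 H1 H2 H3 H4.
move: H; rewrite H0 => /(forall_signP t3)/(forall_signP d1); rewrite H3.
by move=> /(forall_signP d4); rewrite H1 H2 H4.
Qed.

(** * Polygons with three to five vertices through signs of areas *)

Section SimpleStar.
Variable R : realType.
Implicit Types (v : nat -> R[i]^o) (p : R[i]^o) (n k : nat) (x y : R).

Definition sgo x : option bool := if x == 0 then None else Some (0 < x).

Lemma sgo_None x : (sgo x == None) = (x == 0).
Proof. by rewrite /sgo; case: (x == 0). Qed.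

Lemma sgo_true x : (sgo x == Some true) = (0 < x).
Proof. by rewrite /sgo; case: ltgtP. Qed.

Lemma sgo_false x : (sgo x == Some false) = (x < 0).
Proof. by rewrite /sgo; case: ltgtP. Qed.

Lemma sgo_mul x y : sgo (x * y) = sign_mul (sgo x) (sgo y).
Proof.
rewrite /sgo mulf_eq0; have [x0|x0|->] := ltgtP x 0;
  have [y0|y0|->] := ltgtP y 0 => //=.
- by rewrite nmulr_rgt0// y0.
- by rewrite nmulr_rgt0// (lt_gtF y0).
- by rewrite pmulr_rgt0// (lt_gtF y0).
- by rewrite pmulr_rgt0// y0.
Qed.

Lemma sgo_sum x y : sign_sum (sgo (x + y)) (sgo x) (sgo y).
Proof.
rewrite /sgo; have [x0|x0|->] := ltgtP x 0; have [y0|y0|->] := ltgtP y 0;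
  rewrite ?add0r ?addr0 ?eqxx //=.
- have s : x + y < 0 by lra.
  by rewrite (lt_eqF s) ltNge (ltW s).
- by rewrite lt_eqF// ltNge ltW.
- by rewrite gt_eqF ?addr_gt0.
- by rewrite gt_eqF// x0.
- by rewrite lt_eqF// ltNge ltW.
- by rewrite gt_eqF// y0.
Qed.

Lemma sgo_pos_scale (c : R) x : 0 < c -> sgo (c * x) = sgo x.
Proof. by move=> c0; rewrite /sgo mulf_eq0 gt_eqF//= pmulr_rgt0. Qed.

Lemma area_rot (a b c : R[i]) : area a b c = area b c a.
Proof. by rewrite /area /cross; case: a b c => [? ?] [? ?] [? ?] /=; ring. Qed.

Lemma area_conj (a b c : R[i]) : area (conjc a) (conjc b) (conjc c) = - area a b c.
Proof. by rewrite /area /cross; case: a b c => [? ?] [? ?] [? ?] /=; ring. Qed.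

Lemma vertex_add n (w : 'rV[R[i]^o]_n) k : vertex w (k + n) = vertex w k.
Proof. by rewrite -vertex_mod modnDr vertex_mod. Qed.

Lemma vertex_modD n (w : 'rV[R[i]^o]_n) k j :
  vertex w (k %% n + j) = vertex w (k + j).
Proof. by rewrite -vertex_mod modnDml vertex_mod. Qed.

Section Pentagon.
Variable w : 'rV[R[i]^o]_5.
Let v := vertex w.
Let t k := area (v (k + 4)) (v k) (v k.+1).
Let d k := area (v k) (v k.+2) (v k.+3).

Let per k : v (k + 5)%N = v k. Proof. exact: vertex_add. Qed.

Let tper k : t (k + 5) = t k.
Proof. by rewrite /t addnAC per per -addSn per. Qed.

Let dper k : d (k + 5) = d k.
Proof. by rewrite /d -!addSn !per. Qed.

(** The three-term Pluecker relation for the four vectors from [v k] to the other vertices. *)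
Let plucker k : d (k + 2) * d (k + 3) = t (k + 4) * t (k + 1) + d k * t k.
Proof.
have vS i : v i.+4.+1 = v i by have := per i; rewrite addnC.
rewrite /d /t !(addn1, addn2, addn3, addn4) !vS.
move: (v k) (v k.+1) (v k.+2) (v k.+3) (v k.+4).
move=> [a a'] [b b'] [c c'] [e e'] [f f'].
by rewrite /area /cross /=; ring.
Qed.

Hypothesis sw : simple_polygon w.

(** The factors are the areas that the edges starting at [v k] and at [v k.+2] form with the
    endpoints of each other. *)
Let disjoint_sign k : t (k + 1) * d (k + 3) <= 0 -> t (k + 2) * d k <= 0 ->
  [/\ t (k + 1) = 0, d (k + 3) = 0, t (k + 2) = 0 & d k = 0].
Proof.
have vS i : v i.+4.+1 = v i by have := per i; rewrite addnC.
have -> : t (k + 1) = area (v k) (v k.+1) (v k.+2).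
  by rewrite /t !(addn1, addn4) vS.
have -> : d (k + 3) = area (v k) (v k.+1) (v k.+3).
  by rewrite /d !addn3 !vS area_rot.
have -> : t (k + 2) = area (v k.+2) (v k.+3) (v k.+1).
  by rewrite /t !(addn2, addn4) vS area_rot.
have -> : d k = area (v k.+2) (v k.+3) (v k) by rewrite /d area_rot.
move=> x0; rewrite mulrC => y0.
have [] := disjoint_segments_area _ x0 y0; last by split.
have ne i j : (i %% 5 != j %% 5)%N -> (k + i != k + j %[mod 5])%N.
  by rewrite eqn_modDl.
move: (ne 0%N 2%N isT) (ne 1%N 2%N isT) (ne 0%N 3%N isT).
rewrite !(addn0, addn1, addn2, addn3) => n1 n2 n3.
by move=> s s' s01 s'01; apply: (simple_disjoint _ sw).
Qed.

Let flat k : t k = 0 -> exists2 c : R, 0 < c & v k - v (k + 4) = c%:C * (v k.+1 - v k).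
Proof.
have vS i : v i.+4.+1 = v i by have := per i; rewrite addnC.
rewrite /t addn4; have := @simple_flat R 5 w k.+4 isT sw.
by rewrite -/v !vS.
Qed.

(** At a flat vertex both edges have the same direction, so that a third point forms triangles of
    the same sign with them. *)
Let flat_sign k : t k = 0 ->
  sgo (t (k + 1)) = sgo (d (k + 2)) /\ sgo (t (k + 4)) = sgo (d (k + 3)).
Proof.
have vS i : v i.+4.+1 = v i by have := per i; rewrite addnC.
move=> /flat[c c0]; rewrite /t /d !(addn1, addn2, addn3, addn4) !vS => cE.
have scale (x : R[i]) : area (v k.+4) (v k) x = c * area (v k) (v k.+1) x.
  have -> : v k.+4 = v k - c%:C * (v k.+1 - v k) by rewrite -cE opprB addrC subrK.
  case: (v k) (v k.+1) (x) => [? ?] [? ?] [? ?].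
  by rewrite /area /cross /=; ring.
split; last by rewrite area_rot scale sgo_pos_scale// [in RHS]area_rot.
by rewrite [in RHS]area_rot scale sgo_pos_scale.
Qed.

Let signs k : simple_signs (sgo (t k)) (sgo (t (k + 1))) (sgo (t (k + 2)))
  (sgo (t (k + 4))) (sgo (d k)) (sgo (d (k + 2))) (sgo (d (k + 3))).
Proof.
have nonposE x y : (if sign_mul (sgo x) (sgo y) is Some true then false else true) = (x * y <= 0).
  rewrite -sgo_mul leNgt -sgo_true.
  by case: (sgo _) => [[]|].
apply/and3P; split.
- by rewrite -!sgo_mul plucker sgo_sum.
- rewrite !nonposE !sgo_None; case: ifP => // x0; case: ifP => // y0.
  by have [-> -> -> ->] := disjoint_sign x0 y0; rewrite !eqxx.
- case: (sgo (t k)) (sgo_None (t k)) => // /esym/eqP/flat_sign[-> ->].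
  by rewrite !eqxx.
Qed.

Lemma pentagon_some_fan :
  exists k, exists e, fan_sign e (sgo (t k)) (sgo (t (k + 1))) (sgo (t (k + 4)))
    (sgo (d k)) (sgo (d (k + 2))) (sgo (d (k + 3))).
Proof.
have S1 : simple_signs (sgo (t 1)) (sgo (t 2)) (sgo (t 3)) (sgo (t 0))
  (sgo (d 1)) (sgo (d 3)) (sgo (d 4)) by rewrite -(tper 0); exact: (signs 1).
have S2 : simple_signs (sgo (t 2)) (sgo (t 3)) (sgo (t 4)) (sgo (t 1))
  (sgo (d 2)) (sgo (d 4)) (sgo (d 0)).
  by rewrite -(tper 1) -(dper 0); exact: (signs 2).
have S3 : simple_signs (sgo (t 3)) (sgo (t 4)) (sgo (t 0)) (sgo (t 2))
  (sgo (d 3)) (sgo (d 0)) (sgo (d 1)).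
  by rewrite -(tper 0) -(tper 2) -(dper 0) -(dper 1); exact: (signs 3).
have S4 : simple_signs (sgo (t 4)) (sgo (t 0)) (sgo (t 1)) (sgo (t 3))
  (sgo (d 4)) (sgo (d 1)) (sgo (d 2)).
  by rewrite -(tper 0) -(tper 1) -(tper 3) -(dper 1) -(dper 2); exact: (signs 4).
have [k tk] := simple_not_flat (n := 5) isT sw.
have not0 : ~~ [&& sgo (t 0) == None, sgo (t 1) == None, sgo (t 2) == None,
                sgo (t 3) == None & sgo (t 4) == None].
  rewrite !sgo_None; apply/negP => /and5P[/eqP t0 /eqP t1 /eqP t2 /eqP t3 /eqP t4].
  have tmod i : t (i %% 5) = t i.
    by rewrite /t /v vertex_modD vertex_mod vertex_modS.
  have : t k.+1 = 0.
    rewrite -tmod; have : (k.+1 %% 5 < 5)%N by rewrite ltn_pmod.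
    by case: (k.+1 %% 5)%N => [|[|[|[|[|]]]]].
  have -> : t k.+1 = area (v k) (v k.+1) (v k.+2).
    by rewrite /t addSnnS per.
  by apply/eqP.
have := pentagon_signs (signs 0) S1 S2 S3 S4.
rewrite [(0 + 1)%N]/= [(0 + 2)%N]/= [(0 + 3)%N]/= [(0 + 4)%N]/=.
rewrite (negbTE not0) orFb => /orP[] /or4P[F|F|F|/orP[F|F]].
- by exists 0%N, true.
- by exists 1%N, true; rewrite -(tper 0) in F.
- by exists 2%N, true; rewrite -(tper 1) -(dper 0) in F.
- by exists 3%N, true; rewrite -(tper 2) -(dper 0) -(dper 1) in F.
- by exists 4%N, true; rewrite -(tper 0) -(tper 3) -(dper 1) -(dper 2) in F.
- by exists 0%N, false.
- by exists 1%N, false; rewrite -(tper 0) in F.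
- by exists 2%N, false; rewrite -(tper 1) -(dper 0) in F.
- by exists 3%N, false; rewrite -(tper 2) -(dper 0) -(dper 1) in F.
- by exists 4%N, false; rewrite -(tper 0) -(tper 3) -(dper 1) -(dper 2) in F.
Qed.

Lemma simple_pentagon_star : (exists p, star v 5 p) \/
  exists p, star (fun k => conjc (v k) : R[i]^o) 5 p.
Proof.
have vS i : v i.+4.+1 = v i by have := per i; rewrite addnC.
have [k [e]] := pentagon_some_fan.
have t1E : t (k + 1) = area (v k) (v k.+1) (v k.+2).
  by rewrite /t !(addn1, addn4) vS.
have t4E : t (k + 4) = area (v k) (v k.+3) (v k.+4).
  by rewrite /t !addn4 !vS -area_rot.
have d2E : d (k + 2) = area (v k) (v k.+2) (v k.+4).
  by rewrite /d !addn2 vS -area_rot.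
have d3E : d (k + 3) = area (v k) (v k.+1) (v k.+3).
  by rewrite /d !addn3 !vS area_rot.
rewrite t1E t4E d2E d3E => /and4P[].
have tE : t k = area (v k.+4) (v k) (v k.+1) by rewrite /t addn4.
case: e; rewrite /= ?sgo_true ?sgo_false => a3 a1 a2 or; [left|right].
  apply: (@pentagon_fan _ v k) => //.
  - rewrite -tE => t0; move: or; rewrite t0/= => /orP[d2|d3].
      by right.
    by left.
  - by rewrite -tE => /flat; rewrite addn4.
apply: (@pentagon_fan _ _ k); rewrite ?area_conj ?oppr_gt0 => //.
- by move=> j; rewrite per.
- rewrite -tE => t0; move: or; rewrite t0/= => /orP[d2|d3].
    by right.
  by left.
- move/eqP; rewrite oppr_eq0 -tE => /eqP/flat[c c0]; rewrite addn4 => cE.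
  exists c => //; rewrite -!rmorphB cE rmorphM/=; congr (_ * _).
  exact: conjc_real.
Qed.

End Pentagon.

(** The signs make the pentagon or its mirror image star-shaped, and [star_conj_not_ccw] excludes
    the latter. *)
Lemma LSP_pentagonP (w : 'rV[R[i]^o]_5) :
  LSP w <-> exists p, star (vertex w) 5 p.
Proof.
split=> [[sw ccw]|[p /star_LSP]]; last exact.
by case: (simple_pentagon_star sw) => // -[p /star_conj_not_ccw]; case.
Qed.

(** Seen from the midpoint of a diagonal, each edge spans half of one of the two triangles that the
    diagonal cuts off. *)
Lemma midpoint_star v : (forall k, v (k + 4)%N = v k) ->
  0 < area (v 0%N) (v 1%N) (v 2%N) -> 0 < area (v 2%N) (v 3%N) (v 0%N) ->
  exists p, star v 4 p.
Proof.
move=> per t1 t3; have v4 : v 4%N = v 0%N := per 0%N.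
exists ((1 / 2)%:C * (v 0%N + v 2%N)); apply: star_small => //.
case=> [|[|[|[|//]]]] _; move: t1 t3; rewrite ?v4 /area /cross;
  case: (v 0%N) (v 1%N) (v 2%N) (v 3%N) => [? ?] [? ?] [? ?] [? ?] /=; lra.
Qed.

(** Both sums are twice the signed area of the quadrilateral. If it is not 0, disjoint opposite
    edges force one diagonal to cut off two triangles of its sign; if it is 0, disjointness
    fails. *)
Lemma quadrilateral_signs (t0 t1 t2 t3 : R) : t0 + t2 = t1 + t3 ->
  (t1 * t0 <= 0 -> t3 * t2 <= 0 -> [/\ t1 = 0, t0 = 0, t3 = 0 & t2 = 0]) ->
  (t2 * t1 <= 0 -> t0 * t3 <= 0 -> [/\ t2 = 0, t1 = 0, t0 = 0 & t3 = 0]) ->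
  ~ [/\ t0 = 0, t1 = 0, t2 = 0 & t3 = 0] ->
  (0 < t1 /\ 0 < t3) \/ (0 < t0 /\ 0 < t2) \/
  (0 < - t1 /\ 0 < - t3) \/ (0 < - t0 /\ 0 < - t2).
Proof.
move=> E D1 D2 nz; rewrite !oppr_gt0.
have n1 : t1 * t0 <= 0 -> ~ (t3 * t2 <= 0).
  by move=> x0 y0; apply: nz; have [] := D1 x0 y0.
have n2 : t2 * t1 <= 0 -> ~ (t0 * t3 <= 0).
  by move=> x0 y0; apply: nz; have [] := D2 x0 y0.
have [S0|S0|S0] := ltgtP (t0 + t2) 0.
- have [p1|p1] := ltP t1 0; have [p3|p3] := ltP t3 0;
  have [p0|p0] := ltP t0 0; have [p2|p2] := ltP t2 0;
  first [by right; right; left|by right; right; right|lra|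
         exfalso; apply: n1; nra|exfalso; apply: n2; nra].
- have [p1|p1] := ltP 0 t1; have [p3|p3] := ltP 0 t3;
  have [p0|p0] := ltP 0 t0; have [p2|p2] := ltP 0 t2;
  first [by left|by right; left|lra|
         exfalso; apply: n1; nra|exfalso; apply: n2; nra].
- have [e2 e3] : t2 = - t0 /\ t3 = - t1 by split; lra.
  have [p|p] := leP (t1 * t0) 0.
    by exfalso; apply: (n1 p); rewrite e2 e3; nra.
  by exfalso; apply: n2; rewrite ?e2 ?e3; nra.
Qed.

Lemma simple_quadrilateral (w : 'rV[R[i]^o]_4) (v := vertex w)
  (t0 := area (v 3%N) (v 0%N) (v 1%N)) (t1 := area (v 0%N) (v 1%N) (v 2%N))
  (t2 := area (v 1%N) (v 2%N) (v 3%N)) (t3 := area (v 2%N) (v 3%N) (v 0%N)) :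
  simple_polygon w -> (0 < t1 /\ 0 < t3) \/ (0 < t0 /\ 0 < t2) \/
  (0 < - t1 /\ 0 < - t3) \/ (0 < - t0 /\ 0 < - t2).
Proof.
move=> sw; have v4 : v 4%N = v 0%N := vertex_period w.
apply: quadrilateral_signs.
- rewrite /t0 /t1 /t2 /t3 /area /cross.
  by case: (v 0%N) (v 1%N) (v 2%N) (v 3%N) => [? ?] [? ?] [? ?] [? ?] /=; ring.
- have -> : t0 = area (v 0%N) (v 1%N) (v 3%N) by rewrite /t0 area_rot.
  have -> : t2 = area (v 2%N) (v 3%N) (v 1%N) by rewrite /t2 area_rot.
  move=> x0 y0; have [] := disjoint_segments_area _ x0 y0; last by split.
  by move=> s s' s01 s'01; apply: (@simple_disjoint _ _ w 0 2 s s').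
- have -> : t1 = area (v 1%N) (v 2%N) (v 0%N) by rewrite /t1 area_rot.
  have -> : t3 = area (v 3%N) (v 0%N) (v 2%N) by rewrite /t3 area_rot.
  move=> x0 y0; have [] := disjoint_segments_area _ x0 y0; last by split.
  move=> s s' s01 s'01; rewrite -[v 0%N]v4.
  exact: (@simple_disjoint _ _ w 1 3 s s').
- move=> [z0 z1 z2 z3]; have [k] := simple_not_flat (n := 4) isT sw.
  rewrite -(vertex_mod w k) -[k.+2]addn2 -[k.+1]addn1 -!(vertex_modD w k).
  have : (k %% 4 < 4)%N by rewrite ltn_pmod.
  have v5 : v 5%N = v 1%N := vertex_add w 1.
  case: (k %% 4)%N => [|[|[|[|//]]]] _; rewrite !(add0n, add1n, add2n, add3n) ?v4 ?v5.
  + by rewrite -/t1 z1 eqxx.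
  + by rewrite -/t2 z2 eqxx.
  + by rewrite -/t3 z3 eqxx.
  + by rewrite -/t0 z0 eqxx.
Qed.

(** One of the diagonals runs inside; the second alternative is the first one after a shift of the
    labels. *)
Lemma LSP_quadrilateralP (w : 'rV[R[i]^o]_4) (v := vertex w) :
  LSP w <-> (0 < area (v 0%N) (v 1%N) (v 2%N) /\ 0 < area (v 2%N) (v 3%N) (v 0%N)) \/
            (0 < area (v 3%N) (v 0%N) (v 1%N) /\ 0 < area (v 1%N) (v 2%N) (v 3%N)).
Proof.
have per k : v (k + 4)%N = v k := vertex_add w k.
have star_shift u p : (forall k, u (k + 4)%N = u k) ->
    star (fun k => u k.+1) 4 p -> star u 4 p.
  move=> peru [A _]; apply: star_small => //; first exact: (peru 0%N).
  case=> [|k] kn; last by apply: A; exact: ltnW.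
  by have := A 3%N isT; rewrite (peru 0%N) (peru 1%N).
have odd u : (forall k, u (k + 4)%N = u k) ->
    0 < area (u 3%N) (u 0%N) (u 1%N) -> 0 < area (u 1%N) (u 2%N) (u 3%N) ->
    exists p, star u 4 p.
  move=> peru t0 t2; have [|||p sp] := @midpoint_star (fun k => u k.+1).
  - by move=> k; rewrite -addSn peru.
  - by [].
  - by rewrite (peru 0%N).
  - by exists p; apply: star_shift.
split=> [[sw ccw]|].
  have pc k : conjc (v (k + 4)%N) = conjc (v k) by rewrite per.
  have [|[|[[t1 t3]|[t0 t2]]]] := simple_quadrilateral sw; [by left|by right| |]; exfalso.
  - have [||p /star_conj_not_ccw] := @midpoint_star _ pc; rewrite ?area_conj//.
    exact.
  - have [||p /star_conj_not_ccw] := odd _ pc; rewrite ?area_conj//; exact.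
move=> [[t1 t3]|[t0 t2]].
  by have [p /star_LSP] := midpoint_star per t1 t3; exact.
by have [p /star_LSP] := odd _ per t0 t2; exact.
Qed.

Lemma centroid_star v : (forall k, v (k + 3)%N = v k) ->
  0 < area (v 0%N) (v 1%N) (v 2%N) -> exists p, star v 3 p.
Proof.
move=> per t1; have v3 : v 3%N = v 0%N := per 0%N.
exists ((1 / 3)%:C * (v 0%N + v 1%N + v 2%N)); apply: star_small => //.
case=> [|[|[|//]]] _; move: t1; rewrite ?v3 /area /cross;
  case: (v 0%N) (v 1%N) (v 2%N) => [? ?] [? ?] [? ?] /=; lra.
Qed.

Lemma LSP_triangleP (w : 'rV[R[i]^o]_3) (v := vertex w) :
  LSP w <-> 0 < area (v 0%N) (v 1%N) (v 2%N).
Proof.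
have per k : v (k + 3)%N = v k := vertex_add w k.
split=> [[sw ccw]|]; last first.
  by move=> /(centroid_star per)[p /star_LSP]; exact.
have [A|A|A] := ltgtP 0 (area (v 0%N) (v 1%N) (v 2%N)) => //; exfalso.
  have pc k : conjc (v (k + 3)%N) = conjc (v k) by rewrite per.
  have [|p /star_conj_not_ccw] := @centroid_star _ pc; last exact.
  by rewrite area_conj oppr_gt0.
have [k] := simple_not_flat (n := 3) isT sw.
rewrite -(vertex_mod w k) -[k.+2]addn2 -[k.+1]addn1 -!(vertex_modD w k).
have : (k %% 3 < 3)%N by rewrite ltn_pmod.
have v3 : v 3%N = v 0%N := per 0%N; have v4 : v 4%N = v 1%N := per 1%N.
case: (k %% 3)%N => [|[|[|//]]] _; rewrite !(add0n, add1n, add2n, add3n) ?v3 ?v4.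
- by rewrite -A eqxx.
- by rewrite -area_rot -A eqxx.
- by rewrite area_rot -A eqxx.
Qed.

End SimpleStar.

(** * Triangles and quadrilaterals *)

Section Coordinates.
Variable R : realType.

Lemma vertex_ord n (w : 'rV[R[i]^o]_n) (j : 'I_n) : vertex w j = w 0 j.
Proof.
rewrite /vertex modn_small//; case: insubP => [u _ uj|]; last by rewrite ltn_ord.
by congr (w 0 _); exact: val_inj.
Qed.

Lemma vertex_row n (f : nat -> R[i]^o) k : (k < n)%N ->
  vertex (\row_(j < n) f j : 'rV[R[i]^o]_n) k = f k.
Proof. by move=> kn; rewrite (vertex_ord _ (Ordinal kn)) mxE. Qed.

Lemma vertex_map n (w : 'rV[R[i]^o]_n) (h : R[i]^o -> R[i]^o) k : (0 < n)%N ->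
  vertex (map_mx h w) k = h (vertex w k).
Proof.
move=> n0; rewrite -vertex_mod -(vertex_mod w).
by rewrite !(vertex_ord _ (Ordinal (ltn_pmod k n0))) mxE.
Qed.

Lemma eq_vertex n (w u : 'rV[R[i]^o]_n) :
  (forall k, (k < n)%N -> vertex w k = vertex u k) -> w = u.
Proof. by move=> wu; apply/rowP => j; rewrite -!vertex_ord wu. Qed.

Lemma cvg_vertex n (w : 'rV[R[i]^o]_n) (F : set_system 'rV[R[i]^o]_n)
    {FF : Filter F} k : F --> w -> vertex M k @[M --> F] --> vertex w k.
Proof.
move=> Fw; rewrite /vertex; case: insubP => [j _ _|_]; first exact: cvg_coord.
exact: cvg_cst.
Qed.

Lemma cross_realC (a b : R[i]) (c : R) : cross (c%:C * a) b = c * cross a b.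
Proof. by rewrite /cross; case: a b => [? ?] [? ?] /=; ring. Qed.

Lemma cross_realCr (a b : R[i]) (c : R) : cross a (c%:C * b) = c * cross a b.
Proof. by rewrite /cross; case: a b => [? ?] [? ?] /=; ring. Qed.

Lemma cvg_cross (T : Type) (F : set_system T) {FF : Filter F}
    (f g : T -> R[i]^o) (a b : R[i]^o) :
  f x @[x --> F] --> a -> g x @[x --> F] --> b ->
  cross (f x) (g x) @[x --> F] --> cross a b.
Proof.
move=> fa gb; have [fR fI] := (cvg_Re_comp fa, cvg_Im_comp fa).
have [gR gI] := (cvg_Re_comp gb, cvg_Im_comp gb).
by rewrite /cross; apply: cvgB; apply: cvgM.
Qed.

Lemma cvg_row N (T : Type) (F : set_system T) {FF : Filter F}
    (f : T -> nat -> R) (a : nat -> R) :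
  (forall k, (k < N)%N -> f x k @[x --> F] --> a k) ->
  (\row_(j < N) f x j) @[x --> F] --> \row_(j < N) a j.
Proof.
move=> fa; apply: cvg_mx => i j; rewrite !mxE.
by under eq_fun do rewrite mxE; exact: fa.
Qed.

Lemma cvg_rowc N (T : Type) (F : set_system T) {FF : Filter F}
    (f : T -> nat -> R[i]^o) (a : nat -> R[i]^o) :
  (forall k, (k < N)%N -> f x k @[x --> F] --> a k) ->
  (\row_(j < N) f x j : 'rV[R[i]^o]_N) @[x --> F] -->
  (\row_(j < N) a j : 'rV[R[i]^o]_N).
Proof.
move=> fa; apply: cvg_mx => i j; rewrite !mxE.
by under eq_fun do rewrite mxE; exact: fa.
Qed.

Lemma cvg_ln (T : Type) (F : set_system T) {FF : Filter F} (f : T -> R) (a : R) :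
  0 < a -> f x @[x --> F] --> a -> ln (f x) @[x --> F] --> ln a.
Proof. by move=> a0 fa; apply: continuous_cvg fa; exact: continuous_ln. Qed.

Lemma cvg_expR (T : Type) (F : set_system T) {FF : Filter F} (f : T -> R) (a : R) :
  f x @[x --> F] --> a -> expR (f x) @[x --> F] --> expR a.
Proof. by move=> fa; apply: continuous_cvg fa; exact: continuous_expR. Qed.

End Coordinates.

Section Triangle.
Variable R : realType.

Definition triangle_shape (w : 'rV[R[i]^o]_3) : R[i] :=
  (vertex w 2 - vertex w 0) / (vertex w 1 - vertex w 0).

Definition triangle_coord (w : 'rV[R[i]^o]_3) : nat -> R :=
  nth 0 [:: Re (triangle_shape w); ln (Im (triangle_shape w))].

Definition triangle_vertex (x : 'rV[R]_2) : nat -> R[i]^o :=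
  nth 0 [:: 0; 1; x 0 0 +i* expR (x 0 1)].

Definition triangle_chart w : 'rV[R]_2 := \row_j triangle_coord w j.

Definition triangle_model x : 'rV[R[i]^o]_3 := \row_j triangle_vertex x j.

Lemma triangle_homeomorphic : homeomorphic (LSP_mod_Aff R 3) 'rV[R]_2.
Proof.
have shape_gt0 (w : 'rV[R[i]^o]_3) : LSP w ->
    vertex w 1 - vertex w 0 != 0 /\ 0 < Im (triangle_shape w).
  move=> /LSP_triangleP; rewrite /area => A.
  have n0 : vertex w 1 - vertex w 0 != 0.
    by apply: contraTneq A => ->; rewrite /cross/= !mul0r subrr ltxx.
  split=> //; rewrite /triangle_shape Im_divc divr_gt0// exprn_gt0//.
  by rewrite cmod_gt0.
have modelE x : (vertex (triangle_model x) 0 = 0) *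
    (vertex (triangle_model x) 1 = 1) *
    (vertex (triangle_model x) 2 = x 0 0 +i* expR (x 0 1)).
  by rewrite !vertex_row.
apply: (@LSP_quotient_homeomorphic R 3 2 triangle_chart triangle_model).
- move=> X w FX /shape_gt0[n0 im0] Xw.
  have cs : (triangle_shape M : R[i]^o) @[M --> X] --> (triangle_shape w : R[i]^o).
    apply: cvg_complexM; first by apply: cvgB; exact: cvg_vertex.
    by apply: cvg_complexV => //; apply: cvgB; exact: cvg_vertex.
  apply: (cvg_row (f := triangle_coord)) => -[|[|//]] _ /=.
    exact: cvg_Re_comp.
  by apply: cvg_ln => //; exact: cvg_Im_comp.
- move=> X x FX Xx.
  apply: (cvg_rowc (f := triangle_vertex)) => -[|[|[|//]]] _ /=; try exact: cvg_cst.
  apply: cvg_complex; first exact: cvg_coord.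
  by apply: cvg_expR; exact: cvg_coord.
- move=> w h Lw [a [b [a0 hE]]].
  suff E : triangle_shape (map_mx h w) = triangle_shape w by rewrite /triangle_chart /triangle_coord E.
  rewrite /triangle_shape !vertex_map// !hE.
  have dE x y : a * x + b - (a * y + b) = a * (x - y) by ring.
  by rewrite !dE -mulf_div divff// mul1r.
- move=> x; apply/LSP_triangleP; rewrite !modelE.
  by rewrite /area !subr0 /cross /= mul1r mul0r subr0 expR_gt0.
- move=> x; apply/rowP => j; rewrite mxE /triangle_coord /triangle_shape !modelE !subr0 divr1/=.
  by case: j => [[|[|//]]] ij /=; rewrite ?expRK; congr (x _ _); exact: val_inj.
- move=> w /[dup] Lw /shape_gt0[n0 im0].
  exists (fun z => (vertex w 1 - vertex w 0) * z + vertex w 0).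
    by exists (vertex w 1 - vertex w 0), (vertex w 0).
  apply: eq_vertex => k k3; rewrite vertex_map//.
  have xE : (triangle_chart w 0 0 = Re (triangle_shape w)) *
     (triangle_chart w 0 1 = ln (Im (triangle_shape w))) by rewrite !mxE.
  case: k k3 => [|[|[|//]]] _; rewrite modelE.
  + by rewrite mulr0 add0r.
  + by rewrite mulr1 subrK.
  + rewrite !xE lnK ?posrE// -[_ +i* _](_ : triangle_shape w = _); last first.
      by case: (triangle_shape w).
    by rewrite /triangle_shape mulrC divfK// subrK.
Qed.

End Triangle.

(** * Quadrilaterals through their diagonals *)

Section Quadrilateral.
Variable R : realType.
Implicit Types (y g : R).

(* v |-> v / (1 - g v) and v |-> v / (1 + g v) are mutually inverse whenever g *)
(* is positively homogeneous.                                                  *)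
Lemma gauge_out (x g : R) : g < 1 -> x / (1 - g) / (1 + g / (1 - g)) = x.
Proof.
move=> g1; have h : 1 - g != 0 by rewrite gt_eqF// subr_gt0.
have -> : 1 + g / (1 - g) = (1 - g)^-1 by field.
by rewrite invrK divfK.
Qed.

Lemma gauge_in (x g : R) : 0 <= g -> x / (1 + g) / (1 - g / (1 + g)) = x.
Proof.
move=> g0; have h : 1 + g != 0 by rewrite gt_eqF// ltr_pwDl.
have -> : 1 - g / (1 + g) = (1 + g)^-1 by field.
by rewrite invrK divfK.
Qed.

Lemma gauge_in_lt1 g : 0 <= g -> g / (1 + g) < 1.
Proof. by move=> g0; rewrite ltr_pdivrMr ?ltr_pwDl// mul1r ltrDr. Qed.

(** The domain of the pairs (x, y) is not convex; the radial rescaling rests on this gauge being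
    continuous, nonnegative and positively homogeneous. *)
Definition cross_gauge (x y : R) : R := Num.min `|x| `|y|.

Lemma cross_gauge_ge0 (x y : R) : 0 <= cross_gauge x y.
Proof. by rewrite le_min !normr_ge0. Qed.

Lemma cross_gaugeZ (c x y : R) : 0 <= c ->
  cross_gauge (x * c) (y * c) = cross_gauge x y * c.
Proof. by move=> c0; rewrite /cross_gauge !normrM (ger0_norm c0) minr_pMl. Qed.

Lemma cvg_min (T : Type) (F : set_system T) {FF : Filter F} (f h : T -> R) (x y : R) :
  f u @[u --> F] --> x -> h u @[u --> F] --> y ->
  Num.min (f u) (h u) @[u --> F] --> Num.min x y.
Proof.
move=> fx hy; have E (a b : R) : Num.min a b = (a + b - `|a - b|) / 2.
  by have [ab|ab] := leP a b; [rewrite ler0_norm ?subr_le0//|rewrite gtr0_norm ?subr_gt0//]; lra.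
under eq_fun do rewrite E; rewrite E.
apply: cvgM; last exact: cvg_cst.
by apply: cvgB; [exact: cvgD|apply: cvg_norm; exact: cvgB].
Qed.

Lemma cvg_max (T : Type) (F : set_system T) {FF : Filter F} (f h : T -> R) (x y : R) :
  f u @[u --> F] --> x -> h u @[u --> F] --> y ->
  Num.max (f u) (h u) @[u --> F] --> Num.max x y.
Proof.
move=> fx hy; have E (a b : R) : Num.max a b = a + b - Num.min a b.
  by rewrite -(addr_max_min a b) addrK.
under eq_fun do rewrite E; rewrite E.
by apply: cvgB; [exact: cvgD|exact: cvg_min].
Qed.

Lemma cvg_cross_gauge (T : Type) (F : set_system T) {FF : Filter F} (f h : T -> R) (x y : R) :
  f u @[u --> F] --> x -> h u @[u --> F] --> y ->
  cross_gauge (f u) (h u) @[u --> F] --> cross_gauge x y.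
Proof. by move=> fx hy; apply: cvg_min; exact: cvg_norm. Qed.

Implicit Types (w : 'rV[R[i]^o]_4) (x : 'rV[R]_4).

Definition diagonal02 w : R[i]^o := vertex w 2 - vertex w 0.
Definition diagonal13 w : R[i]^o := vertex w 3 - vertex w 1.
Definition diagonal_cross w : R := cross (diagonal02 w) (diagonal13 w).

(* The lines supporting the diagonals meet at                                  *)
(* v0 + a (v2 - v0) = v1 + b (v3 - v1) with a = (x + 1) / 2 and b = (y + 1) / 2. *)
Definition meet02 w : R :=
  2 * (cross (vertex w 1 - vertex w 0) (diagonal13 w) / diagonal_cross w) - 1.
Definition meet13 w : R :=
  2 * (cross (vertex w 1 - vertex w 0) (diagonal02 w) / diagonal_cross w) - 1.
Definition meet_gauge w : R := cross_gauge (meet02 w) (meet13 w).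
Definition diagonal_ratio w : R[i]^o := diagonal13 w / diagonal02 w.

Definition quadrilateral_coord w : nat -> R :=
  nth 0 [:: Re (diagonal_ratio w); ln (Im (diagonal_ratio w));
            meet02 w / (1 - meet_gauge w); meet13 w / (1 - meet_gauge w)].

Definition model_ratio (x : 'rV[R]_4) : R[i]^o := x 0 0 +i* expR (x 0 1).
Definition model_gauge (x : 'rV[R]_4) : R := cross_gauge (x 0 (inord 2)) (x 0 (inord 3)).
Definition model_meet (x : 'rV[R]_4) k : R :=
  (x 0 (inord k) / (1 + model_gauge x) + 1) / 2.

(** A normal form: the lines supporting the diagonals meet at 0, the diagonal from v0 to v2 is 1,
    and the other one is the ratio. *)
Definition quadrilateral_vertex (x : 'rV[R]_4) : nat -> R[i]^o :=
  nth 0 [:: (- model_meet x 2)%:C; (- model_meet x 3)%:C * model_ratio x;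
            (1 - model_meet x 2)%:C; (1 - model_meet x 3)%:C * model_ratio x].

Definition quadrilateral_chart w : 'rV[R]_4 := \row_j quadrilateral_coord w j.

Definition quadrilateral_model (x : 'rV[R]_4) : 'rV[R[i]^o]_4 := \row_j quadrilateral_vertex x j.

(** For positively crossing diagonals, the triangles on both sides of v1 v3 are positive exactly if
    the meeting point lies strictly inside v0 v2, that is |x| < 1; likewise for y. *)
Lemma LSP_diagonals w : LSP w <-> 0 < diagonal_cross w /\ meet_gauge w < 1.
Proof.
have h3 : area (vertex w 3) (vertex w 0) (vertex w 1) =
    cross (vertex w 1 - vertex w 0) (diagonal13 w).
  rewrite /area /cross /diagonal13; case: (vertex w 0) (vertex w 1) (vertex w 3) =>
    [? ?] [? ?] [? ?] /=; by ring.
have h1 : area (vertex w 0) (vertex w 1) (vertex w 2) =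
    cross (vertex w 1 - vertex w 0) (diagonal02 w) by [].
have h23 : area (vertex w 1) (vertex w 2) (vertex w 3) = diagonal_cross w -
    area (vertex w 3) (vertex w 0) (vertex w 1).
  rewrite /area /diagonal_cross /cross /diagonal13 /diagonal02.
  case: (vertex w 0) (vertex w 1) (vertex w 2) (vertex w 3) =>
    [? ?] [? ?] [? ?] [? ?] /=; by ring.
have h20 : area (vertex w 2) (vertex w 3) (vertex w 0) = diagonal_cross w -
    area (vertex w 0) (vertex w 1) (vertex w 2).
  rewrite /area /diagonal_cross /cross /diagonal13 /diagonal02.
  case: (vertex w 0) (vertex w 1) (vertex w 2) (vertex w 3) =>
    [? ?] [? ?] [? ?] [? ?] /=; by ring.
have D z : 0 < diagonal_cross w ->
    (`|2 * (z / diagonal_cross w) - 1| < 1) = (0 < z) && (z < diagonal_cross w).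
  move=> D0; set q := z / _.
  have -> : (0 < z) = (0 < q) by rewrite pmulr_lgt0 ?invr_gt0.
  have -> : (z < diagonal_cross w) = (q < 1) by rewrite ltr_pdivrMr// mul1r.
  by rewrite ltr_norml; apply/andP/andP => -[? ?]; split; lra.
split.
  move=> /LSP_quadrilateralP; rewrite h20 h23 h3 h1 => H.
  have D0 : 0 < diagonal_cross w by case: H => -[]; lra.
  split=> //; rewrite /meet_gauge /cross_gauge gt_min !D//.
  by apply/orP; case: H => -[H1 H2]; [right|left]; apply/andP; split; lra.
move=> [D0]; rewrite /meet_gauge /cross_gauge gt_min !D// => H.
apply/LSP_quadrilateralP; rewrite h20 h23 h3 h1.
by case/orP: H => /andP[? ?]; [right|left]; split; lra.
Qed.

Lemma cramer (u d1 d2 : R[i]) : cross d1 d2 != 0 ->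
  u = (cross u d2 / cross d1 d2)%:C * d1 - (cross u d1 / cross d1 d2)%:C * d2.
Proof.
move=> D0; have E : (cross d1 d2)%:C * u = (cross u d2)%:C * d1 - (cross u d1)%:C * d2.
  rewrite /cross; case: u d1 d2 {D0} => [? ?] [? ?] [? ?]; apply/eqP.
  by rewrite eq_complex/=; apply/andP; split; apply/eqP; ring.
have D0C : (cross d1 d2)%:C != 0 by apply/eqP => -[/eqP]; rewrite (negbTE D0).
apply: (mulfI D0C); rewrite E mulrBr !mulrA -!rmorphM/=.
by rewrite ![_ * (_ / _)]mulrC !divfK.
Qed.

Lemma nat4_ind (P : nat -> Prop) : P 0%N -> P 1%N -> P 2%N -> P 3%N ->
  forall k, (k < 4)%N -> P k.
Proof. by move=> P0 P1 P2 P3 [|[|[|[|]]]]. Qed.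

Lemma quadrilateral_homeomorphic : homeomorphic (LSP_mod_Aff R 4) 'rV[R]_4.
Proof.
have gm0 x : 0 <= model_gauge x by exact: cross_gauge_ge0.
have ratio_gt0 w : LSP w -> diagonal02 w != 0 /\ 0 < Im (diagonal_ratio w).
  move=> /LSP_diagonals[D0 _].
  have d0 : diagonal02 w != 0.
    by apply: contraTneq D0; rewrite /diagonal_cross => ->; rewrite /cross/= !mul0r subrr ltxx.
  split=> //; rewrite /diagonal_ratio Im_divc divr_gt0// exprn_gt0//.
  by rewrite cmod_gt0.
have modelE x : (vertex (quadrilateral_model x) 0 = (- model_meet x 2)%:C) *
    (vertex (quadrilateral_model x) 1 = (- model_meet x 3)%:C * model_ratio x) *
    (vertex (quadrilateral_model x) 2 = (1 - model_meet x 2)%:C) *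
    (vertex (quadrilateral_model x) 3 = (1 - model_meet x 3)%:C * model_ratio x).
  by rewrite !vertex_row.
have model02 x : diagonal02 (quadrilateral_model x) = 1.
  by rewrite /diagonal02 !modelE -rmorphB/= opprK subrK.
have model13 x : diagonal13 (quadrilateral_model x) = model_ratio x.
  by rewrite /diagonal13 !modelE -mulrBl -rmorphB/= opprK subrK mul1r.
have modelD x : diagonal_cross (quadrilateral_model x) = expR (x 0 1).
  by rewrite /diagonal_cross model02 model13 /cross/= mul1r mul0r subr0.
have meetE x : (meet02 (quadrilateral_model x) = x 0 (inord 2) / (1 + model_gauge x)) *
    (meet13 (quadrilateral_model x) = x 0 (inord 3) / (1 + model_gauge x)).
  have e0 : expR (x 0 1) != 0 by rewrite gt_eqF// expR_gt0.
  rewrite /meet02 /meet13 model02 model13 modelD !modelE /model_ratio /cross/=.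
  have g1 : 1 + model_gauge x != 0 by rewrite gt_eqF// ltr_pwDl.
  by rewrite /model_meet; split; field; rewrite e0 g1.
have gaugeE x : meet_gauge (quadrilateral_model x) = model_gauge x / (1 + model_gauge x).
  by rewrite /meet_gauge !meetE cross_gaugeZ// invr_ge0 addr_ge0.
apply: (@LSP_quotient_homeomorphic R 4 4 quadrilateral_chart quadrilateral_model).
- move=> X w FX /[dup] /ratio_gt0[d0 im0] /LSP_diagonals[D0 g1] Xw.
  have cv k : vertex M k @[M --> X] --> vertex w k by exact: cvg_vertex.
  have c02 : diagonal02 M @[M --> X] --> diagonal02 w by apply: cvgB; exact: cv.
  have c13 : diagonal13 M @[M --> X] --> diagonal13 w by apply: cvgB; exact: cv.
  have c01 : (vertex M 1 - vertex M 0) @[M --> X] --> vertex w 1 - vertex w 0.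
    by apply: cvgB; exact: cv.
  have cD : diagonal_cross M @[M --> X] --> diagonal_cross w by exact: cvg_cross c02 c13.
  have cDV : ((diagonal_cross M)^-1 : R) @[M --> X] --> (diagonal_cross w)^-1.
    by apply: cvgV; [rewrite gt_eqF|exact: cD].
  have cr : diagonal_ratio M @[M --> X] --> diagonal_ratio w.
    by apply: cvg_complexM; [exact: c13|exact: cvg_complexV c02].
  have cm (f g : 'rV[R[i]^o]_4 -> R[i]^o) (a b : R[i]^o) :
      f M @[M --> X] --> a -> g M @[M --> X] --> b ->
      (2 * (cross (f M) (g M) / diagonal_cross M) - 1) @[M --> X] -->
      2 * (cross a b / diagonal_cross w) - 1.
    move=> fa gb; apply: cvgB; last exact: cvg_cst.
    apply: cvgM; first exact: cvg_cst.
    by apply: cvgM; [exact: cvg_cross fa gb|exact: cDV].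
  have cm02 : meet02 M @[M --> X] --> meet02 w by exact: cm c01 c13.
  have cm13 : meet13 M @[M --> X] --> meet13 w by exact: cm c01 c02.
  have cg : ((1 - meet_gauge M)^-1 : R) @[M --> X] --> (1 - meet_gauge w)^-1.
    apply: cvgV; first by rewrite gt_eqF// subr_gt0.
    by apply: cvgB; [exact: cvg_cst|exact: cvg_cross_gauge cm02 cm13].
  apply: (cvg_row (f := quadrilateral_coord)); apply: nat4_ind => /=.
  + exact: cvg_Re_comp.
  + by apply: cvg_ln; [exact: im0|exact: cvg_Im_comp].
  + by apply: cvgM; [exact: cm02|exact: cg].
  + by apply: cvgM; [exact: cm13|exact: cg].
- move=> X x FX Xx.
  have cx k : M 0 k @[M --> X] --> x 0 k by exact: cvg_coord.
  have cr : model_ratio M @[M --> X] --> model_ratio x.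
    apply: cvg_complex; first exact: cx.
    by apply: cvg_expR; exact: cx.
  have cm k : model_meet M k @[M --> X] --> model_meet x k.
    apply: cvgM; last exact: cvg_cst.
    apply: cvgD; last exact: cvg_cst.
    apply: cvgM; first exact: cx.
    apply: cvgV; first by rewrite gt_eqF// ltr_pwDl.
    by apply: cvgD; [exact: cvg_cst|apply: cvg_cross_gauge; exact: cx].
  have cC (f : 'rV[R]_4 -> R) : f M @[M --> X] --> f x ->
      (f M)%:C @[M --> X] --> ((f x)%:C : R[i]^o).
    by move=> fx; apply: cvg_complex; [exact: fx|exact: cvg_cst].
  apply: (@cvg_rowc R 4 _ X FX quadrilateral_vertex (quadrilateral_vertex x)).
  apply: nat4_ind; rewrite /quadrilateral_vertex /=.
  + by apply: (cC (fun M => - model_meet M 2)); apply: cvgN; exact: cm.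
  + apply: cvg_complexM; last exact: cr.
    by apply: (cC (fun M => - model_meet M 3)); apply: cvgN; exact: cm.
  + apply: (cC (fun M => 1 - model_meet M 2)).
    by apply: cvgB; [exact: cvg_cst|exact: cm].
  + apply: cvg_complexM; last exact: cr.
    apply: (cC (fun M => 1 - model_meet M 3)).
    by apply: cvgB; [exact: cvg_cst|exact: cm].
- move=> w h Lw [a [b [a0 hE]]].
  have dE z z' : h z - h z' = a * (z - z') by rewrite !hE; ring.
  have a2 : cmod a ^+ 2 != 0 by rewrite expf_neq0// gt_eqF// cmod_gt0.
  have crossE z z' : cross (a * z) (a * z') = cmod a ^+ 2 * cross z z'.
    rewrite sqr_cmod /cross; case: (a) z z' => [? ?] [? ?] [? ?] /=; ring.
  have E02 : diagonal02 (map_mx h w) = a * diagonal02 w.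
    by rewrite /diagonal02 !vertex_map// dE.
  have E13 : diagonal13 (map_mx h w) = a * diagonal13 w.
    by rewrite /diagonal13 !vertex_map// dE.
  have ED : diagonal_cross (map_mx h w) = cmod a ^+ 2 * diagonal_cross w.
    by rewrite /diagonal_cross E02 E13 crossE.
  have Er : diagonal_ratio (map_mx h w) = diagonal_ratio w.
    by rewrite /diagonal_ratio E02 E13 -mulf_div divff// mul1r.
  have Em02 : meet02 (map_mx h w) = meet02 w.
    by rewrite /meet02 ED E13 !vertex_map// dE crossE -mulf_div divff// mul1r.
  have Em13 : meet13 (map_mx h w) = meet13 w.
    by rewrite /meet13 ED E02 !vertex_map// dE crossE -mulf_div divff// mul1r.
  by rewrite /quadrilateral_chart /quadrilateral_coord /meet_gauge Er Em02 Em13.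
- move=> x; apply/LSP_diagonals; rewrite modelD expR_gt0 gaugeE; split=> //.
  exact: gauge_in_lt1.
- move=> x; have H : forall k, (k < 4)%N ->
      quadrilateral_coord (quadrilateral_model x) k = x 0 (inord k).
    rewrite /quadrilateral_coord gaugeE !meetE /diagonal_ratio model02 model13.
    rewrite divr1 !gauge_in//; apply: nat4_ind => /=; rewrite ?expRK//.
      by congr (x _ _); apply: val_inj; rewrite /= inordK.
    by congr (x _ _); apply: val_inj; rewrite /= inordK.
  by apply/rowP => j; rewrite mxE H// inord_val.
- move=> w /[dup] /[dup] Lw /ratio_gt0[d0 im0] /LSP_diagonals[D0 g1].
  set x := quadrilateral_chart w.
  have xE k : (k < 4)%N -> x 0 (inord k) = quadrilateral_coord w k.
    by move=> k4; rewrite /x mxE inordK.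
  have mg : model_gauge x = meet_gauge w / (1 - meet_gauge w).
    rewrite /model_gauge !xE//= cross_gaugeZ// invr_ge0 subr_ge0.
    exact: ltW.
  have m2 : model_meet x 2 = (meet02 w + 1) / 2.
    by rewrite /model_meet mg xE//= gauge_out.
  have m3 : model_meet x 3 = (meet13 w + 1) / 2.
    by rewrite /model_meet mg xE//= gauge_out.
  have ratioE : model_ratio x = diagonal_ratio w.
    rewrite /model_ratio /x !mxE/= lnK ?posrE//.
    by rewrite /quadrilateral_coord/=; case: (diagonal_ratio w).
  have := cramer (vertex w 1 - vertex w 0) (lt0r_neq0 D0).
  set a := _ / _; set b := _ / _ => ab.
  have m2E : model_meet x 2 = a by rewrite m2 /meet02 subrK mulrC mulKf.
  have m3E : model_meet x 3 = b by rewrite m3 /meet13 subrK mulrC mulKf.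
  (* The linear part is the diagonal from v0 to v2, and 0 goes to the meeting point of the
     diagonals. *)
  exists (fun z => diagonal02 w * z + (vertex w 0 + a%:C * diagonal02 w)).
    by exists (diagonal02 w), (vertex w 0 + a%:C * diagonal02 w).
  have rE : diagonal02 w * diagonal_ratio w = diagonal13 w.
    by rewrite /diagonal_ratio mulrC divfK.
  apply: eq_vertex => k k4; rewrite vertex_map//.
  move: k k4; apply: nat4_ind; rewrite modelE ?m2E ?m3E ?ratioE.
  + by rewrite rmorphN; ring.
  + rewrite mulrCA rE rmorphN; apply/eqP; rewrite -subr_eq0; apply/eqP.
    by move/eqP: ab; rewrite -subr_eq0 => /eqP <-; ring.
  + by rewrite rmorphB/= /diagonal02; ring.
  + rewrite mulrCA rE rmorphB/=; apply/eqP; rewrite -subr_eq0; apply/eqP.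
    by move/eqP: ab; rewrite -subr_eq0 => /eqP <-; rewrite /diagonal13; ring.
Qed.

End Quadrilateral.

(** * The analytic center of the kernel *)

Section AnalyticCenter.
Variable R : realType.
Implicit Types (v : nat -> R[i]^o) (p q h : R[i]^o) (n k : nat).

Definition side v k : R[i] := v k.+1 - v k.

Definition wing v k p : R := cross (v k - p) (v k.+1 - p).

Definition barrier_gradient v n p : R[i] :=
  \sum_(k < n) ((wing v k p)^-1)%:C * side v k.

(* For [wing v k p > 0] this is the vanishing at [p] of the gradient of the     *)
(* logarithmic barrier [- \sum_k ln (wing v k)], rotated by a quarter turn.     *)
Definition is_center v n p : Prop :=
  (forall k, (k < n)%N -> 0 < wing v k p) /\ barrier_gradient v n p = 0.

Lemma wingD v k p h : wing v k (p + h) = wing v k p + cross (side v k) h.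
Proof.
rewrite /wing /side /cross; case: (v k) (v k.+1) p h => [? ?] [? ?] [? ?] [? ?] /=.
by ring.
Qed.

Lemma cross_suml n (F : 'I_n -> R[i]) (h : R[i]) :
  cross (\sum_k F k) h = \sum_k cross (F k) h.
Proof.
apply: (big_morph (fun z => cross z h)); last by rewrite /cross/= !mul0r subrr.
by move=> [a b] [c d]; rewrite /cross/=; ring.
Qed.

Lemma cross_barrier v n p h :
  cross (barrier_gradient v n p) h = \sum_(k < n) cross (side v k) h / wing v k p.
Proof.
rewrite cross_suml; apply: eq_bigr => k _.
by rewrite cross_realC mulrC.
Qed.

(** The total area does not depend on the point, as the sides sum up to 0. *)
Lemma sum_wing v n p q : v n = v 0%N ->
  \sum_(k < n) wing v k q = \sum_(k < n) wing v k p.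
Proof.
move=> vn; have -> : q = p + (q - p) by rewrite addrC subrK.
under eq_bigr do rewrite wingD; rewrite big_split/= -cross_suml.
rewrite -(big_mkord xpredT (side v)) telescope_sumr// vn subrr.
by rewrite /cross/= !mul0r subrr addr0.
Qed.

Lemma sum_wing_ratio v n p q : (forall k, (k < n)%N -> 0 < wing v k p) ->
  \sum_(k < n) wing v k q / wing v k p =
  n%:R + cross (barrier_gradient v n p) (q - p).
Proof.
move=> A; rewrite cross_barrier -[n in n%:R]card_ord -sumr_const -big_split/=.
apply: eq_bigr => k _; have -> : q = p + (q - p) by rewrite addrC subrK.
by rewrite wingD mulrDl divff ?gt_eqF ?A// addrAC subrr add0r.
Qed.

(** Induction on the number of factors gives the linear term and a quadratic remainder with one
    constant for all |e| <= 1. *)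
Lemma prod_first_order (c : nat -> R) n : exists M, forall e, `|e| <= 1 ->
  `|\prod_(k < n) (1 + e * c k) - 1 - e * \sum_(k < n) c k| <= M * e ^+ 2.
Proof.
elim: n => [|n [M IH]].
  by exists 0 => e _; rewrite !big_ord0 subrr mulr0 subrr normr0 mul0r.
set s := \sum_(k < n) c k in IH.
exists (M + `|s * c n| + `|c n| * M) => e e1; have := IH e e1.
rewrite !big_ord_recr/= -/s; set Q := \prod_(k < n) _ => IHe.
have -> : Q * (1 + e * c n) - 1 - e * (s + c n) =
    (Q - 1 - e * s) + e ^+ 2 * (s * c n) + e * c n * (Q - 1 - e * s) by ring.
rewrite (le_trans (ler_normD _ _))// mulrDl lerD//.
  rewrite (le_trans (ler_normD _ _))// mulrDl lerD// normrM [leRHS]mulrC.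
  by rewrite ler_wpM2r// ger0_norm// sqr_ge0.
rewrite !normrM -[leLHS]mulrA -[leRHS]mulrA -[leRHS]mul1r.
by rewrite ler_pM// ?mulr_ge0// ler_wpM2l.
Qed.

Lemma prod_local_max (c : nat -> R) n d : 0 < d ->
  (forall e, `|e| < d -> \prod_(k < n) (1 + e * c k) <= 1) ->
  \sum_(k < n) c k = 0.
Proof.
move=> d0 H; have [M HM] := prod_first_order c n.
set s := \sum_(k < n) c k in HM *.
have M0 : 0 <= M by have := HM 1; rewrite normr1 lexx expr1n mulr1 => /(_ isT); apply: le_trans.
apply: contrapT => /eqP s0.
(* For e of size m and with the sign of s, the linear gain m |s| exceeds the remainder M m^2. *)
pose m := Num.min (d / 2) (Num.min 1 (`|s| / (2 * (M + 1)))).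
have m0 : 0 < m.
  rewrite !lt_min ltr01 !divr_gt0 ?normr_gt0// mulr_gt0// ltr_wpDl//.
have [md [m1 ms]] : m < d /\ (m <= 1 /\ m <= `|s| / (2 * (M + 1))).
  split; last by rewrite /m !ge_min !lexx ?orbT.
  by rewrite /m gt_min ltr_pdivrMr// ltr_pMr// ltr1n.
have M1 : 0 < 2 * (M + 1) by rewrite mulr_gt0// ltr_wpDl.
move: ms; rewrite ler_pdivlMr// => ms.
pose e := m * Num.sg s.
have em : `|e| = m.
  by rewrite normrM gtr0_norm// normr_sg s0 mulr1.
have es : e * s = m * `|s| by rewrite /e -mulrA -normrEsg.
have := H e; rewrite em md => /(_ isT) Pe.
have := HM e; rewrite em m1 => /(_ isT); rewrite ler_norml => /andP[+ _].
have -> : e ^+ 2 = m ^+ 2 by rewrite -em real_normK ?num_real.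
rewrite es; have := normr_gt0 s; rewrite s0.
by nra.
Qed.

(** On the kernel each wing is at most their constant sum; two sides of independent directions then
    bound both coordinates. *)
Lemma kernel_bounded v n p i j : v n = v 0%N -> (i < n)%N -> (j < n)%N ->
  cross (side v i) (side v j) != 0 -> (forall k, (k < n)%N -> 0 < wing v k p) ->
  exists M : R, forall q, (forall k, (k < n)%N -> 0 < wing v k q) ->
    `|Re q| <= M /\ `|Im q| <= M.
Proof.
move=> vn i_n j_n ij Ap; pose S := \sum_(k < n) wing v k p.
have W q k : (forall k, (k < n)%N -> 0 < wing v k q) -> (k < n)%N -> wing v k q <= S.
  move=> Aq kn; rewrite /S -(sum_wing p q vn) (bigD1 (Ordinal kn))//= lerDl.
  by apply: sumr_ge0 => l _; exact/ltW/Aq.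
have C q k : (forall k, (k < n)%N -> 0 < wing v k q) -> (k < n)%N ->
    `|cross (side v k) (q - p)| <= S.
  move=> Aq kn; have qE : q = p + (q - p) by rewrite addrC subrK.
  have := W q k Aq kn; have := Aq _ kn; rewrite {1 2}qE wingD ler_norml.
  have := W p k Ap kn; have := Ap _ kn => ? ? ? ?.
  by apply/andP; split; lra.
set D := cross _ _ in ij.
pose a := side v i; pose b := side v j.
exists (`|Re p| + `|Im p| + S / `|D| * (cmod a + cmod b)) => q Aq.
have S0 : 0 <= S by rewrite (le_trans (normr_ge0 _) (C q i Aq i_n)).
have := cramer (q - p) ij; rewrite -/D -/a -/b; set x := _ / D; set y := _ / D => E.
have xS : `|x| <= S / `|D|.
  rewrite /x normrM normfV ler_wpM2r ?invr_ge0//.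
  have -> : cross (q - p) b = - cross b (q - p) by rewrite /cross; ring.
  by rewrite normrN; exact: C.
have yS : `|y| <= S / `|D|.
  rewrite /y normrM normfV ler_wpM2r ?invr_ge0//.
  have -> : cross (q - p) a = - cross a (q - p) by rewrite /cross; ring.
  by rewrite normrN; exact: C.
clearbody x y.
have [qR qI] : Re q = Re p + (x * Re a - y * Re b) /\ Im q = Im p + (x * Im a - y * Im b).
  have -> : q = p + (q - p) by rewrite addrC subrK.
  rewrite E; case: (p) (a) (b) => [? ?] [? ?] [? ?] /=.
  by split; ring.
have B (r u z : R) : `|u| <= cmod a -> `|z| <= cmod b ->
    `|r + (x * u - y * z)| <= `|r| + S / `|D| * (cmod a + cmod b).
  move=> ua zb; rewrite (le_trans (ler_normD _ _))// lerD2l.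
  rewrite (le_trans (ler_normB _ _))// mulrDr !normrM.
  by apply: lerD; apply: ler_pM.
have pR := normr_ge0 (Re p); have pI := normr_ge0 (Im p).
rewrite qR qI; split.
  rewrite (le_trans (B _ _ _ (ler_Re_sqrt _) (ler_Re_sqrt _)))// lerD2r.
  by rewrite lerDl.
rewrite (le_trans (B _ _ _ (ler_Im_sqrt _) (ler_Im_sqrt _)))// lerD2r.
by rewrite lerDr.
Qed.

Lemma cvg_prod n (T : Type) (F : set_system T) {FF : Filter F}
    (f : 'I_n -> T -> R) (a : 'I_n -> R) :
  (forall k : 'I_n, f k x @[x --> F] --> a k) ->
  (\prod_k f k x) @[x --> F] --> \prod_k a k.
Proof.
move=> fa; have cm : continuous (fun x : R * R => x.1 * x.2) by exact: mul_continuous.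
by apply: (cvg_big cm) => k _; exact: fa.
Qed.

(** The product of the wings is maximised over a square containing the kernel. Negative wings are
    replaced by 0, so that a maximum, being positive, lies in the kernel; moving from it by e h
    multiplies the wings by factors 1 + e c_k, and [prod_local_max] applies. *)
Lemma center_exists v n p i j : v n = v 0%N -> (i < n)%N -> (j < n)%N ->
  cross (side v i) (side v j) != 0 -> (forall k, (k < n)%N -> 0 < wing v k p) ->
  exists q, is_center v n q.
Proof.
move=> vn i_n j_n ij Ap; have [M HM] := kernel_bounded vn i_n j_n ij Ap.
pose pt (x : 'rV[R]_2) : R[i]^o := x 0 0 +i* x 0 1.
pose P (x : 'rV[R]_2) : R := \prod_(k < n) Num.max 0 (wing v k (pt x)).
pose K := [set x : 'rV[R]_2 | forall k : 'I_2, `[- M, M]%classic (x ord0 k)].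
have cK : compact K.
  exact: (@rV_compact R 2 (fun=> `[- M, M]%classic)
    (fun=> @segment_compact R (- M) M)).
pose row q : 'rV[R]_2 := \row_(k < 2) (if k == 0 then Re q else Im q).
have rowK q : pt (row q) = q by rewrite /pt /row !mxE/=; case: q.
have rowE q : (forall k, (k < n)%N -> 0 < wing v k q) -> K (row q).
  move=> /HM[qR qI] k; rewrite /= in_itv/= -ler_norml mxE.
  by case: ifP.
have cP : {within K, continuous P}.
  apply: continuous_subspaceT => x.
  apply: (@cvg_prod n _ (nbhs x) (nbhs_filter x)
    (fun (k : 'I_n) x => Num.max 0 (wing v k (pt x)))) => k.
  have cpt (X : set_system 'rV[R]_2) : Filter X -> X --> x -> pt y @[y --> X] --> pt x.
    by move=> FX Xx; apply: cvg_complex; exact: cvg_coord.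
  have cw (X : set_system 'rV[R]_2) : Filter X -> X --> x ->
      Num.max 0 (wing v k (pt y)) @[y --> X] --> Num.max 0 (wing v k (pt x)).
    move=> FX Xx; apply: cvg_max; first exact: cvg_cst.
    by apply: cvg_cross; (apply: cvgB; [exact: cvg_cst|exact: cpt]).
  exact: (cw (nbhs x) (nbhs_filter x) (fun _ => id)).
have [x /set_mem Kx maxx] := compact_EVT_max (ex_intro _ _ (rowE _ Ap)) cK cP.
have Pp : 0 < P (row p).
  by apply: prodr_gt0 => k _; rewrite rowK lt_max Ap ?orbT.
have Px : 0 < P x by rewrite (lt_le_trans Pp)// maxx// inE; exact: rowE.
pose q := pt x.
have Aq k : (k < n)%N -> 0 < wing v k q.
  move=> kn; move: Px; rewrite /P (bigD1 (Ordinal kn))//=.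
  have [//|w0] := ltP 0 (wing v k q).
  by rewrite mul0r ltxx.
have PE y : (forall k, (k < n)%N -> 0 < wing v k y) -> P (row y) = \prod_(k < n) wing v k y.
  by move=> Ay; apply: eq_bigr => k _; rewrite rowK max_r// ltW// Ay.
have PxE : P x = \prod_(k < n) wing v k q.
  by apply: eq_bigr => k _; rewrite -/q max_r// ltW// Aq.
exists q; split=> // .
have crit h : cross (barrier_gradient v n q) h = 0.
  rewrite cross_barrier; pose c k := cross (side v k) h / wing v k q.
  have [d d0 Hd] : exists2 d, 0 < d & forall e, `|e| < d ->
      forall k, (k < n)%N -> 0 < 1 + e * c k.
    elim: (n) => [|l [d d0 Hd]]; first by exists 1.
    have cl : 0 < 1 + `|c l| by rewrite ltr_pwDl.
    exists (Num.min d (1 + `|c l|)^-1); first by rewrite lt_min d0 invr_gt0.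
    move=> e; rewrite lt_min => /andP[ed ec] k.
    rewrite ltnS leq_eqVlt => /predU1P[->|kl]; last exact: Hd.
    move: ec; rewrite -[_^-1]mul1r ltr_pdivlMr// => ec.
    have : `|e * c l| < 1.
      by rewrite normrM (le_lt_trans _ ec)// mulrDr mulr1 lerDr.
    by rewrite ltr_norml => /andP[? _]; lra.
  apply: (@prod_local_max c n d d0) => e ed.
  have wE k : (k < n)%N -> wing v k (q + e%:C * h) = wing v k q * (1 + e * c k).
    move=> kn; rewrite wingD mulrDr mulr1; congr (_ + _); rewrite /c.
    rewrite [RHS]mulrCA [X in _ = _ * X]mulrC divfK ?gt_eqF ?Aq//.
    exact: cross_realCr.
  have Ae k : (k < n)%N -> 0 < wing v k (q + e%:C * h).
    by move=> kn; rewrite wE// mulr_gt0 ?Aq ?Hd.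
  have := maxx (row (q + e%:C * h)); rewrite inE => /(_ (rowE _ Ae)).
  rewrite PE// PxE; under eq_bigr => k _ do rewrite wE//.
  rewrite big_split/= -{2}[\prod_(k < n) wing v k q]mulr1 ler_pM2l//.
  by apply: prodr_gt0 => k _; exact: Aq.
(* The gradient is paired with its own quarter turn, which gives its squared modulus. *)
have := crit (- Im (barrier_gradient v n q) +i* Re (barrier_gradient v n q)).
rewrite {1}/cross/=; case: (barrier_gradient v n q) => a b /= ab.
have : a ^+ 2 + b ^+ 2 = 0 by rewrite -ab; ring.
move/eqP; rewrite paddr_eq0 ?sqr_ge0// !sqrf_eq0 => /andP[/eqP -> /eqP ->].
by [].
Qed.

End AnalyticCenter.

(** * Uniqueness and continuity of the analytic center *)

Section CenterContinuity.
Variable R : realType.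
Implicit Types (v : nat -> R[i]^o) (p q h : R[i]^o) (n k i j : nat).

Lemma cross_le_cmod (a b : R[i]) : `|cross a b| <= cmod a * cmod b.
Proof.
have h : Im (conjc a * b) = cross a b.
  by rewrite /cross; case: a b => [? ?] [? ?] /=; ring.
have -> : cmod a * cmod b = cmod (conjc a * b).
  by rewrite cmodM; congr (_ * _); case: a {h} => ? ?; rewrite /cmod/= sqrrN.
by rewrite -h; exact: ler_Im_sqrt.
Qed.

Lemma ler_cmodB (a b : R[i]) : cmod (a - b) <= cmod a + cmod b.
Proof. by rewrite -lecR rmorphD/= -!normcE' ler_normB. Qed.

(** For a ratio r, (r - 1)^2 / r = r + 1 / r - 2; the sum of the 1 / r is n because the gradient
    vanishes at [q]. *)
Lemma center_ratio v n p q : (forall k, (k < n)%N -> 0 < wing v k p) ->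
  is_center v n q ->
  \sum_(k < n) (wing v k q / wing v k p - 1) ^+ 2 / (wing v k q / wing v k p) =
  cross (barrier_gradient v n p) (q - p).
Proof.
move=> Ap [Aq gq].
have -> : \sum_(k < n) (wing v k q / wing v k p - 1) ^+ 2 / (wing v k q / wing v k p) =
    \sum_(k < n) wing v k q / wing v k p + \sum_(k < n) wing v k p / wing v k q -
    \sum_(k < n) 2.
  rewrite -big_split -sumrB/=; apply: eq_bigr => k _.
  by field; rewrite !gt_eqF ?Ap ?Aq.
rewrite !sum_wing_ratio// gq sumr_const card_ord /cross/=.
by rewrite -[2 *+ n]mulr_natr; ring.
Qed.

(** With G = 0 this gives uniqueness, with G tending to 0 continuity. [center_ratio] bounds the
    relative change of each wing by s, [cramer] turns this into H <= m s for the distance H, and X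
    <= G H closes the estimate. *)
Lemma center_dist v n p q i j
  (m := (cmod (side v i) * wing v j p + cmod (side v j) * wing v i p) /
        `|cross (side v i) (side v j)|)
  (G := cmod (barrier_gradient v n p)) :
  (i < n)%N -> (j < n)%N -> cross (side v i) (side v j) != 0 ->
  (forall k, (k < n)%N -> 0 < wing v k p) -> is_center v n q ->
  cmod (q - p) * (1 - m ^+ 2 * G ^+ 2) <= n%:R * m ^+ 2 * G.
Proof.
move=> i_n j_n ij Ap cq; have Aq := cq.1.
have ratioE := center_ratio Ap cq; have ratioS := sum_wing_ratio q Ap.
set X := cross (barrier_gradient v n p) (q - p) in ratioE ratioS.
pose x k := wing v k q / wing v k p.
have x0 k : (k < n)%N -> 0 < x k by move=> kn; rewrite divr_gt0 ?Ap ?Aq.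
have xX k : (k < n)%N -> (x k - 1) ^+ 2 <= (n%:R + X) * X.
  move=> kn; have xk := x0 _ kn.
  have h1 : x k <= n%:R + X.
    rewrite -ratioS (bigD1 (Ordinal kn))//= lerDl.
    by apply: sumr_ge0 => l _; exact/ltW/x0.
  have h2 : (x k - 1) ^+ 2 / x k <= X.
    rewrite -ratioE (bigD1 (Ordinal kn))//= lerDl.
    by apply: sumr_ge0 => l _; rewrite divr_ge0 ?sqr_ge0 ?(ltW (x0 _ _)).
  have -> : (x k - 1) ^+ 2 = x k * ((x k - 1) ^+ 2 / x k).
    by rewrite mulrC divfK ?gt_eqF.
  by rewrite ler_pM ?(ltW xk)// divr_ge0 ?sqr_ge0 ?ltW.
set s := Num.sqrt ((n%:R + X) * X).
have Y0 : 0 <= (n%:R + X) * X by rewrite (le_trans _ (xX _ i_n))// sqr_ge0.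
have side_le k : (k < n)%N -> `|cross (side v k) (q - p)| <= wing v k p * s.
  move=> kn; have -> : cross (side v k) (q - p) = wing v k p * (x k - 1).
    have qE : q = p + (q - p) by rewrite addrC subrK.
    by rewrite mulrBr mulr1 mulrC divfK ?gt_eqF ?Ap// {2}qE wingD addrAC subrr add0r.
  rewrite normrM gtr0_norm ?Ap// ler_wpM2l ?(ltW (Ap _ kn))//.
  by rewrite -sqrtr_sqr ler_sqrt// xX.
have D0 : 0 < `|cross (side v i) (side v j)| by rewrite normr_gt0.
have m0 : 0 <= m.
  by rewrite divr_ge0 ?(ltW D0)// addr_ge0// mulr_ge0 ?cmod_ge0// ltW// Ap.
have Hs : cmod (q - p) <= m * s.
  rewrite {1}(cramer (q - p) ij) (le_trans (ler_cmodB _ _))// !cmodM.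
  have cabs (r : R) : cmod r%:C = `|r| by rewrite /cmod/= expr0n addr0 sqrtr_sqr.
  have flip (a b : R[i]) : cross a b = - cross b a by rewrite /cross; ring.
  rewrite !cabs !normrM !normfV (flip (q - p)) (flip (q - p)) !normrN.
  have [si sj] := (side_le i i_n, side_le j j_n).
  have ci := cmod_ge0 (side v i); have cj := cmod_ge0 (side v j).
  have dist (a b x' y z t d r : R) : 0 < d -> 0 <= a -> 0 <= b ->
      x' <= z * r -> y <= t * r -> x' / d * a + y / d * b <= (a * z + b * t) / d * r.
    move=> d0 a0 b0 xz yt.
    have -> : x' / d * a + y / d * b = (a * x' + b * y) / d by ring.
    have -> : (a * z + b * t) / d * r = (a * (z * r) + b * (t * r)) / d by ring.
    by rewrite ler_pM2r ?invr_gt0// lerD// ler_wpM2l.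
  exact: dist.
set H := cmod (q - p) in Hs *.
have H0 : 0 <= H := cmod_ge0 _.
have G0 : 0 <= G := cmod_ge0 _.
have XGH : X <= G * H by rewrite (le_trans (ler_norm _))// cross_le_cmod.
have H2 : H ^+ 2 <= m ^+ 2 * ((n%:R + X) * X).
  by rewrite -[X in _ * X](sqr_sqrtr Y0) -exprMn ler_pXn2r// nnegrE mulr_ge0 ?sqrtr_ge0.
have X0 : 0 <= X.
  rewrite -ratioE; apply: sumr_ge0 => k _.
  by rewrite divr_ge0 ?sqr_ge0// ltW// x0.
have n0 : 0 <= n%:R :> R by rewrite ler0n.
have H3 : H ^+ 2 <= m ^+ 2 * ((n%:R + G * H) * (G * H)).
  apply: (le_trans H2); apply: ler_wpM2l; first exact: sqr_ge0.
  by apply: ler_pM => //; [exact: addr_ge0|rewrite lerD2l].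
have [HE|Hn] := eqVneq H 0.
  rewrite HE mul0r; apply: mulr_ge0 => //; apply: mulr_ge0 => //.
  exact: sqr_ge0.
have Hp : 0 < H by rewrite lt_neqAle eq_sym Hn.
rewrite -(ler_pM2r Hp) mulrBr mulr1 mulrBl -expr2 lerBlDr.
rewrite (le_trans H3)// le_eqVlt; apply/orP; left; apply/eqP; ring.
Qed.

Lemma center_unique v n p q i j : (i < n)%N -> (j < n)%N ->
  cross (side v i) (side v j) != 0 -> is_center v n p -> is_center v n q -> q = p.
Proof.
move=> i_n j_n ij [Ap gp] cq; have := center_dist i_n j_n ij Ap cq.
rewrite gp (_ : cmod 0 = 0); last by rewrite /cmod/= expr0n addr0 sqrtr0.
rewrite expr0n !mulr0 subr0 mulr1 => H; apply/eqP; rewrite -subr_eq0.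
by move: H; rewrite leNgt cmod_gt0 negbK.
Qed.

Definition center v n : R[i]^o := xget 0 [set p | is_center v n p].

Lemma centerP v n p i j : (i < n)%N -> (j < n)%N ->
  cross (side v i) (side v j) != 0 -> is_center v n p -> center v n = p.
Proof.
move=> i_n j_n ij cp; apply: (center_unique i_n j_n ij cp).
by rewrite /center; case: xgetP => [y -> //|/(_ p)].
Qed.

Lemma cvg_dist_cmod (T : Type) (F : set_system T) {FF : Filter F}
    (f : T -> R[i]^o) (a : R[i]^o) :
  cmod (f x - a) @[x --> F] --> 0 -> f x @[x --> F] --> a.
Proof.
move=> fa; apply/cvgrPdist_lt => -[e e'] e0.
have [e'0 {}e0] : e' = 0 /\ 0 < e by move: e0; rewrite ltcE/= => /andP[/eqP].
move/cvgrPdist_lt : fa => /(_ _ e0); apply: filterS => x.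
rewrite sub0r normrN ger0_norm ?cmod_ge0// => fe.
have -> : e +i* e' = e%:C by rewrite e'0.
by rewrite distrC normcE' ltcR.
Qed.

(** The center [p] of the limit is kept fixed: the gradients of nearby polygons at [p] tend to 0,
    and [center_dist] bounds the distance to their centers. *)
Lemma cvg_center n (w : 'rV[R[i]^o]_n) p i j (X : set_system 'rV[R[i]^o]_n) :
  Filter X -> X --> w -> (i < n)%N -> (j < n)%N ->
  cross (side (vertex w) i) (side (vertex w) j) != 0 -> is_center (vertex w) n p ->
  center (vertex M) n @[M --> X] --> p.
Proof.
move=> FX Xw i_n j_n ij [Ap gp].
have n0 : (0 < n)%N by apply: leq_ltn_trans i_n.
have cv k : vertex M k @[M --> X] --> vertex w k by exact: cvg_vertex.
have cside k : (vertex M k.+1 - vertex M k) @[M --> X] --> (vertex w k.+1 - vertex w k).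
  by apply: cvgB; exact: cv.
have cwing k : wing (vertex M) k p @[M --> X] --> wing (vertex w) k p.
  by apply: cvg_cross; (apply: cvgB; [exact: cv|exact: cvg_cst]).
have ccross : cross (side (vertex M) i) (side (vertex M) j) @[M --> X] -->
    cross (side (vertex w) i) (side (vertex w) j).
  by exact: (cvg_cross (cside i) (cside j)).
pose m (M : 'rV[R[i]^o]_n) := (cmod (side (vertex M) i) * wing (vertex M) j p +
   cmod (side (vertex M) j) * wing (vertex M) i p) /
        `|cross (side (vertex M) i) (side (vertex M) j)|.
have cm : m M @[M --> X] --> m w.
  apply: cvgM.
    by apply: cvgD; (apply: cvgM; [exact: (cvg_cmod (cside _))|exact: cwing]).
  by apply: cvgV; [rewrite normr_eq0|exact: cvg_norm ccross].
pose G (M : 'rV[R[i]^o]_n) := cmod (barrier_gradient (vertex M) n p).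
have cG : G M @[M --> X] --> 0.
  have -> : 0 = G w by rewrite /G gp /cmod/= expr0n addr0 sqrtr0.
  have addc : continuous (fun x : R[i]^o * R[i]^o => x.1 + x.2).
    exact: add_continuous.
  apply: cvg_cmod; apply: (cvg_big addc) => k _.
  apply: cvg_complexM; last exact: cside.
  apply: cvg_complex; last exact: cvg_cst.
  by apply: cvgV; [rewrite gt_eqF ?Ap|exact: cwing].
have cmG : (m M ^+ 2 * G M ^+ 2) @[M --> X] --> 0.
  rewrite (_ : 0 = (m w * m w) * (0 * 0)); last by rewrite !mulr0.
  by apply: cvgM; (apply: cvgM; [|]); [exact: cm|exact: cm|exact: cG|exact: cG].
(* The factor 2 absorbs 1 - m^2 G^2, which is eventually above 1 / 2. *)
have cB : (2 * (n%:R * m M ^+ 2 * G M)) @[M --> X] --> 0.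
  rewrite (_ : 0 = 2 * (n%:R * (m w * m w) * 0)); last by rewrite !mulr0.
  apply: cvgM; first exact: cvg_cst.
  apply: cvgM; last exact: cG.
  by apply: cvgM; [exact: cvg_cst|apply: cvgM; exact: cm].
apply: cvg_dist_cmod; apply: (squeeze_cvgr _ _ cB); last first.
  exact: (@cvg_cst R 0).
have near_wing : \forall M \near X, forall k : 'I_n, 0 < wing (vertex M) k p.
  apply: filter_forall => k.
  have wk : 0 < wing (vertex w) k p by exact: Ap.
  have := cwing k; move/cvgrPdist_lt => /(_ _ wk); apply: filterS => M.
  by rewrite ltr_norml => /andP[_]; rewrite ltrBlDr ltrDl.
have near_cross : \forall M \near X,
    cross (side (vertex M) i) (side (vertex M) j) != 0.
  have d0 : 0 < `|cross (side (vertex w) i) (side (vertex w) j)| by rewrite normr_gt0.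
  move/cvgrPdist_lt : ccross => /(_ _ d0); apply: filterS => M.
  by apply: contraTneq => ->; rewrite subr0 ltxx.
have near_half : \forall M \near X, m M ^+ 2 * G M ^+ 2 < 1 / 2.
  have h0 : 0 < 1 / 2 :> R by rewrite divr_gt0.
  move/cvgrPdist_lt : cmG => /(_ _ h0); apply: filterS => M.
  by rewrite sub0r normrN; apply: le_lt_trans; exact: ler_norm.
apply: filterS3 near_wing near_cross near_half => M wM xM hM.
rewrite cmod_ge0/=.
have Aw k : (k < n)%N -> 0 < wing (vertex M) k p by move=> kn; exact: (wM (Ordinal kn)).
have [q cq] := center_exists (vertex_period M) i_n j_n xM Aw.
rewrite (centerP i_n j_n xM cq).
have := center_dist i_n j_n xM Aw cq; rewrite -/(m M) -/(G M).
have := cmod_ge0 (q - p).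
by nra.
Qed.

End CenterContinuity.

(** * Pentagons *)

Section PentagonFrame.
Variable R : realType.
Implicit Types (z : nat -> R[i]^o) (f r : nat -> R) (k : nat).

Definition min5 f : R :=
  Num.min (f 0%N) (Num.min (f 1%N) (Num.min (f 2%N) (Num.min (f 3%N) (f 4%N)))).

Lemma nat5_ind (P : nat -> Prop) : P 0%N -> P 1%N -> P 2%N -> P 3%N -> P 4%N ->
  forall k, (k < 5)%N -> P k.
Proof. by move=> P0 P1 P2 P3 P4 [|[|[|[|[|]]]]]. Qed.

Lemma lt_min5 (c : R) f : (c < min5 f) <-> (forall k, (k < 5)%N -> c < f k).
Proof.
rewrite /min5 !lt_min; split=> [/and5P[? ? ? ? ?]|H]; first exact: nat5_ind.
by rewrite !H.
Qed.

Lemma min5_le f k : (k < 5)%N -> min5 f <= f k.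
Proof.
by move: k; apply: nat5_ind; rewrite /min5 !ge_min lexx ?orbT.
Qed.

Lemma eq_min5 f r : (forall k, (k < 5)%N -> f k = r k) -> min5 f = min5 r.
Proof. by move=> fr; rewrite /min5 !fr. Qed.

Lemma min5D f (c : R) : min5 (fun k => f k + c) = min5 f + c.
Proof. by rewrite /min5 !addr_minl. Qed.

Lemma min5M f (c : R) : 0 <= c -> min5 (fun k => f k * c) = min5 f * c.
Proof. by move=> c0; rewrite /min5 !minr_pMl. Qed.

Lemma cvg_min5 (T : Type) (F : set_system T) {FF : Filter F} (g : T -> nat -> R) f :
  (forall k, g u k @[u --> F] --> f k) -> min5 (g u) @[u --> F] --> min5 f.
Proof. by move=> gf; rewrite /min5; do 4?[apply: cvg_min; first exact: gf]; exact: gf. Qed.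

Definition wedge z k : R := cross (z k) (z k.+1).

(* The scaling factors for which the vectors [weight z k * z k] have           *)
(* consecutive cross products equal to 1; they exist because 5 is odd.         *)
Definition weight z k : R :=
  Num.sqrt (wedge z k.+1 * wedge z k.+3 / (wedge z k * wedge z k.+2 * wedge z k.+4)).

Definition frame z k : R[i]^o := (weight z k)%:C * z k.

(** For a frame, the barycentric coordinate of y_k at 0 with respect to the triangle y_0, y_1, 0. *)
Definition excess z k : R := area (frame z 0%N) (frame z 1%N) (frame z k).

Section Fixed.
Variable z : nat -> R[i]^o.
Hypothesis (per : forall k, z k.+4.+1 = z k) (pos : forall k, 0 < wedge z k).

Lemma wedge_period k : wedge z k.+4.+1 = wedge z k.
Proof. by rewrite /wedge !per. Qed.

Lemma weight_gt0 k : 0 < weight z k.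
Proof. by rewrite sqrtr_gt0 divr_gt0 ?mulr_gt0. Qed.

Lemma weight_period k : weight z k.+4.+1 = weight z k.
Proof. by rewrite /weight !wedge_period. Qed.

Lemma frame_period k : frame z k.+4.+1 = frame z k.
Proof. by rewrite /frame weight_period per. Qed.

Lemma weight_mul k : weight z k * weight z k.+1 = (wedge z k)^-1.
Proof.
rewrite /weight -sqrtrM; last by rewrite ltW// divr_gt0 ?mulr_gt0.
have -> : wedge z k.+1 * wedge z k.+3 / (wedge z k * wedge z k.+2 * wedge z k.+4) *
   (wedge z k.+2 * wedge z k.+4 / (wedge z k.+1 * wedge z k.+3 * wedge z k.+1.+4)) =
   (wedge z k)^-1 ^+ 2.
  by rewrite (wedge_period k); field; rewrite !lt0r_neq0.
by rewrite sqrtr_sqr ger0_norm// invr_ge0 ltW.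
Qed.

Lemma wedge_frame k : wedge (frame z) k = 1.
Proof.
rewrite /wedge /frame cross_realC cross_realCr mulrA weight_mul mulVf//.
by rewrite lt0r_neq0.
Qed.

Lemma weight_scale (c : R[i]) r k : c != 0 -> (forall k, r k.+4.+1 = r k) ->
  (forall k, 0 < r k) ->
  weight (fun k => c * ((r k)%:C * z k)) k = weight z k / (cmod c * r k).
Proof.
move=> c0 rper r0; have cc : 0 < cmod c by rewrite cmod_gt0.
have E j : wedge (fun k => c * ((r k)%:C * z k)) j =
    cmod c ^+ 2 * (r j * r j.+1) * wedge z j.
  rewrite sqr_cmod /wedge /cross; case: (c) (z j) (z j.+1) => [? ?] [? ?] [? ?] /=.
  ring.
rewrite /weight !E !rper.
have -> : cmod c ^+ 2 * (r k.+1 * r k.+2) * wedge z k.+1 *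
    (cmod c ^+ 2 * (r k.+3 * r k.+4) * wedge z k.+3) /
    (cmod c ^+ 2 * (r k * r k.+1) * wedge z k * (cmod c ^+ 2 * (r k.+2 * r k.+3) * wedge z k.+2) *
     (cmod c ^+ 2 * (r k.+4 * r k) * wedge z k.+4)) =
   ((cmod c * r k)^-1) ^+ 2 *
   (wedge z k.+1 * wedge z k.+3 / (wedge z k * wedge z k.+2 * wedge z k.+4)).
  by field; rewrite !lt0r_neq0.
rewrite sqrtrM ?sqr_ge0// sqrtr_sqr ger0_norm ?invr_ge0 ?mulr_ge0 ?(ltW cc) ?(ltW (r0 _))//.
by rewrite mulrC.
Qed.

(** The weights undo any positive rescaling of the vectors, so that the frame depends on the angles
    alone, up to the rotation c / |c|. *)
Lemma frame_scale (c : R[i]) r k : c != 0 -> (forall k, r k.+4.+1 = r k) ->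
  (forall k, 0 < r k) ->
  frame (fun k => c * ((r k)%:C * z k)) k = c / (cmod c)%:C * frame z k.
Proof.
move=> c0 rper r0; rewrite /frame weight_scale//.
have rC : (r k)%:C != 0 :> R[i] by rewrite fmorph_eq0 lt0r_neq0.
have cC : (cmod c)%:C != 0 :> R[i] by rewrite fmorph_eq0 lt0r_neq0// cmod_gt0.
have -> : (weight z k / (cmod c * r k))%:C = (weight z k)%:C / ((cmod c)%:C * (r k)%:C) :> R[i].
  by rewrite fmorph_div rmorphM.
by field; rewrite rC cC.
Qed.

(** Otherwise all frame vectors lie in the open half-plane [cross u n > 0], where [slope], the
    cotangent of the angle from u to n, grows under counter-clockwise turning; it would increase all
    around the cycle. *)
Lemma excess_gt0 : exists2 k, (1 < k < 5)%N & 0 < excess z k.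
Proof.
apply: contrapT => H.
have le0 k : (1 < k < 5)%N -> excess z k <= 0.
  by move=> k5; rewrite leNgt; apply/negP => h; apply: H; exists k.
pose n := frame z 1%N - frame z 0%N.
have det01 := wedge_frame 0; rewrite /wedge in det01.
have n_gt0 k : (k < 5)%N -> 0 < cross (frame z k) n.
  have E j : cross (frame z j) n = 1 - excess z j.
    rewrite -det01 /excess /area /n /cross.
    by case: (frame z j) (frame z 0%N) (frame z 1%N) => [? ?] [? ?] [? ?] /=; ring.
  have e0 : excess z 0 = 0 by rewrite /excess /area subrr /cross/= mulr0 mulr0 subrr.
  have e1 : excess z 1 = 0 by rewrite /excess /area /cross mulrC subrr.
  move: k; apply: nat5_ind; rewrite E ?e0 ?e1 ?subr0// subr_gt0;
    (apply: le_lt_trans ltr01; exact: le0).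
pose slope (u : R[i]) := (Re n * Re u + Im n * Im u) / cross u n.
have slope_lt k : 0 < cross (frame z k) n -> 0 < cross (frame z k.+1) n ->
    slope (frame z k) < slope (frame z k.+1).
  have := wedge_frame k; rewrite /slope /wedge.
  move: (frame z k) (frame z k.+1) => a b ab1 a0 b0.
  rewrite ltr_pdivrMr// mulrAC ltr_pdivlMr// -subr_gt0.
  have -> : (Re n * Re b + Im n * Im b) * cross a n - (Re n * Re a + Im n * Im a) * cross b n =
     cmod n ^+ 2 * cross a b.
    by rewrite sqr_cmod /cross; case: (n) a b {ab1 a0 b0} => [? ?] [? ?] [? ?] /=; ring.
  rewrite ab1 mulr1 exprn_gt0// cmod_gt0; apply: contraTneq a0 => ->.
  by rewrite /cross/= !mulr0 subrr ltxx.
have n5 : 0 < cross (frame z 5) n by rewrite (frame_period 0) n_gt0.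
have := slope_lt _ (n_gt0 4 isT) n5; rewrite (frame_period 0).
have := slope_lt _ (n_gt0 3 isT) (n_gt0 4 isT).
have := slope_lt _ (n_gt0 2 isT) (n_gt0 3 isT).
have := slope_lt _ (n_gt0 1 isT) (n_gt0 2 isT).
have := slope_lt _ (n_gt0 0 isT) (n_gt0 1 isT).
by lra.
Qed.

End Fixed.

(** As 1 / A_k = sigma_k sigma_(k+1), the gradient is the sum of the sigma_k y_(k+1) - sigma_(k+1)
    y_k, regrouped cyclically; [k.+4] stands for k - 1. *)
Lemma barrier_frame (v : nat -> R[i]^o) p (z := fun k => v k - p : R[i]^o) :
  (forall k, z k.+4.+1 = z k) -> (forall k, 0 < wedge z k) ->
  barrier_gradient v 5 p =
  \sum_(k < 5) (weight z k.+4 - weight z k.+1)%:C * frame z k.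
Proof.
move=> per pos; rewrite /barrier_gradient.
have E k : ((wing v k p)^-1)%:C * side v k =
    ((weight z k)%:C * (weight z k.+1)%:C) * (z k.+1 - z k).
  rewrite -rmorphM/= weight_mul//; congr (_ * _).
  by rewrite /side /z opprB addrA subrK.
under eq_bigr do rewrite E; rewrite !big_ord_recr !big_ord0/= !add0r.
have := weight_period per.
move=> wp; rewrite !(wp 0%N) !(wp 1%N) !(wp 2%N) !(wp 3%N) (per 0%N) /frame !rmorphB/=.
ring.
Qed.

Lemma cvg_weight (T : Type) (F : set_system T) {FF : Filter F} (g : T -> nat -> R[i]^o) z k :
  (forall k, g u k @[u --> F] --> z k) -> (forall k, 0 < wedge z k) ->
  weight (g u) k @[u --> F] --> weight z k.
Proof.
move=> gz pos; have cw j : wedge (g u) j @[u --> F] --> wedge z j.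
  exact: (cvg_cross (gz j) (gz j.+1)).
have c1 : wedge (g u) k.+1 * wedge (g u) k.+3 /
    (wedge (g u) k * wedge (g u) k.+2 * wedge (g u) k.+4) @[u --> F] -->
    wedge z k.+1 * wedge z k.+3 / (wedge z k * wedge z k.+2 * wedge z k.+4).
  apply: cvgM; first by apply: cvgM; exact: cw.
  apply: cvgV; first by rewrite lt0r_neq0// !mulr_gt0.
  by apply: cvgM; [apply: cvgM|]; exact: cw.
exact: (cvg_comp _ _ c1 (@sqrt_continuous R _)).
Qed.

Lemma cvg_frame (T : Type) (F : set_system T) {FF : Filter F} (g : T -> nat -> R[i]^o) z k :
  (forall k, g u k @[u --> F] --> z k) -> (forall k, 0 < wedge z k) ->
  frame (g u) k @[u --> F] --> frame z k.
Proof.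
move=> gz pos; apply: cvg_complexM; last exact: gz.
by apply: cvg_complex; [exact: cvg_weight|exact: cvg_cst].
Qed.

End PentagonFrame.

(** * Trivialization of the plane of weight differences *)

Section Deviation.
Variable R : realType.
Implicit Types (z : nat -> R[i]^o) (G : nat -> nat -> R) (u d : nat -> R) (k : nat).

(** Cross products, invariant under a common rotation of the frame; what is built from them depends
    on the angles alone. *)
Definition gram z j k : R := cross (frame z j) (frame z k).

Definition gram_excess G k : R := G 1%N k - G 1%N 0%N - G 0%N k.

Definition positive_excess G k : R := Num.max (gram_excess G k) 0.

Definition sum3 u : R := u 2%N + u 3%N + u 4%N.

(* Sequences [d] of length 5 with [\sum_k d k = 0] and [\sum_k d k * y k = 0]  *)
(* form a plane that depends on [y]; the three entries [d 2], [d 3], [d 4]     *)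
(* determine [d] and fill the plane orthogonal to the excess. [flat_dev]    *)
(* and [dev] identify this plane with the fixed plane [sum3 u = 0], by         *)
(* projection along the positive part of the excess.                           *)
Definition flat_dev G d k : R :=
  d k - sum3 d / sum3 (positive_excess G) * positive_excess G k.

Definition tilt G u k : R := u k -
  sum3 (fun j => gram_excess G j * u j) /
  sum3 (fun j => gram_excess G j * positive_excess G j) * positive_excess G k.

Definition dev G u : nat -> R := nth 0
  [:: - sum3 (fun j => tilt G u j * G j 1%N); - sum3 (fun j => tilt G u j * G 0%N j);
      tilt G u 2%N; tilt G u 3%N; tilt G u 4%N].

Lemma gram_excessE z k : gram_excess (gram z) k = excess z k.
Proof.
rewrite /gram_excess /excess /area /gram /cross.
by case: (frame z 0%N) (frame z 1%N) (frame z k) => [? ?] [? ?] [? ?] /=; ring.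
Qed.

Lemma sum3_flat_dev G d : sum3 (positive_excess G) != 0 -> sum3 (flat_dev G d) = 0.
Proof. by rewrite /flat_dev; set m := positive_excess G; rewrite /sum3 => m0; field. Qed.

Lemma flat_dev_dev G u : sum3 (fun j => gram_excess G j * positive_excess G j) != 0 ->
  sum3 (positive_excess G) != 0 -> sum3 u = 0 ->
  forall k, (1 < k < 5)%N -> flat_dev G (dev G u) k = u k.
Proof.
move=> q0 m0 u0 k k5; set m := positive_excess G in q0 m0 *.
have devE j : (1 < j < 5)%N -> dev G u j = tilt G u j by case: j => [|[|[|[|[|]]]]].
rewrite /flat_dev /sum3 !devE//= /tilt -/m.
set c := _ / _; move: m0 u0; rewrite /sum3 => m0 u0.
have -> : u 2%N - c * m 2%N + (u 3%N - c * m 3%N) + (u 4%N - c * m 4%N) = - c * (m 2%N + m 3%N + m 4%N).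
  by rewrite -[LHS]subr0 -u0; ring.
by rewrite mulfK//; ring.
Qed.

Section Fixed.
Variable z : nat -> R[i]^o.
Hypothesis (per : forall k, z k.+4.+1 = z k) (pos : forall k, 0 < wedge z k).

Let G := gram z.

(** With [sum3_excess_sqr] this makes the positive part transverse to the plane [sum3 u = 0] and to
    the plane orthogonal to the excess, so that projecting along it identifies the two. *)
Lemma sum3_positive_excess : 0 < sum3 (positive_excess G).
Proof.
have [k k5 ek] := excess_gt0 per pos.
have m0 j : 0 <= positive_excess G j by rewrite le_max lexx orbT.
have mk : 0 < positive_excess G k by rewrite lt_max gram_excessE ek.
rewrite /sum3; case: k k5 mk {ek} => [|[|[|[|[|]]]]]// _ mk.
- by rewrite ltr_pwDl// ltr_pwDl.
- by rewrite ltr_pwDl// ltr_wpDl.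
- by rewrite ltr_wpDl// addr_ge0.
Qed.

Lemma sum3_excess_sqr : 0 < sum3 (fun j => gram_excess G j * positive_excess G j).
Proof.
have E j : gram_excess G j * positive_excess G j = positive_excess G j ^+ 2.
  by rewrite /positive_excess; case: leP => h; rewrite ?mulr0 ?expr2 ?mulr0.
have := sum3_positive_excess; rewrite /sum3 !E.
have m0 j : 0 <= positive_excess G j by rewrite le_max lexx orbT.
have := m0 2%N; have := m0 3%N; have := m0 4%N.
move: (positive_excess G 2%N) (positive_excess G 3%N) (positive_excess G 4%N) => a b c.
move=> c0 b0 a0 s0; have : 0 < (a + b + c) ^+ 2 by rewrite exprn_gt0.
by have := sqr_ge0 (a - b); have := sqr_ge0 (a - c); have := sqr_ge0 (b - c); nra.
Qed.

Lemma gram01 : G 0%N 1%N = 1.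
Proof. exact: (wedge_frame per pos 0%N). Qed.

(** The coefficients of y_k on y_0 and y_1 are [G k 1] and [G 0 k]; the excess is what they lack to
    sum up to 1. Once d 0 and d 1 are eliminated, the vanishing of the sum of d is therefore
    orthogonality to the excess. *)
Lemma gram_excess01 k : gram_excess G k = 1 - G k 1%N - G 0%N k.
Proof.
rewrite /gram_excess -gram01 /G /gram /cross.
by case: (frame z 0%N) (frame z 1%N) (frame z k) => [? ?] [? ?] [? ?] /=; ring.
Qed.

Lemma sum_dev u : \sum_(k < 5) dev G u k = 0.
Proof.
rewrite !big_ord_recr big_ord0/= add0r /dev/= /sum3.
have q0 := lt0r_neq0 sum3_excess_sqr.
have : sum3 (fun j => gram_excess G j * tilt G u j) = 0.
  by move: q0; rewrite /tilt; set m := positive_excess G; rewrite /sum3 => q0; field.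
by rewrite /sum3 !gram_excess01 => <-; ring.
Qed.

Lemma sum_dev_frame u : \sum_(k < 5) (dev G u k)%:C * frame z k = 0.
Proof.
have g0 : cross (frame z 0%N) (frame z 1%N) != 0 by rewrite [cross _ _]gram01 oner_neq0.
have E k : frame z k = (G k 1%N)%:C * frame z 0%N + (G 0%N k)%:C * frame z 1%N.
  rewrite {1}(cramer (frame z k) g0) [cross (frame z 0%N) (frame z 1%N)]gram01 !divr1.
  rewrite (_ : cross (frame z k) (frame z 0%N) = - G 0%N k); last first.
    by rewrite /G /gram /cross; ring.
  by rewrite rmorphN mulNr opprK.
rewrite !big_ord_recr big_ord0/= add0r /dev/= /sum3 (E 2%N) (E 3%N) (E 4%N).
move: (G 2%N 1%N) (G 3%N 1%N) (G 4%N 1%N) (G 0%N 2%N) (G 0%N 3%N) (G 0%N 4%N).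
move: (tilt G u 2%N) (tilt G u 3%N) (tilt G u 4%N) => a b c a' b' c' a'' b'' c''.
case: (frame z 0%N) (frame z 1%N) => [x y] [x' y']; apply/eqP.
by rewrite eq_complex/=; apply/andP; split; apply/eqP; ring.
Qed.

(** Pairing the vector relation with y_0 and y_1 recovers d 1 and d 0, and [tilt] undoes the
    projection, since both move along the positive excess. *)
Lemma dev_flat_dev d : \sum_(k < 5) d k = 0 -> \sum_(k < 5) (d k)%:C * frame z k = 0 ->
  forall k, (k < 5)%N -> dev G (flat_dev G d) k = d k.
Proof.
move=> d0 dy; have q0 := lt0r_neq0 sum3_excess_sqr.
have cr h : \sum_(k < 5) d k * cross (frame z k) h = 0.
  transitivity (cross (\sum_(k < 5) (d k)%:C * frame z k) h); last first.
    by rewrite dy /cross/= !mul0r subrr.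
  by rewrite cross_suml; apply: eq_bigr => k _; rewrite cross_realC.
have cxx a : cross a a = 0 :> R by rewrite /cross mulrC subrr.
have flip a b : cross a b = - cross b a :> R by rewrite /cross; ring.
have := cr (frame z 0%N); have := cr (frame z 1%N).
rewrite !big_ord_recr !big_ord0/= !add0r !cxx [cross (frame z 0%N) (frame z 1%N)]gram01.
rewrite (flip _ (frame z 0%N)) [cross (frame z 0%N) (frame z 1%N)]gram01.
rewrite !(flip _ (frame z 0%N)) -!/(gram z _ _) -/G => d1E d0E.
have qd : sum3 (fun j => gram_excess G j * d j) = 0.
  move: d0; rewrite !big_ord_recr !big_ord0/= !add0r => d0.
  by rewrite /sum3 !gram_excess01; lra.
have tiltE k : tilt G (flat_dev G d) k = d k.
  move: q0 qd; rewrite /tilt /flat_dev; set m := positive_excess G.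
  set c := _ / sum3 m; rewrite /sum3 => q0 qd.
  have -> : gram_excess G 2%N * (d 2%N - c * m 2%N) + gram_excess G 3%N * (d 3%N - c * m 3%N) +
     gram_excess G 4%N * (d 4%N - c * m 4%N) =
     - c * (gram_excess G 2%N * m 2%N + gram_excess G 3%N * m 3%N + gram_excess G 4%N * m 4%N).
    by rewrite -[RHS]add0r -qd; ring.
  by rewrite mulfK//; ring.
by apply: nat5_ind; rewrite /dev/= ?tiltE// /sum3 !tiltE; lra.
Qed.

End Fixed.

Lemma gram_scale z z' (c : R[i]) : cmod c = 1 ->
  (forall k, frame z' k = c * frame z k) -> gram z' = gram z.
Proof.
move=> c1 E; apply/funext => j; apply/funext => k; rewrite /gram !E.
have : cmod c ^+ 2 = 1 by rewrite c1 expr1n.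
rewrite sqr_cmod /cross; case: (c) (frame z j) (frame z k) => [x y] [? ?] [? ?] /= h.
by rewrite -[RHS]mul1r -h; ring.
Qed.

Lemma cvg_gram (T : Type) (F : set_system T) {FF : Filter F} (g : T -> nat -> R[i]^o) z j k :
  (forall k, g u k @[u --> F] --> z k) -> (forall k, 0 < wedge z k) ->
  gram (g u) j k @[u --> F] --> gram z j k.
Proof. by move=> gz pos; apply: cvg_cross; exact: cvg_frame. Qed.

Section Limits.
Variables (T : Type) (F : set_system T) (FF : Filter F).
Variables (H : T -> nat -> nat -> R) (G : nat -> nat -> R).
Hypothesis HG : forall j k, H u j k @[u --> F] --> G j k.

Lemma cvg_sum3 (f : T -> nat -> R) u : (forall k, f x k @[x --> F] --> u k) ->
  sum3 (f x) @[x --> F] --> sum3 u.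
Proof. by move=> fu; apply: cvgD; [apply: cvgD|]; exact: fu. Qed.

Lemma cvg_gram_excess k : gram_excess (H u) k @[u --> F] --> gram_excess G k.
Proof. by apply: cvgB; [apply: cvgB|]; exact: HG. Qed.

Lemma cvg_positive_excess k : positive_excess (H u) k @[u --> F] --> positive_excess G k.
Proof. by apply: cvg_max; [exact: cvg_gram_excess|exact: cvg_cst]. Qed.

Lemma cvg_flat_dev (f : T -> nat -> R) d k : 0 < sum3 (positive_excess G) ->
  (forall k, f x k @[x --> F] --> d k) ->
  flat_dev (H x) (f x) k @[x --> F] --> flat_dev G d k.
Proof.
move=> m0 fd; apply: cvgB; first exact: fd.
apply: cvgM; last exact: cvg_positive_excess.
apply: cvgM; first exact: (cvg_sum3 fd).
by apply: cvgV; [rewrite gt_eqF|exact: cvg_sum3 cvg_positive_excess].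
Qed.

Lemma cvg_dev (f : T -> nat -> R) u k :
  0 < sum3 (fun j => gram_excess G j * positive_excess G j) ->
  (forall k, f x k @[x --> F] --> u k) ->
  (k < 5)%N -> dev (H x) (f x) k @[x --> F] --> dev G u k.
Proof.
move=> q0 fu.
have ct j : tilt (H x) (f x) j @[x --> F] --> tilt G u j.
  apply: cvgB; first exact: fu.
  apply: cvgM; last exact: cvg_positive_excess.
  apply: cvgM.
    apply: cvg_sum3 => i; apply: cvgM; [exact: cvg_gram_excess|exact: fu].
  apply: cvgV; first by rewrite gt_eqF.
  apply: cvg_sum3 => i; apply: cvgM; [exact: cvg_gram_excess|exact: cvg_positive_excess].
move: k; apply: nat5_ind; rewrite /dev/=.
- apply: cvgN; apply: cvg_sum3 => j; apply: cvgM; [exact: ct|exact: HG].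
- apply: cvgN; apply: cvg_sum3 => j; apply: cvgM; [exact: ct|exact: HG].
- exact: ct.
- exact: ct.
- exact: ct.
Qed.

End Limits.

End Deviation.

(** * Spokes from the center to the vertices, and their angles *)

Section PentagonSpokes.
Variable R : realType.
Implicit Types (v : nat -> R[i]^o) (p q : R[i]^o) (n k : nat) (w : 'rV[R[i]^o]_5).

(** The segment from [p] to [q] stays in the kernel, hence off the curve, and the total angle is
    constant along it. *)
Lemma star_kernel v n p q : (0 < n)%N -> v n = v 0%N -> star v n p ->
  (forall k, (k < n)%N -> 0 < wing v k q) -> star v n q.
Proof.
move=> n0 vn st Aq; split=> //; rewrite -st.2.
pose l := edge (fun k => if k is 0%N then p else q) 0.
have wE k s : wing v k (l s) = (1 - s) * wing v k p + s * wing v k q.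
  rewrite /l /edge /wing /cross.
  by case: (v k) (v k.+1) p q {st Aq l} => [? ?] [? ?] [? ?] [? ?] /=; ring.
have cl : continuous l by exact: continuous_edge.
have con : connected (l @` `[0, 1]%classic).
  apply: connected_continuous_connected.
    by apply/connected_intervalP; exact: interval_is_interval.
  exact: continuous_subspaceT.
apply: (winding_constant vn con).
- move=> _ [s + <-]; rewrite /= in_itv/= => /andP[s0 s1].
  apply: cross_avoids => // k kn; rewrite -[cross _ _]/(wing v k (l s)) wE.
  have [Ap _] := st; have := Ap _ kn; have := Aq _ kn; rewrite -/(wing v k p).
  by move=> wq wp; have [->|s_neq] := eqVneq s 0; nra.
- by exists 1; rewrite /= ?in_itv/= ?ler01 ?lexx// /l edge1.
- by exists 0; rewrite /= ?in_itv/= ?ler01 ?lexx// /l edge0.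
Qed.

Definition pentagon_center w : R[i]^o := center (vertex w) 5.

Definition spoke w k : R[i]^o := vertex w k - pentagon_center w.

Definition angle (z : nat -> R[i]^o) k : R := arg (z k.+1 / z k).

Lemma spoke_period w k : spoke w k.+4.+1 = spoke w k.
Proof. by rewrite /spoke -(vertex_add w k) addnC. Qed.

Lemma LSP_not_flat w : LSP w -> exists i j,
  [/\ (i < 5)%N, (j < 5)%N & cross (side (vertex w) i) (side (vertex w) j) != 0].
Proof.
move=> [sw _]; have [//|k] := @simple_not_flat R 5 w _ sw.
have sideE j : side (vertex w) (j %% 5) = side (vertex w) j.
  by rewrite /side vertex_mod vertex_modS.
have -> : area (vertex w k) (vertex w k.+1) (vertex w k.+2) =
    cross (side (vertex w) k) (side (vertex w) k.+1).
  rewrite /area /side /cross.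
  by case: (vertex w k) (vertex w k.+1) (vertex w k.+2) => [? ?] [? ?] [? ?] /=; ring.
move=> k0; exists (k %% 5)%N, (k.+1 %% 5)%N.
by rewrite !ltn_mod !sideE.
Qed.

Lemma LSP_center w p : LSP w -> is_center (vertex w) 5 p -> pentagon_center w = p.
Proof. by move=> /LSP_not_flat[i [j [i5 j5 ij]]]; exact: centerP i5 j5 ij. Qed.

Lemma LSP_spoke w : LSP w -> [/\ is_center (vertex w) 5 (pentagon_center w),
  (forall k, 0 < wedge (spoke w) k) & \sum_(k < 5) angle (spoke w) k = 2 * pi].
Proof.
move=> Lw; have [i [j [i5 j5 ij]]] := LSP_not_flat Lw.
have [p st] := (LSP_pentagonP w).1 Lw.
have [q cq] := center_exists (vertex_period w) i5 j5 ij st.1.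
have cw := cq; rewrite -(centerP i5 j5 ij cq) -/(pentagon_center w) in cw.
split=> //; last first.
  have [_ <-] := @star_kernel (vertex w) 5 p (pentagon_center w) isT (vertex_period w) st cw.1.
  by [].
move=> k; have := cw.1 (k %% 5)%N; rewrite ltn_mod => /(_ isT).
by rewrite /wing vertex_mod vertex_modS.
Qed.

Lemma cvg_spoke w k (X : set_system 'rV[R[i]^o]_5) : Filter X -> LSP w -> X --> w ->
  spoke M k @[M --> X] --> spoke w k.
Proof.
move=> FX Lw Xw; have [i [j [i5 j5 ij]]] := LSP_not_flat Lw.
have [cw _ _] := LSP_spoke Lw.
apply: cvgB; first exact: cvg_vertex.
exact: (cvg_center FX Xw i5 j5 ij cw).
Qed.

(** A similarity multiplies all wings by |a|^2 and hence takes the center to the center. *)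
Lemma spoke_Aff w (a b : R[i]) k : LSP w -> a != 0 ->
  spoke (map_mx (fun z => a * z + b) w) k = a * spoke w k.
Proof.
move=> Lw a0; set h := fun z => _; have [cw pos sw] := LSP_spoke Lw.
set p := pentagon_center w.
have vE j : vertex (map_mx h w) j = h (vertex w j) by rewrite vertex_map.
have hB z u : h z - h u = a * (z - u) by rewrite /h; ring.
have wE j : wing (vertex (map_mx h w)) j (h p) = cmod a ^+ 2 * wing (vertex w) j p.
  rewrite /wing !vE !hB sqr_cmod /cross.
  by case: (a) (_ - p) (vertex w j.+1 - p) => [? ?] [? ?] [? ?] /=; ring.
have a2 : 0 < cmod a ^+ 2 by rewrite exprn_gt0// cmod_gt0.
have cE : is_center (vertex (map_mx h w)) 5 (h p).
  split=> [j j5|]; first by rewrite wE mulr_gt0// cw.1.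
  transitivity (((cmod a ^+ 2)^-1)%:C * a * barrier_gradient (vertex w) 5 p); last first.
    by rewrite cw.2 mulr0.
  rewrite /barrier_gradient mulr_sumr; apply: eq_bigr => j _.
  by rewrite wE invfM rmorphM/= /side !vE hB; ring.
have Lh : LSP (map_mx h w).
  apply/LSP_pentagonP; exists (h p); split=> [j j5|]; first exact: cE.1.
  rewrite -sw /winding; apply: eq_bigr => j _; rewrite !vE !hB -mulf_div divff// mul1r.
  by [].
by rewrite {1}/spoke (LSP_center Lh cE) vE hB.
Qed.

(** The gauge of the box -2 pi / 5 < b k < 3 pi / 5, that is, of angles in (0, pi) recentred at the
    regular pentagon; a maximum written as - min. *)
Definition angle_gauge (b : nat -> R) : R :=
  - min5 (fun k => Num.min (b k * (5 / (2 * pi))) (b k * - (5 / (3 * pi)))).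

Lemma angle_gauge_lt1 b : (angle_gauge b < 1) <->
  (forall k, (k < 5)%N -> 0 < b k + 2 * pi / 5 < pi).
Proof.
have pi0 : 0 < pi :> R := pi_gt0 R.
rewrite /angle_gauge ltrNl lt_min5.
suff E k : (- 1 < Num.min (b k * (5 / (2 * pi))) (b k * - (5 / (3 * pi)))) =
    (0 < b k + 2 * pi / 5 < pi).
  by split=> H k k5; have := H k k5; rewrite E.
rewrite lt_min mulrN ltrN2 !mulrA; congr (_ && _).
  by rewrite ltr_pdivlMr ?mulr_gt0//; apply/idP/idP; lra.
by rewrite ltr_pdivrMr ?mulr_gt0//; apply/idP/idP; lra.
Qed.

Lemma angle_gauge_ge0 b : 0 <= angle_gauge b.
Proof.
rewrite oppr_ge0 (le_trans (min5_le _ (_ : 0 < 5)%N))// ge_min.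
have p2 : 0 <= 5 / (2 * pi) :> R by rewrite divr_ge0// mulr_ge0// pi_ge0.
have p3 : 0 <= 5 / (3 * pi) :> R by rewrite divr_ge0// mulr_ge0// pi_ge0.
have [b0|b0] := leP (b 0%N) 0; first by rewrite mulr_le0_ge0.
by rewrite mulrN oppr_le0 mulr_ge0 ?orbT// ltW.
Qed.

Lemma angle_gaugeM b (c : R) : 0 <= c ->
  angle_gauge (fun k => b k * c) = angle_gauge b * c.
Proof.
move=> c0; rewrite /angle_gauge mulNr -min5M//; congr (- _); apply: eq_min5 => k _.
by rewrite minr_pMl// ![_ * c * _]mulrAC.
Qed.

Lemma eq_angle_gauge b b' : (forall k, (k < 5)%N -> b k = b' k) ->
  angle_gauge b = angle_gauge b'.
Proof. by move=> bb; congr (- _); apply: eq_min5 => k k5; rewrite bb. Qed.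

Lemma cvg_angle_gauge (T : Type) (F : set_system T) {FF : Filter F} (g : T -> nat -> R) b :
  (forall k, g u k @[u --> F] --> b k) -> angle_gauge (g u) @[u --> F] --> angle_gauge b.
Proof.
move=> gb; apply: cvgN; apply: cvg_min5 => k.
by apply: cvg_min; (apply: cvgM; [exact: gb|exact: cvg_cst]).
Qed.

End PentagonSpokes.

(** * Directions with given angles, and weights with given differences *)

Section PentagonModel.
Variable R : realType.
Implicit Types (z : nat -> R[i]^o) (m d u : nat -> R) (k : nat) (x : 'rV[R]_6).

Lemma modS5 k : (k.+4.+1 %% 5 = k %% 5)%N.
Proof. by have -> : k.+4.+1 = (k + 5)%N; rewrite ?modnDr// addnC. Qed.

Lemma period_mod (T : Type) (f : nat -> T) k : (forall k, f k.+4.+1 = f k) ->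
  f (k %% 5)%N = f k.
Proof.
move=> per; rewrite {2}(divn_eq k 5) addnC; elim: (k %/ 5)%N => [|q ->].
  by rewrite mul0n addn0.
by rewrite mulSn addnCA -per.
Qed.

(** Reducing the index makes the sequence periodic by definition; the total 2 pi enters in [turnS]
    at the wrap-around. *)
Definition turn m k : R[i]^o := expi (\sum_(j < k %% 5) m j).

Lemma turn_period m k : turn m k.+4.+1 = turn m k.
Proof. by rewrite /turn modS5. Qed.

Lemma turnS m k : \sum_(j < 5) m j = 2 * pi -> turn m k.+1 = turn m k * expi (m (k %% 5)%N).
Proof.
move=> m5; rewrite /turn -expiD -addn1 -modnDml addn1.
have : (k %% 5 < 5)%N by rewrite ltn_mod.
move: (k %% 5)%N; apply: nat5_ind.
- by rewrite /= !big_ord_recr/= !big_ord0.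
- by rewrite /= !big_ord_recr/= !big_ord0.
- by rewrite /= !big_ord_recr/= !big_ord0.
- by rewrite /= !big_ord_recr/= !big_ord0.
- rewrite modnn big_ord0 -(big_ord_recr 4 m) m5 expi0.
  by have := expi2pi R 1; rewrite mulr1.
Qed.

Lemma wedge_turn m k : \sum_(j < 5) m j = 2 * pi ->
  wedge (turn m) k = sin (m (k %% 5)%N).
Proof.
move=> m5; rewrite /wedge turnS// /turn /expi; set a := \sum_j _.
rewrite /cross/= -[RHS]mul1r -(cos2Dsin2 a); ring.
Qed.

Definition skew z k : R := (weight z k.+4 - weight z k.+1) / min5 (weight z).

(* The step [k - 1 -> k + 1] runs through all residues mod 5, so that the      *)
(* differences [d k = s (k - 1) - s (k + 1)] determine [s] up to a constant.   *)
Definition level d : nat -> R := nth 0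
  [:: 0; - d 1%N - d 3%N - d 0%N; - d 1%N; - d 1%N - d 3%N - d 0%N - d 2%N; - d 1%N - d 3%N].

(** The additive constant left open by [level] is fixed by the minimum 1, which also keeps the
    weights positive. *)
Definition mass d k : R := level d (k %% 5) - min5 (level d) + 1.

Lemma mass_period d k : mass d k.+4.+1 = mass d k.
Proof. by rewrite /mass modS5. Qed.

Lemma mass_ge1 d k : 1 <= mass d k.
Proof. by rewrite lerDr subr_ge0 min5_le// ltn_mod. Qed.

Lemma mass_gt0 d k : 0 < mass d k.
Proof. exact: lt_le_trans (mass_ge1 d k). Qed.

(** [level] is built from d 0 to d 3; at k = 4 the vanishing sum closes the cycle. *)
Lemma mass_diff d k : \sum_(j < 5) d j = 0 -> (k < 5)%N ->
  mass d k.+4 - mass d k.+1 = d k.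
Proof.
rewrite !big_ord_recr big_ord0/= add0r => d0.
move: k; apply: nat5_ind; rewrite /mass /level/=; try ring.
by have -> : d 4%N = - (d 0%N + d 1%N + d 2%N + d 3%N); [lra|ring].
Qed.

Lemma min5_mass d : min5 (mass d) = 1.
Proof.
have E k : (k < 5)%N -> mass d k = level d k + (1 - min5 (level d)).
  by move=> k5; rewrite /mass modn_small//; ring.
by rewrite (eq_min5 E) min5D addrC subrK.
Qed.

Lemma skew_mass z d : (forall k, weight z k = mass d k) ->
  \sum_(j < 5) d j = 0 -> forall k, (k < 5)%N -> skew z k = d k.
Proof.
move=> wz d0 k k5; rewrite /skew (eq_min5 (r := mass d))// min5_mass divr1.
by rewrite !wz mass_diff.
Qed.

Section Fixed.
Variable z : nat -> R[i]^o.
Hypothesis (per : forall k, z k.+4.+1 = z k) (pos : forall k, 0 < wedge z k).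

Lemma min5_weight_gt0 : 0 < min5 (weight z).
Proof. by apply/lt_min5 => k _; exact: weight_gt0. Qed.

Lemma sum_skew : \sum_(k < 5) skew z k = 0.
Proof.
have wp := weight_period per.
rewrite -mulr_suml !big_ord_recr big_ord0/= add0r.
by rewrite (wp 0%N) (wp 1%N) (wp 2%N) (wp 3%N) [X in X / _](_ : _ = 0) ?mul0r//; ring.
Qed.

Lemma mass_skew d k : (forall k, (k < 5)%N -> d k = skew z k) -> (k < 5)%N ->
  mass d k = weight z k / min5 (weight z).
Proof.
move=> dE; set mu := min5 (weight z).
have wp := weight_period per.
have levelE j : (j < 5)%N -> level d j = weight z j / mu + - (weight z 0%N / mu).
  move: j; apply: nat5_ind; rewrite /level/= ?dE// /skew -/mu.
  - by rewrite subrr.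
  - by rewrite (wp 0%N) (wp 2%N); ring.
  - by rewrite (wp 0%N); ring.
  - by rewrite (wp 0%N) (wp 1%N) (wp 2%N); ring.
  - by rewrite (wp 0%N) (wp 2%N); ring.
move=> k5; rewrite /mass modn_small// levelE// (eq_min5 levelE) min5D.
rewrite min5M ?invr_ge0 ?(ltW min5_weight_gt0)// -/mu divff ?gt_eqF ?min5_weight_gt0//.
ring.
Qed.

End Fixed.

Lemma eq_dev G u u' : (forall k, (1 < k < 5)%N -> u k = u' k) -> dev G u =1 dev G u'.
Proof.
move=> uu k; have tE j : tilt G u j = u j - (u' j - tilt G u' j).
  by rewrite /tilt /sum3 !(uu 2%N isT, uu 3%N isT, uu 4%N isT); ring.
by rewrite /dev /sum3 !tE !(uu 2%N isT, uu 3%N isT, uu 4%N isT) !subKr.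
Qed.

Lemma cvg_skew (T : Type) (F : set_system T) {FF : Filter F} (g : T -> nat -> R[i]^o) z k :
  (forall k, g u k @[u --> F] --> z k) -> (forall k, 0 < wedge z k) ->
  skew (g u) k @[u --> F] --> skew z k.
Proof.
move=> gz pos; apply: cvgM; first by apply: cvgB; exact: cvg_weight.
apply: cvgV; first by rewrite gt_eqF// min5_weight_gt0.
by apply: cvg_min5 => j; exact: cvg_weight.
Qed.

Lemma cvg_mass (T : Type) (F : set_system T) {FF : Filter F} (g : T -> nat -> R) d k :
  (forall k, (k < 5)%N -> g u k @[u --> F] --> d k) -> mass (g u) k @[u --> F] --> mass d k.
Proof.
move=> gd; have cl j : (j < 5)%N -> level (g u) j @[u --> F] --> level d j.
  move: j; apply: nat5_ind; rewrite /level/=.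
  - exact: cvg_cst.
  - by apply: cvgB; [apply: cvgB; [apply: cvgN|]|]; exact: gd.
  - by apply: cvgN; exact: gd.
  - by apply: cvgB; [apply: cvgB; [apply: cvgB; [apply: cvgN|]|]|]; exact: gd.
  - by apply: cvgB; [apply: cvgN|]; exact: gd.
apply: cvgD; last exact: cvg_cst.
apply: cvgB; first by apply: cl; rewrite ltn_mod.
by rewrite /min5; do 4?[apply: cvg_min; first exact: cl]; exact: cl.
Qed.

Lemma cvg_turn (T : Type) (F : set_system T) {FF : Filter F} (g : T -> nat -> R) m k :
  (forall k, g u k @[u --> F] --> m k) -> turn (g u) k @[u --> F] --> turn m k.
Proof.
move=> gm; have cs n : \sum_(j < n) g u j @[u --> F] --> \sum_(j < n) m j.
  elim: n => [|n IH].
    rewrite big_ord0; under eq_fun do rewrite big_ord0; exact: cvg_cst.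
  rewrite big_ord_recr/=; under eq_fun do rewrite big_ord_recr/=.
  by apply: cvgD; [exact: IH|exact: gm].
apply: cvg_complex.
  exact: (cvg_comp _ _ (cs (k %% 5)%N) (@continuous_cos R _)).
exact: (cvg_comp _ _ (cs (k %% 5)%N) (@continuous_sin R _)).
Qed.

End PentagonModel.

(** * The chart of pentagons and its section *)

Section Pentagon.
Variable R : realType.
Implicit Types (k : nat) (x : 'rV[R]_6) (w : 'rV[R[i]^o]_5).

Definition offset (z : nat -> R[i]^o) k : R := angle z k - 2 * pi / 5.

(** Four offsets determine the fifth, and two entries of [flat_dev] the third, as both families sum
    up to 0. *)
Definition pentagon_coord w : nat -> R :=
  let z := spoke w in
  let g := 1 - angle_gauge (offset z) in
  nth 0 [:: offset z 0 / g; offset z 1 / g; offset z 2 / g; offset z 3 / g;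
    flat_dev (gram z) (skew z) 2; flat_dev (gram z) (skew z) 3].

Definition pentagon_chart w : 'rV[R]_6 := \row_j pentagon_coord w j.

Definition model_offset x : nat -> R :=
  let c k := x 0 (inord k) in
  nth 0 [:: c 0%N; c 1%N; c 2%N; c 3%N; - (c 0%N + c 1%N + c 2%N + c 3%N)].

Definition model_angle x k : R :=
  model_offset x k / (1 + angle_gauge (model_offset x)) + 2 * pi / 5.

Definition model_turn x : nat -> R[i]^o := turn (model_angle x).

Definition model_flat x : nat -> R :=
  let c k := x 0 (inord k) in nth 0 [:: 0; 0; c 4%N; c 5; - (c 4%N + c 5)].

Definition model_dev x : nat -> R := dev (gram (model_turn x)) (model_flat x).

(** Dividing the frame by [mass] yields vectors whose weights are [mass] and whose frame is
    unchanged. *)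
Definition model_spoke x k : R[i]^o :=
  ((mass (model_dev x) k)^-1)%:C * frame (model_turn x) k.

Definition pentagon_model x : 'rV[R[i]^o]_5 := \row_j model_spoke x j.

Section Model.
Variable x : 'rV[R]_6.

Let e := model_turn x.

Lemma model_gauge_neq0 : 1 + angle_gauge (model_offset x) != 0.
Proof. by rewrite gt_eqF// ltr_pwDl// angle_gauge_ge0. Qed.

Lemma sum_model_angle : \sum_(k < 5) model_angle x k = 2 * pi.
Proof.
rewrite !big_ord_recr big_ord0/= add0r /model_angle /model_offset/=.
by field; exact: model_gauge_neq0.
Qed.

Lemma model_angle_bound k : (k < 5)%N -> 0 < model_angle x k < pi.
Proof.
move: k; apply/angle_gauge_lt1; rewrite angle_gaugeM ?invr_ge0 ?addr_ge0 ?angle_gauge_ge0//.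
by apply: gauge_in_lt1; exact: angle_gauge_ge0.
Qed.

Lemma wedge_model_turn k : 0 < wedge e k.
Proof.
rewrite wedge_turn ?sum_model_angle//; apply: sin_gt0_pi.
by apply: model_angle_bound; rewrite ltn_mod.
Qed.

Let per : forall k, e k.+4.+1 = e k := turn_period (model_angle x).

Lemma model_spokeE : model_spoke x = fun k =>
  1 * ((weight e k / mass (model_dev x) k)%:C * e k).
Proof.
apply/funext => k; rewrite mul1r /model_spoke /frame mulrA -rmorphM/=.
by rewrite [_^-1 * _]mulrC.
Qed.

Let ratio_gt0 k : 0 < weight e k / mass (model_dev x) k.
Proof. by rewrite divr_gt0 ?mass_gt0//; exact: weight_gt0 wedge_model_turn k. Qed.

Let cmod1 : cmod (1 : R[i]) = 1.
Proof. by rewrite -[1]/(1%:C) cmod_real. Qed.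

Lemma weight_model_spoke k : weight (model_spoke x) k = mass (model_dev x) k.
Proof.
rewrite model_spokeE (weight_scale wedge_model_turn) ?oner_neq0//.
rewrite cmod1 mul1r invf_div mulrC divfK// gt_eqF//.
exact: weight_gt0 wedge_model_turn k.
Qed.

Lemma frame_model_spoke : frame (model_spoke x) = frame e.
Proof.
apply/funext => k; rewrite model_spokeE (frame_scale wedge_model_turn) ?oner_neq0//.
by rewrite cmod1 divr1 mul1r.
Qed.

Lemma model_spoke_period k : model_spoke x k.+4.+1 = model_spoke x k.
Proof. by rewrite /model_spoke mass_period (frame_period per). Qed.

Lemma wedge_model_spoke k : 0 < wedge (model_spoke x) k.
Proof.
rewrite /wedge /model_spoke cross_realC cross_realCr -[cross _ _]/(wedge (frame e) k).
by rewrite (wedge_frame per wedge_model_turn) mulr1 mulr_gt0// invr_gt0 mass_gt0.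
Qed.

Lemma vertex_model : vertex (pentagon_model x) = model_spoke x.
Proof.
apply/funext => k; rewrite -vertex_mod -(period_mod _ model_spoke_period).
by rewrite vertex_row// ltn_mod.
Qed.

Lemma sum_model_dev : \sum_(k < 5) model_dev x k = 0.
Proof. exact: sum_dev per wedge_model_turn _. Qed.

(** By [barrier_frame] the gradient at 0 combines the frame vectors with the differences of the
    masses, and [dev] was built to make this vanish. *)
Lemma model_center : is_center (vertex (pentagon_model x)) 5 0.
Proof.
have V0 : (fun k => vertex (pentagon_model x) k - 0) = model_spoke x.
  by apply/funext => k; rewrite vertex_model subr0.
split=> [k k5|].
  by have := wedge_model_spoke k; rewrite -V0.
have := @barrier_frame R (vertex (pentagon_model x)) 0; rewrite /= V0.
move=> ->; [|by move=> k; rewrite vertex_model !subr0 model_spoke_period|exact: wedge_model_spoke].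
rewrite frame_model_spoke -[RHS](sum_dev_frame per wedge_model_turn (model_flat x)).
apply: eq_bigr => k _; rewrite !weight_model_spoke mass_diff//.
exact: sum_model_dev.
Qed.

Lemma angle_model_spoke k : angle (model_spoke x) k = model_angle x (k %% 5).
Proof.
have /andP[a0 api] : 0 < model_angle x (k %% 5) < pi.
  by apply: model_angle_bound; rewrite ltn_mod.
rewrite /angle model_spokeE !mul1r [e k.+1](turnS k sum_model_angle).
have r_neq0 : (weight e k / mass (model_dev x) k)%:C != 0 :> R[i].
  by rewrite fmorph_eq0 gt_eqF// ratio_gt0.
have e_neq0 : e k != 0 by exact: expi_neq0.
have -> : (weight e k.+1 / mass (model_dev x) k.+1)%:C *
    (turn (model_angle x) k * expi (model_angle x (k %% 5))) /
    ((weight e k / mass (model_dev x) k)%:C * e k) =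
    ((weight e k.+1 / mass (model_dev x) k.+1) / (weight e k / mass (model_dev x) k))%:C *
    expi (model_angle x (k %% 5)).
  rewrite [in RHS]fmorph_div/= -[turn _ k]/(e k).
  move: (_%:C) r_neq0 (_%:C) (expi _) => r r0 r' u; field.
  by rewrite r0 e_neq0.
apply: arg_unique; first by rewrite divr_gt0// ratio_gt0.
by rewrite api andbT (lt_trans _ a0)// oppr_lt0 pi_gt0.
Qed.

Lemma LSP_model : LSP (pentagon_model x).
Proof.
apply/LSP_pentagonP; exists 0; split=> [k k5|]; first exact: model_center.1.
rewrite -sum_model_angle; apply: eq_bigr => k _.
rewrite !subr0 !vertex_model -[arg _]/(angle (model_spoke x) k).
by rewrite angle_model_spoke modn_small.
Qed.

Lemma spoke_model : spoke (pentagon_model x) = model_spoke x.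
Proof.
apply/funext => k; rewrite /spoke (LSP_center LSP_model model_center).
by rewrite vertex_model subr0.
Qed.

Lemma model_flat_sum : sum3 (model_flat x) = 0.
Proof. by rewrite /sum3 /model_flat/= addrN. Qed.

Lemma pentagon_chartK : pentagon_chart (pentagon_model x) = x.
Proof.
have oE k : (k < 5)%N -> offset (model_spoke x) k =
    model_offset x k * (1 + angle_gauge (model_offset x))^-1.
  by move=> k5; rewrite /offset angle_model_spoke modn_small// /model_angle addrK.
have gE : angle_gauge (offset (model_spoke x)) =
    angle_gauge (model_offset x) / (1 + angle_gauge (model_offset x)).
  rewrite (eq_angle_gauge oE) angle_gaugeM// invr_ge0 addr_ge0 ?angle_gauge_ge0//.
have gram_model : gram (model_spoke x) = gram e by rewrite /gram frame_model_spoke.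
have sE k : (k < 5)%N -> skew (model_spoke x) k = model_dev x k.
  by apply: skew_mass; [exact: weight_model_spoke|exact: sum_model_dev].
have fE k : (1 < k < 5)%N ->
    flat_dev (gram (model_spoke x)) (skew (model_spoke x)) k = model_flat x k.
  move=> k5; rewrite gram_model -(@flat_dev_dev _ (gram e) (model_flat x)) //.
  - by rewrite /flat_dev /sum3 !sE//; case/andP: k5.
  - by rewrite gt_eqF//; exact: sum3_excess_sqr per wedge_model_turn.
  - by rewrite gt_eqF//; exact: sum3_positive_excess per wedge_model_turn.
  - exact: model_flat_sum.
suff H k : (k < 6)%N -> pentagon_coord (pentagon_model x) k = x 0 (inord k).
  by apply/rowP => j; rewrite mxE H// inord_val.
rewrite /pentagon_coord spoke_model gE !fE// !oE//.
by case: k => [|[|[|[|[|[|//]]]]]] _; rewrite //= gauge_in// angle_gauge_ge0.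
Qed.

End Model.
End Pentagon.

(** * The homeomorphism for pentagons *)

Section PentagonHomeomorphism.
Variable R : realType.
Implicit Types (k : nat) (x : 'rV[R]_6) (w : 'rV[R[i]^o]_5) (z : nat -> R[i]^o).

Lemma wedge_neq0 z k : 0 < wedge z k -> z k != 0.
Proof. by apply: contraTneq; rewrite /wedge => ->; rewrite /cross/= !mul0r subrr ltxx. Qed.

Lemma slit_ratio z k : 0 < wedge z k -> slit (z k.+1 / z k).
Proof.
move=> zk; apply/orP; left; rewrite Im_divc gt_eqF// divr_gt0//.
by rewrite exprn_gt0// cmod_gt0 wedge_neq0.
Qed.

Lemma angle_period z k : (forall k, z k.+4.+1 = z k) -> angle z k.+4.+1 = angle z k.
Proof. by move=> per; rewrite /angle !per. Qed.

Lemma polar_turn z k : (forall k, z k.+4.+1 = z k) -> (forall k, 0 < wedge z k) ->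
  \sum_(j < 5) angle z j = 2 * pi ->
  z k = z 0%N / (cmod (z 0%N))%:C * ((cmod (z k))%:C * turn (angle z) k).
Proof.
move=> per pos sa.
have cC j : (cmod (z j))%:C != 0 :> R[i].
  by rewrite fmorph_eq0 gt_eqF// cmod_gt0 wedge_neq0.
elim: k => [|k IH]; first by rewrite /turn big_ord0 expi0 mulr1 divfK.
rewrite turnS// (period_mod k (fun k => angle_period k per)).
have := polar (slit_ratio (pos k)); rewrite -/(angle z k).
have : z k.+1 = z k * (z k.+1 / z k) by rewrite mulrC divfK// wedge_neq0.
move: (z k.+1 / z k) => q -> qE; rewrite {1}qE {1}IH cmodM rmorphM/=; ring.
Qed.

(** The spokes are multiplied by a: the angles stay, the frame is rotated, and the weights are
    divided by |a|, which cancels in [skew]. *)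
Lemma pentagon_chart_Aff w h : LSP w -> Aff h ->
  pentagon_chart (map_mx h w) = pentagon_chart w.
Proof.
move=> Lw [a [b [a0 /funext ->]]].
have [cw pos sw] := LSP_spoke Lw; have per := spoke_period w.
have sE : spoke (map_mx (fun y => a * y + b) w) =
    fun k => a * (1%:C * spoke w k).
  by apply/funext => k; rewrite spoke_Aff// mul1r.
have weightE k : weight (fun k => a * (1%:C * spoke w k)) k =
    weight (spoke w) k * (cmod a)^-1.
  by rewrite (weight_scale pos (r := fun=> 1)) ?mulr1.
have frameE k : frame (fun k => a * (1%:C * spoke w k)) k =
    a / (cmod a)%:C * frame (spoke w) k.
  exact: (frame_scale pos (r := fun=> 1)).
have ca : 0 < cmod a by rewrite cmod_gt0.
have a1 : cmod (a / (cmod a)%:C) = 1.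
  by rewrite cmodM cmodV cmod_real ?cmod_ge0// mulfV// gt_eqF.
have gramE : gram (fun k => a * (1%:C * spoke w k)) = gram (spoke w).
  exact: gram_scale a1 frameE.
have offsetE : offset (fun k => a * (1%:C * spoke w k)) = offset (spoke w).
  by apply/funext => k; rewrite /offset /angle !mul1r -mulf_div divff// mul1r.
have skewE : skew (fun k => a * (1%:C * spoke w k)) = skew (spoke w).
  apply/funext => k; rewrite /skew (eq_min5 (fun k _ => weightE k)) !weightE.
  rewrite min5M ?invr_ge0 ?(ltW ca)// -mulrBl -mulf_div divff ?mulr1//.
  by rewrite invr_eq0 gt_eqF.
by apply/rowP => j; rewrite !mxE /pentagon_coord sE gramE offsetE skewE.
Qed.

Lemma cvg_pentagon_chart (X : set_system 'rV[R[i]^o]_5) w : Filter X -> LSP w ->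
  X --> w -> pentagon_chart M @[M --> X] --> pentagon_chart w.
Proof.
move=> FX Lw Xw; have [cw pos sw] := LSP_spoke Lw; have per := spoke_period w.
have cz k : spoke M k @[M --> X] --> spoke w k by exact: cvg_spoke.
have co k : offset (spoke M) k @[M --> X] --> offset (spoke w) k.
  apply: cvgB; last exact: cvg_cst.
  apply: cvg_arg; first exact: slit_ratio.
  apply: cvg_complexM; first exact: cz.
  by apply: cvg_complexV; [exact: wedge_neq0|exact: cz].
have g1 : angle_gauge (offset (spoke w)) < 1.
  apply/angle_gauge_lt1 => k _; rewrite /offset subrK.
  exact: cross_arg_bound (wedge_neq0 (pos k)) (pos k).
have cg : ((1 - angle_gauge (offset (spoke M)))^-1 : R) @[M --> X] -->
    (1 - angle_gauge (offset (spoke w)))^-1.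
  apply: cvgV; first by rewrite gt_eqF// subr_gt0.
  by apply: cvgB; [exact: cvg_cst|exact: cvg_angle_gauge].
have cf k : flat_dev (gram (spoke M)) (skew (spoke M)) k @[M --> X] -->
    flat_dev (gram (spoke w)) (skew (spoke w)) k.
  apply: cvg_flat_dev.
  - by move=> i j; exact: cvg_gram.
  - exact: sum3_positive_excess per pos.
  - by move=> j; exact: cvg_skew.
apply: (@cvg_row R 6 _ X FX (@pentagon_coord R) (pentagon_coord w)) => -[|[|[|[|[|[|//]]]]]] _; rewrite /pentagon_coord/=.
- by apply: cvgM; [exact: co|exact: cg].
- by apply: cvgM; [exact: co|exact: cg].
- by apply: cvgM; [exact: co|exact: cg].
- by apply: cvgM; [exact: co|exact: cg].
- exact: cf.
- exact: cf.
Qed.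

Lemma cvg_pentagon_model (X : set_system 'rV[R]_6) x : Filter X -> X --> x ->
  pentagon_model M @[M --> X] --> pentagon_model x.
Proof.
move=> FX Xx.
have cx (k : 'I_6) : M 0 k @[M --> X] --> x 0 k by exact: cvg_coord.
have co k : model_offset M k @[M --> X] --> model_offset x k.
  rewrite /model_offset; case: k => [|[|[|[|[|k]]]]] /=; try exact: cx.
    by apply: cvgN; apply: cvgD; [apply: cvgD; [apply: cvgD|]|]; exact: cx.
  by rewrite nth_nil; exact: cvg_cst.
have ca k : model_angle M k @[M --> X] --> model_angle x k.
  apply: cvgD; last exact: cvg_cst.
  apply: cvgM; first exact: co.
  apply: cvgV; first exact: model_gauge_neq0.
  by apply: cvgD; [exact: cvg_cst|exact: cvg_angle_gauge].
have ct k : model_turn M k @[M --> X] --> model_turn x k by exact: cvg_turn.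
have cf k : model_flat M k @[M --> X] --> model_flat x k.
  rewrite /model_flat; case: k => [|[|[|[|[|k]]]]] /=; try exact: cx; try exact: cvg_cst.
  by apply: cvgN; apply: cvgD; exact: cx.
have pos := wedge_model_turn x; have per := turn_period (model_angle x).
have cd k : (k < 5)%N -> model_dev M k @[M --> X] --> model_dev x k.
  move=> k5; apply: cvg_dev => //.
  - by move=> i j; exact: cvg_gram.
  - exact: sum3_excess_sqr per pos.
apply: (@cvg_rowc R 5 _ X FX (@model_spoke R) (model_spoke x)) => k _.
apply: cvg_complexM; last exact: cvg_frame.
apply: cvg_complex; last exact: cvg_cst.
by apply: cvgV; [rewrite gt_eqF// mass_gt0|exact: cvg_mass].
Qed.

(** The angles give back the frame up to the rotation u, and the fibre coordinates give back the
    weights divided by their minimum mu; scaling the model by u / mu and moving it to the center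
    recovers w. *)
Lemma pentagon_modelK w : LSP w ->
  exists2 h, Aff h & w = map_mx h (pentagon_model (pentagon_chart w)).
Proof.
move=> Lw; have [cw pos sw] := LSP_spoke Lw; have per := spoke_period w.
set x := pentagon_chart w; pose z := spoke w; pose e := turn (angle z).
have g1 : angle_gauge (offset z) < 1.
  apply/angle_gauge_lt1 => k _; rewrite /offset subrK.
  exact: cross_arg_bound (wedge_neq0 (pos k)) (pos k).
have xE k : (k < 6)%N -> x 0 (inord k) = pentagon_coord w k.
  by move=> k6; rewrite /x mxE inordK.
have offE k : (k < 5)%N -> model_offset x k = offset z k * (1 - angle_gauge (offset z))^-1.
  have sumo : offset z 0 + offset z 1 + offset z 2 + offset z 3 = - offset z 4.
    move: sw; rewrite !big_ord_recr big_ord0/= add0r /offset -/z => sw.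
    by apply/eqP; rewrite -subr_eq0 opprK; apply/eqP; lra.
  move: k; apply: nat5_ind; rewrite /model_offset/= !xE//= -/z.
  by rewrite -!mulrDl sumo mulNr opprK.
have angE k : (k < 5)%N -> model_angle x k = angle z k.
  move=> k5; rewrite /model_angle (eq_angle_gauge offE) angle_gaugeM; last first.
    by rewrite invr_ge0 subr_ge0 ltW.
  by rewrite offE// gauge_out// /offset subrK.
have turnE : model_turn x = e.
  apply/funext => k; rewrite /model_turn /e /turn; congr expi.
  apply: eq_bigr => j _; apply: angE; apply: ltn_trans (ltn_ord j) _.
  by rewrite ltn_mod.
pose u : R[i] := z 0%N / (cmod (z 0%N))%:C.
have z0 : z 0%N != 0 by exact: wedge_neq0.
have u1 : cmod u = 1.
  by rewrite cmodM cmodV cmod_real ?cmod_ge0// mulfV// gt_eqF// cmod_gt0.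
have u0 : u != 0 by rewrite -cmod_gt0 u1.
have epos k : 0 < wedge e k by rewrite -turnE; exact: wedge_model_turn.
have frameE k : frame z k = u * frame e k.
  have -> : z = fun k => u * ((cmod (z k))%:C * e k).
    by apply/funext => j; exact: polar_turn.
  rewrite (frame_scale epos (r := fun k => cmod (z k)))// ?u1 ?rmorph1 ?divr1//.
  by move=> j; rewrite cmod_gt0 wedge_neq0.
have gramE : gram e = gram z by rewrite (gram_scale u1 frameE).
have flatE k : (1 < k < 5)%N -> model_flat x k = flat_dev (gram z) (skew z) k.
  have := sum3_flat_dev (skew z) (lt0r_neq0 (sum3_positive_excess per pos)).
  rewrite /sum3 -/z => s3.
  case: k => [|[|[|[|[|//]]]]]// _; rewrite /model_flat/= !xE//= -/z.
  by apply/eqP; rewrite eq_sym -subr_eq0 opprK addrC s3.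
have devE k : (k < 5)%N -> model_dev x k = skew z k.
  move=> k5; rewrite /model_dev turnE gramE (eq_dev _ flatE).
  apply: dev_flat_dev => //; first exact: sum_skew.
  have := @barrier_frame R (vertex w) (pentagon_center w) per pos.
  rewrite cw.2 => /esym E.
  transitivity (((min5 (weight z))^-1)%:C * \sum_(k < 5) (weight z k.+4 - weight z k.+1)%:C *
     frame z k); last by rewrite E mulr0.
  by rewrite mulr_sumr; apply: eq_bigr => j _; rewrite /skew rmorphM/=; ring.
set mu := min5 (weight z).
have mu0 : 0 < mu by exact: min5_weight_gt0.
have spokeE k : (k < 5)%N -> u / mu%:C * model_spoke x k = z k.
  move=> k5; rewrite /model_spoke (mass_skew per pos devE k5) turnE -/mu.
  have -> : frame e k = u^-1 * frame z k by rewrite frameE mulKf.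
  have wk : (weight z k)%:C != 0 :> R[i] by rewrite fmorph_eq0 gt_eqF// weight_gt0.
  have muC : mu%:C != 0 :> R[i] by rewrite fmorph_eq0 gt_eqF.
  rewrite invf_div fmorph_div/= /frame; field.
  by rewrite wk muC u0.
exists (fun y => u / mu%:C * y + pentagon_center w).
  exists (u / mu%:C), (pentagon_center w); split=> //.
  by rewrite mulf_neq0// invr_eq0 fmorph_eq0 gt_eqF.
apply: eq_vertex => k k5; rewrite vertex_map// vertex_row// spokeE//.
by rewrite /z /spoke subrK.
Qed.

Lemma pentagon_homeomorphic : homeomorphic (LSP_mod_Aff R 5) 'rV[R]_6.
Proof.
apply: (@LSP_quotient_homeomorphic R 5 6 (@pentagon_chart R) (@pentagon_model R)).
- exact: cvg_pentagon_chart.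
- exact: cvg_pentagon_model.
- exact: pentagon_chart_Aff.
- exact: LSP_model.
- exact: pentagon_chartK.
- exact: pentagon_modelK.
Qed.

End PentagonHomeomorphism.

Close Scope complex_scope.
Close Scope ring_scope.
Close Scope classical_set_scope.

Theorem corollary1p2 (R : realType) (n : nat) (hn : n \in [:: 3; 4; 5]) :
  homeomorphic (LSP_mod_Aff R n) 'rV[R]_(2 * n - 4).
Proof.
move: hn; rewrite !inE => /or3P[] /eqP ->.
- exact: triangle_homeomorphic.
- exact: quadrilateral_homeomorphic.
- exact: pentagon_homeomorphic.
Qed.
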